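(* The decision problem Hunting — given a graph $G$ and $m\in\mathbb{N}_{>0}$, decide whether $\text{hn}(G)\le m$ — is NP-hard even on bipartite graphs. Moreover, there exists an infinite family of graphs for which shortest winning $\text{hn}(G)$-hunter-strategies have length superpolynomial in the respective graph sizes.
   Context: All graphs are finite, simple and undirected. In the Rabbit and Hunter game on $G=(V,E)$, an $m$-hunter-strategy of length $T$ is a sequence $(F_1,\dots,F_T)$ of subsets of $V$ with $|F_i|\le m$; the possible rabbit positions are $B_0=V$ and, for $t\ge1$, $B_t$ = the set of nodes adjacent to at least one node of $B_{t-1}\setminus F_t$ (with $F_t=\emptyset$ for $t>T$), i.e., the rabbit is forced to move to a neighbouring node each round. The strategy is winning if $B_T=\emptyset$. $\text{hn}(G)$ is the smallest $m$ for which a winning $m$-hunter-strategy exists. *)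

(* Defs.v *)
From mathcomp Require Import all_boot.
From mathcomp Require Import boolp.

Set Implicit Arguments.
Unset Strict Implicit.
Unset Printing Implicit Defensive.

Record sgraph := SGraph {
  vertex :> finType;
  edge : rel vertex;
  edge_sym : symmetric edge;
  edge_irr : irreflexive edge }.

Definition bipartite (G : sgraph) : Prop :=
  exists A : {set G}, forall x y : G, edge x y -> (x \in A) != (y \in A).

Definition rabbit_move (G : sgraph) (B : {set G}) : {set G} :=
  [set y | [exists x in B, edge x y]].

(** The set [F_t] shot at in round [t >= 1] is [nth set0 s t.-1]: it is empty for
    [t > size s]. *)
Fixpoint rabbit_positions (G : sgraph) (s : seq {set G}) (t : nat) : {set G} :=
  if t is t'.+1 then rabbit_move (rabbit_positions s t' :\: nth set0 s t')
  else setT.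

Definition hunter_strategy (G : sgraph) (m : nat) (s : seq {set G}) : Prop :=
  forall F, F \in s -> #|F| <= m.

Definition winning (G : sgraph) (m : nat) (s : seq {set G}) : Prop :=
  hunter_strategy m s /\ rabbit_positions s (size s) = set0.

Definition shortest_winning (G : sgraph) (m : nat) (s : seq {set G}) : Prop :=
  winning m s /\ forall s' : seq {set G}, winning m s' -> size s <= size s'.

Lemma ex_winning (G : sgraph) :
  exists m, `[< exists s : seq {set G}, winning m s >].
Proof.
exists #|G|; apply/asboolP; exists [:: setT]; split=> [F _|]; first exact: max_card.
by apply/setP=> y; rewrite !inE; apply/existsP=> -[x]; rewrite !inE.
Qed.

Definition hn (G : sgraph) : nat := ex_minn (ex_winning G).

Inductive move := Left | Stay | Right.

(** [None] is the blank, [Some (inl b)] a bit, and [Some (inr g)] an auxiliary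
    tape symbol. *)
Definition symbol (Gamma : finType) : Type := option (bool + Gamma).

(** There are [ntapes.+1] tapes: [ord0] carries the input and [ord_max] the
    output (they coincide when [ntapes = 0]). *)
Record machine := Machine {
  ntapes : nat;
  aux : finType;
  state : finType;
  start : state;
  halt : pred state;
  delta : state -> {ffun 'I_ntapes.+1 -> symbol aux} ->
          state * ('I_ntapes.+1 -> symbol aux * move) }.

(** A two-way infinite tape: the cells strictly to the left of the head, the
    nearest first, and the cells from the head rightwards; all the cells that
    are not listed are blank. *)
Definition tape (Gamma : finType) : Type :=
  seq (symbol Gamma) * seq (symbol Gamma).

Definition read (Gamma : finType) (t : tape Gamma) : symbol Gamma :=
  head None t.2.

Definition write_move (Gamma : finType) (t : tape Gamma)
    (a : symbol Gamma * move) : tape Gamma :=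
  let: (s, d) := a in
  let r := behead t.2 in
  match d with
  | Left => (behead t.1, head None t.1 :: s :: r)
  | Stay => (t.1, s :: r)
  | Right => (s :: t.1, r)
  end.

Definition config (M : machine) : Type :=
  state M * ('I_(ntapes M).+1 -> tape (aux M)).

Definition init (M : machine) (w : seq bool) : config M :=
  (start M, fun i => ([::], if i == ord0 then [seq Some (inl b) | b <- w]
                            else [::])).

Definition step (M : machine) (c : config M) : config M :=
  if halt c.1 then c else
  let: (q, a) := delta c.1 [ffun i => read (c.2 i)] in
  (q, fun i => write_move (c.2 i) (a i)).

Fixpoint bit_prefix (Gamma : finType) (s : seq (symbol Gamma)) : seq bool :=
  if s is Some (inl b) :: s' then b :: bit_prefix s' else [::].

Definition output (M : machine) (c : config M) : seq bool :=
  bit_prefix (c.2 ord_max).2.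

(** Every polynomial in [n] is bounded by [n ^ c + c] for some [c]; since
    halted configurations are fixed by [step], this says that the machine halts
    within that many steps. *)
Definition polytime (f : seq bool -> seq bool) : Prop :=
  exists (M : machine) (c : nat), forall w : seq bool,
    let final := iter (size w ^ c + c) (@step M) (init M w) in
    halt final.1 /\ output final = f w.

(** Self-delimiting: the bits of [w] are doubled, then [10], then [u]. *)
Definition pair_code (w u : seq bool) : seq bool :=
  flatten [seq [:: b; b] | b <- w] ++ [:: true, false & u].

Definition language := seq bool -> Prop.

Definition inNP (L : language) : Prop :=
  exists (V : seq bool -> bool) (c : nat),
    polytime (fun x => [:: V x]) /\
    forall w, L w <->
      exists u, size u <= size w ^ c + c /\ V (pair_code w u).

Record problem := Problem {
  instance : Type;
  encode : instance -> seq bool;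
  yes : instance -> Prop }.

Definition restrict (Q : problem) (D : instance Q -> Prop) : problem :=
  @Problem {x | D x} (fun x => encode (sval x)) (fun x => yes (sval x)).

Definition reduces (L : language) (Q : problem) : Prop :=
  exists f : seq bool -> instance Q,
    polytime (fun w => encode (f w)) /\ forall w, L w <-> yes (f w).

Definition NP_hard (Q : problem) : Prop :=
  forall L : language, inNP L -> reduces L Q.

Record hunting_instance := HuntingInstance {
  hunting_graph : sgraph;
  hunters : nat;
  hunters_gt0 : 0 < hunters }.

(** Binary expansion, least significant bit first. *)
Definition binary (m : nat) : seq bool :=
  mkseq (fun i => odd (m %/ 2 ^ i)) (trunc_log 2 m).+1.

Definition adjacency (G : sgraph) : seq bool :=
  [seq edge x y | x <- enum G, y <- enum G].

(** The number of vertices in unary, ended by [false], then the adjacency matrix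
    row by row, then the number of hunters in binary. *)
Definition encode_hunting (x : hunting_instance) : seq bool :=
  nseq #|hunting_graph x| true ++ false ::
  adjacency (hunting_graph x) ++ binary (hunters x).

Definition Hunting : problem :=
  @Problem hunting_instance encode_hunting
    (fun x => hn (hunting_graph x) <= hunters x).

(** There are finitely many graphs of each order up to isomorphism, so a family
    is infinite up to isomorphism iff its members have unbounded order. *)
Definition infinite_family (Fam : sgraph -> Prop) : Prop :=
  forall n : nat, exists G : sgraph, Fam G /\ n < #|G|.

(* Main.v *)
(* Let a bipartite graph be given by the complement [H] of its edges.  A vertex is
   clean after a round iff it is a common [H]-neighbour of the set [D] of dirty
   vertices that were not shot; if the sides have [m + d] vertices, [m] hunters can
   make [D] any set with [|C| + |D| = d], where [C] is the old clean set.  So a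
   clean set can grow beyond size [a] only through a biclique [K_{a, d + 1 - a}]
   of [H], or its transpose.

   A half graph provides such bicliques for all [a], and removing suitable pairs
   from it leaves two dual levels that can be passed only through a biclique
   encoding a clique of another graph.  This reduces Clique to Hunting, and
   computation tableaux of a verifier are encoded as cliques.

   If the two levels require prescribed different cliques, then the hunters have
   to walk from one clique to the other through cliques differing in one vertex.
   Such a walk can simulate the Chinese rings puzzle, whose solution takes
   exponentially many steps. *)
Require Import Defs.
From mathcomp Require Import all_boot boolp zify.

Set Implicit Arguments.
Unset Strict Implicit.
Unset Printing Implicit Defensive.

(** The long games require a level at which the hunters can linger. A growing clean set uses
    bicliques with [d + 1] vertices, while [d] vertices suffice to keep its size. The level is
    therefore tuned to the shape [K_{L, K^2}] with [L + K^2 = d]: a clique of size [k] yields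
    [L = k (k - 1)] ordered pairs against [K^2] common neighbours, enough to hold the level but not
    to cross it. The missing vertex is supplied by [yf] only over the clique [Se] and by [xg] only
    over [Sx]. For NP-hardness nothing has to be held: [k^2] pairs, diagonal included, and the
    [#|U| - k] remaining vertices already sum to [d + 1]. Polynomial time refers to concrete
    multi-tape machines. The reduction is written in a small imperative language compiled to them:
    loop bounds are unary counters on tapes, and whatever depends only on the verifier is unrolled
    into the finite control. The tableau stores the tapes relative to their heads, so that one fixed
    column holds all the symbols read and a head move becomes a shift of the row. *)

Section Play.
Variable G : sgraph.
Implicit Types (R : {set G}) (s : seq {set G}).

Definition play s R := foldl (fun B F => rabbit_move (B :\: F)) R s.

Lemma rabbit_moveP R y :
  reflect (exists2 x, x \in R & edge x y) (y \in rabbit_move R).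
Proof.
rewrite inE; apply: (iffP existsP) => [[x /andP[]]|[x xR xy]]; first by exists x.
by exists x; rewrite xR.
Qed.

Lemma rabbit_moveU R1 R2 :
  rabbit_move (R1 :|: R2) = rabbit_move R1 :|: rabbit_move R2.
Proof.
apply/setP=> y; rewrite !inE; apply/idP/idP.
  by case/existsP=> x; rewrite inE andb_orl; case/orP=> h;
    apply/orP; [left|right]; apply/existsP; exists x.
by case/orP=> /existsP[x /andP[xR xy]]; apply/existsP; exists x;
  rewrite inE xR xy ?orbT.
Qed.

(** Positions evolve independently of each other. Hence the two sides of a bipartite graph can be
    treated one after the other, and positions can be discarded in favour of the hunters. *)
Lemma playU s R1 R2 : play s (R1 :|: R2) = play s R1 :|: play s R2.
Proof.
elim: s R1 R2 => //= F s IH R1 R2.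
by rewrite -IH setDUl rabbit_moveU.
Qed.

Lemma playS s R1 R2 : R1 \subset R2 -> play s R1 \subset play s R2.
Proof. by move/setUidPr=> <-; rewrite playU subsetUl. Qed.

Lemma play_cat s1 s2 R : play (s1 ++ s2) R = play s2 (play s1 R).
Proof. by rewrite /play foldl_cat. Qed.

Lemma rabbit_positions_play s : rabbit_positions s (size s) = play s setT.
Proof.
have H t : t <= size s -> rabbit_positions s t = play (take t s) setT.
  elim: t => [|t IH] lt /=; first by rewrite take0.
  rewrite (take_nth set0) // -cats1 play_cat /= IH //; exact: ltnW.
by rewrite H // take_size.
Qed.

Lemma hn_leP m :
  reflect (exists s : seq {set G}, winning m s) (hn G <= m).
Proof.
apply: (iffP idP).
  rewrite /hn; case: ex_minnP => m0 /asboolP [s [hs ws]] _ le.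
  by exists s; split=> // F Fs; apply: leq_trans (hs F Fs) le.
by move=> ex; rewrite /hn; case: ex_minnP => m0 _; apply; apply/asboolP.
Qed.

End Play.

(** * Dense bipartite graphs *)

Section Dense.
Variables (X Y : finType) (H : X -> Y -> bool).

Definition dense_edge (a b : X + Y) : bool :=
  match a, b with
  | inl x, inr y | inr y, inl x => ~~ H x y
  | _, _ => false
  end.

Lemma dense_edge_sym : symmetric dense_edge.
Proof. by case=> x [] y. Qed.

Lemma dense_edge_irr : irreflexive dense_edge.
Proof. by case. Qed.

Definition dense_graph : sgraph := SGraph dense_edge_sym dense_edge_irr.

Lemma dense_bipartite : bipartite dense_graph.
Proof.
exists [set a : X + Y | if a is inl _ then true else false].
by case=> x [] y //= _; rewrite !inE.
Qed.

Definition cnY (D : {set X}) : {set Y} := [set y | [forall x in D, H x y]].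
Definition cnX (D : {set Y}) : {set X} := [set x | [forall y in D, H x y]].

Lemma cnYP (D : {set X}) y : reflect (forall x, x \in D -> H x y) (y \in cnY D).
Proof. by rewrite inE; apply: (iffP forall_inP). Qed.

Lemma cnXP (D : {set Y}) x : reflect (forall y, y \in D -> H x y) (x \in cnX D).
Proof. by rewrite inE; apply: (iffP forall_inP). Qed.

Definition posX (C : {set X}) : {set dense_graph} := [set inl x | x in ~: C].
Definition posY (C : {set Y}) : {set dense_graph} := [set inr y | y in ~: C].

Lemma in_posX C x : ((inl x : dense_graph) \in posX C) = (x \notin C).
Proof. by rewrite mem_imset ?inE // => a b []. Qed.
Lemma in_posY C y : ((inr y : dense_graph) \in posY C) = (y \notin C).
Proof. by rewrite mem_imset ?inE // => a b []. Qed.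
Lemma in_posXr C y : ((inr y : dense_graph) \in posX C) = false.
Proof. by apply/imsetP=> -[]. Qed.
Lemma in_posYl C x : ((inl x : dense_graph) \in posY C) = false.
Proof. by apply/imsetP=> -[]. Qed.

Variables m d : nat.
Hypotheses (cardX : #|X| = m + d) (cardY : #|Y| = m + d).

Section Evasion.
Variables (IX : nat -> {set X} -> Prop) (IY : nat -> {set Y} -> Prop).
Hypothesis IX0 : IX 0 set0.
Hypothesis IXY : forall t (C D : {set X}), IX t C -> [disjoint D & C] ->
  d <= #|C| + #|D| -> IY t.+1 (cnY D).
Hypothesis IYX : forall t (C D : {set Y}), IY t C -> [disjoint D & C] ->
  d <= #|C| + #|D| -> IX t.+1 (cnX D).

(** Positions on the other side are ignored, which only helps the hunters; all of the current side
    outside [C] stays possible. When no position is left, the tracked set [C] must be a whole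
    side. *)
Lemma play_invariant (s : seq {set dense_graph}) : hunter_strategy m s ->
  forall t (R : {set dense_graph}), play s R = set0 ->
  (forall C, IX t C -> posX C \subset R ->
     IX (t + size s) setT \/ IY (t + size s) setT) /\
  (forall C, IY t C -> posY C \subset R ->
     IX (t + size s) setT \/ IY (t + size s) setT).
Proof.
elim: s => [|F s IH] hs t R /= playR.
  split=> C IC; rewrite playR subset0 => /eqP P0; rewrite addn0.
    left; suff -> : [set: X] = C by [].
    apply/setP=> x; rewrite inE; have := in_posX C x.
    by rewrite P0 inE => /esym/negbFE.
  right; suff -> : [set: Y] = C by [].
  apply/setP=> x; rewrite inE; have := in_posY C x.
  by rewrite P0 inE => /esym/negbFE.
have hs' : hunter_strategy m s by move=> E Es; apply: hs; rewrite inE Es orbT.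
have leF : #|F| <= m by apply: hs; rewrite inE eqxx.
rewrite addnS -addSn; have [IHX IHY] := IH hs' t.+1 _ playR.
split=> C IC sub.
  (* [D] is what survives the shots outside [C]; at most [m] of the [m + d] vertices of a side are
     shot, whence [d <= #|C| + #|D|]. *)
  pose D := [set x | x \notin C] :\: [set x | (inl x : dense_graph) \in F].
  apply: (IHY (cnY D)).
    apply: (IXY IC).
      by rewrite disjoint_subset; apply/subsetP=> x; rewrite !inE; case/andP.
    have : #|[set x | (inl x : dense_graph) \in F]| <= #|F|.
      rewrite -(card_imset (mem [set x | (inl x : dense_graph) \in F])
        (f := inl : X -> dense_graph)); last by move=> a b [].
      by apply/subset_leq_card/subsetP=> _ /imsetP[x xF ->]; rewrite inE in xF.
    have := cardsC C; have := cardsD [set x | x \notin C]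
      [set x | (inl x : dense_graph) \in F]; rewrite -/D.
    have -> : [set x | x \notin C] = ~: C by apply/setP=> x; rewrite !inE.
    have := subset_leq_card (subsetIr (~: C) [set x | (inl x : dense_graph) \in F]).
    rewrite cardX; lia.
  apply/subsetP=> _ /imsetP[y yD ->]; rewrite !inE in yD.
  move: yD; rewrite negb_forall; case/existsP=> x.
  rewrite negb_imply => /andP[xD nH]; rewrite !inE in xD; case/andP: xD => xF xC.
  apply/(@rabbit_moveP dense_graph); exists (inl x : dense_graph) => //.
  by rewrite inE xF (subsetP sub) // in_posX.
pose D := [set x | x \notin C] :\: [set x | (inr x : dense_graph) \in F].
apply: (IHX (cnX D)).
  apply: (IYX IC).
    by rewrite disjoint_subset; apply/subsetP=> x; rewrite !inE; case/andP.
  have : #|[set x | (inr x : dense_graph) \in F]| <= #|F|.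
    rewrite -(card_imset (mem [set x | (inr x : dense_graph) \in F])
      (f := inr : Y -> dense_graph)); last by move=> a b [].
    by apply/subset_leq_card/subsetP=> _ /imsetP[x xF ->]; rewrite inE in xF.
  have := cardsC C; have := cardsD [set x | x \notin C]
    [set x | (inr x : dense_graph) \in F]; rewrite -/D.
  have -> : [set x | x \notin C] = ~: C by apply/setP=> x; rewrite !inE.
  have := subset_leq_card (subsetIr (~: C) [set x | (inr x : dense_graph) \in F]).
  rewrite cardY; lia.
apply/subsetP=> _ /imsetP[y yD ->]; rewrite !inE in yD.
move: yD; rewrite negb_forall; case/existsP=> x.
rewrite negb_imply => /andP[xD nH]; rewrite !inE in xD; case/andP: xD => xF xC.
apply/(@rabbit_moveP dense_graph); exists (inr x : dense_graph) => //.
by rewrite inE xF (subsetP sub) // in_posY.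
Qed.

Lemma winning_invariant (s : seq {set dense_graph}) : winning m s ->
  IX (size s) setT \/ IY (size s) setT.
Proof.
case=> hs; rewrite rabbit_positions_play => ps.
have [+ _] := play_invariant hs 0 ps.
by move/(_ set0 IX0); rewrite add0n; apply; apply: subsetT.
Qed.

End Evasion.

(* [caught (inl C)]: the hunters can catch a rabbit that is on the side [X] and
   outside of [C]; they shoot the dirty vertices outside of [D], so that only
   neighbours of [D] are dirty in the next round. *)
Inductive caught : {set X} + {set Y} -> Prop :=
| caughtX : caught (inl setT)
| caughtY : caught (inr setT)
| caughtXY (C D : {set X}) (C' : {set Y}) : [disjoint D & C] ->
    d <= #|C| + #|D| -> C' \subset cnY D -> caught (inr C') -> caught (inl C)
| caughtYX (C D : {set Y}) (C' : {set X}) : [disjoint D & C] ->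
    d <= #|C| + #|D| -> C' \subset cnX D -> caught (inl C') -> caught (inr C).

Definition pos (Z : {set X} + {set Y}) : {set dense_graph} :=
  match Z with inl C => posX C | inr C => posY C end.

Lemma caught_strategy Z : caught Z ->
  exists s : seq {set dense_graph}, hunter_strategy m s /\ play s (pos Z) = set0.
Proof.
elim=> [||C D C' dis le sub _ [s [hs ps]]|C D C' dis le sub _ [s [hs ps]]] /=.
- exists [::]; split=> //=; rewrite /posX setCT; exact: imset0.
- exists [::]; split=> //=; rewrite /posY setCT; exact: imset0.
(* Shooting everything outside [C :|: D] takes [m + d - #|C| - #|D|] shots, at most [m]. *)
- exists (posX (C :|: D) :: s); split.
    move=> F; rewrite inE => /predU1P[->|/hs //].
    rewrite card_imset; last by move=> a b [].
    move: dis; rewrite disjoint_sym -setI_eq0 => /eqP CD0.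
    have := cardsC (C :|: D); rewrite cardX cardsU CD0 cards0; lia.
  apply/eqP; rewrite -subset0 -ps; apply: (@playS dense_graph s); apply/subsetP=> y.
  case/(@rabbit_moveP dense_graph)=> [] [] x; last by rewrite inE !in_posXr.
  rewrite inE !in_posX !inE negb_or negb_and !negbK.
  case/andP=> h xC; rewrite (negPf xC) /= in h.
  case: y => //= y nH; rewrite in_posY; apply: contra nH => /(subsetP sub).
  by move/cnYP; apply.
exists (posY (C :|: D) :: s); split.
  move=> F; rewrite inE => /predU1P[->|/hs //].
  rewrite card_imset; last by move=> a b [].
  move: dis; rewrite disjoint_sym -setI_eq0 => /eqP CD0.
  have := cardsC (C :|: D); rewrite cardY cardsU CD0 cards0; lia.
apply/eqP; rewrite -subset0 -ps; apply: (@playS dense_graph s); apply/subsetP=> y.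
case/(@rabbit_moveP dense_graph)=> [] [] x; first by rewrite inE !in_posYl.
rewrite inE !in_posY !inE negb_or negb_and !negbK.
case/andP=> h xC; rewrite (negPf xC) /= in h.
case: y => //= y nH; rewrite in_posX; apply: contra nH => /(subsetP sub).
by move/cnXP; apply.
Qed.

Lemma play_side (s : seq {set dense_graph}) (R : {set dense_graph}) :
  R \subset posX set0 \/ R \subset posY set0 ->
  play s R \subset posX set0 \/ play s R \subset posY set0.
Proof.
elim: s R => //= F s IH R sR; apply: IH.
case: sR => sR; [right|left]; apply/subsetP=> y /(@rabbit_moveP dense_graph)[x].
  rewrite inE => /andP[_ /(subsetP sR)].
  by case: x => x; rewrite ?in_posXr //; case: y => //= y; rewrite in_posY inE.
rewrite inE => /andP[_ /(subsetP sR)].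
by case: x => x; rewrite ?in_posYl //; case: y => //= y; rewrite in_posX inE.
Qed.

(** A rabbit starting on [Y] survives the strategy for [X] but is then confined to one side, which
    depends on the parity of the rounds played; the strategy for that side finishes. *)
Lemma caught_hn : caught (inl set0) -> hn dense_graph <= m.
Proof.
move=> cX; apply/hn_leP.
(* One round without a shot moves the rabbit from [Y] to [X]. *)
have cY : caught (inr set0).
  apply: (@caughtYX set0 setT set0) => //; last exact: sub0set.
    by rewrite disjoint_sym -setI_eq0 set0I.
  by rewrite cards0 cardsT cardY leq_addl.
have [s1 [h1 p1]] := caught_strategy cX; have [s2 [h2 p2]] := caught_strategy cY.
have [s3 [h3 p3]] : exists s, hunter_strategy m s /\
    play s (play s1 (posY set0)) = set0.
  have [sub|sub] := @play_side s1 (posY set0) (or_intror (subxx _)).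
    by exists s1; split=> //; apply/eqP; rewrite -subset0 -p1; apply: playS.
  by exists s2; split=> //; apply/eqP; rewrite -subset0 -p2; apply: playS.
exists (s1 ++ s3); split; first by move=> F; rewrite mem_cat => /orP[/h1|/h3].
have -> : rabbit_positions (s1 ++ s3) (size (s1 ++ s3)) = set0; last by [].
rewrite rabbit_positions_play play_cat.
have -> : [set: dense_graph] = posX set0 :|: posY set0.
  by apply/setP=> -[] x; rewrite !inE ?in_posX ?in_posY ?in_posXr ?in_posYl !inE.
by rewrite playU [play s1 (posX _)]p1 set0U.
Qed.

End Dense.

Lemma card_ord_ltn n a : a <= n -> #|[set i : 'I_n | i < a]| = a.
Proof.
move=> le; rewrite -[RHS]card_ord -(card_imset _ (f := widen_ord le)); last first.
  by move=> i j /(congr1 val) /= /val_inj.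
congr #|pred_of_set _|; apply/setP=> i; rewrite inE; apply/idP/imsetP => [lt|[j _ ->]].
  by exists (Ordinal lt) => //; apply: val_inj.
exact: (ltn_ord j).
Qed.

Lemma card_ord_geq n a : #|[set i : 'I_n | a <= i]| = n - a.
Proof.
have [le|lt] := leqP a n.
  have := cardsC [set i : 'I_n | i < a]; rewrite card_ord_ltn // card_ord.
  have -> : ~: [set i : 'I_n | i < a] = [set i : 'I_n | a <= i].
    by apply/setP=> i; rewrite !inE -leqNgt.
  lia.
rewrite (eqP (ltnW lt : n - a == 0)); apply/eqP; rewrite cards_eq0; apply/eqP/setP=> i.
by rewrite !inE; apply/negbTE; rewrite -ltnNge; apply: ltn_trans lt.
Qed.

Lemma leq_card_of (A B : finType) (f : A -> B) (S : {set A}) (T : {set B}) :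
  (forall y, y \in T -> exists2 x, x \in S & y = f x) -> #|T| <= #|S|.
Proof.
move=> h; apply: leq_trans (leq_imset_card f (mem S)).
by apply/subset_leq_card/subsetP=> y /h[x xS ->]; apply/imsetP; exists x.
Qed.

Lemma max_of_set n (A : {set 'I_n}) : 0 < #|A| ->
  exists2 i, i \in A & forall j, j \in A -> j <= i.
Proof.
by move/card_gt0P=> [i0 iA]; case: (arg_maxnP (fun i : 'I_n => i : nat) iA) => i; exists i.
Qed.

Lemma min_of_set n (A : {set 'I_n}) : 0 < #|A| ->
  exists2 i, i \in A & forall j, j \in A -> i <= j.
Proof.
by move/card_gt0P=> [i0 iA]; case: (arg_minnP (fun i : 'I_n => i : nat) iA) => i; exists i.
Qed.

(* The bicliques of the half graph [i <= j] have every shape [K_{a, d + 1 - a}];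
   the removed pairs exclude those from which the hunters could pass the level [L]
   or the dual level [d - L]. *)
Section HalfGraph.
Variables d L : nat.
Hypotheses (L_gt0 : 0 < L) (L_lt : L.*2 + 2 < d).

Definition near (a i : nat) := (i.+1 == a) || (i == a).
Definition half (i j : nat) :=
  [&& i <= j, ~~ (near L i && near L j) & ~~ (near (d - L) i && near (d - L) j)].

(** With [i <= j] alone, the rows [i < L] share the [d - L + 1] columns [j >= L - 1]. Removing only
    the pair of indices [L - 1] would still leave [d - L] columns, enough to hold the level; so the
    pairs of [L - 1] and [L] with [L] are removed too. *)
Lemma half_lower (A : {set 'I_d}) : L <= #|A| ->
  #|[set j : 'I_d | [forall i in A, half i j]]| < d - L.
Proof.
move=> leA; have [i iA maxi] := max_of_set (leq_trans L_gt0 leA).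
have leL : L <= i.+1.
  apply: leq_trans leA _; rewrite -(@card_ord_ltn d i.+1) //.
  by apply/subset_leq_card/subsetP=> j /maxi; rewrite inE.
set B := [set _ | _].
suff : B \subset [set j : 'I_d | L.+1 <= j].
  by move/subset_leq_card; rewrite card_ord_geq; lia.
apply/subsetP=> j; rewrite !inE => /forall_inP/(_ i iA); rewrite /half /near.
lia.
Qed.

(** Dirty sets lie on both sides in turn, so [L] columns must be blocked as well as [L] rows. This
    is the origin of the second window at [d - L]. Each window blocks a shape together with its
    transpose, which creates the dual level. *)
Lemma half_upper (B : {set 'I_d}) : L <= #|B| ->
  #|[set i : 'I_d | [forall j in B, half i j]]| < d - L.
Proof.
move=> leB; have [j jB minj] := min_of_set (leq_trans L_gt0 leB).
have leL : L <= d - j.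
  apply: leq_trans leB _; rewrite -card_ord_geq.
  by apply/subset_leq_card/subsetP=> i /minj; rewrite inE.
set A := [set _ | _].
suff : A \subset [set i : 'I_d | i < d - L - 1].
  by move/subset_leq_card; rewrite card_ord_ltn; lia.
apply/subsetP=> i; rewrite !inE => /forall_inP/(_ j jB); rewrite /half /near.
have := ltn_ord j; lia.
Qed.

End HalfGraph.

(** * The puzzle graph: bicliques at the level come from cliques *)

Definition clique (V : finType) (c : rel V) (S : {set V}) :=
  [forall u in S, forall v in S, (u != v) ==> c u v].

Lemma cliqueP (V : finType) (c : rel V) (S : {set V}) :
  reflect (forall u v, u \in S -> v \in S -> u != v -> c u v) (clique c S).
Proof.
apply: (iffP forall_inP) => [h u v uS vS uv|h u uS].
  by have /forall_inP/(_ v vS)/implyP := h u uS; apply.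
by apply/forall_inP=> v vS; apply/implyP; apply: h.
Qed.

Definition offdiag (V : finType) (S : {set V}) : {set V * V} :=
  [set p | [&& p.1 \in S, p.2 \in S & p.1 != p.2]].

Lemma card_offdiag (V : finType) (S : {set V}) :
  #|offdiag S| + #|S| = #|S| * #|S|.
Proof.
rewrite -cardsX -(cardsID [set p | p.1 == p.2] (setX S S)) addnC; congr (_ + _).
  rewrite -(card_imset (mem S) (f := fun u => (u, u))); last by move=> ? ? [].
  apply: eq_card => -[u v]; rewrite in_setI in_setX in_set /=; apply/imsetP/idP.
    by case=> z zS [-> ->]; rewrite zS eqxx.
  by case/andP=> /andP[_ vS] /eqP->; exists v.
apply: eq_card => -[u v]; rewrite in_setD in_setX !in_set /=.
by case: (u == v); rewrite /= ?andbF ?andbT.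
Qed.

Section Puzzle.
Variables (V : finType) (c : rel V) (k0 K e pad : nat) (Se Sx : {set V}).
Let k := k0.+1.
Let L := k * k0.
Let d := K ^ 2 + L.
Hypothesis c_irr : irreflexive c.
Hypothesis cardV : #|V| = K + k.
Hypothesis k0_gt1 : 1 < k0.
Hypothesis card_core : d = #|V| * k0 + e + 1.
Hypothesis card_pad : #|V| ^ 2 + 1 = d + pad.
Hypothesis card_compat : #|[set p : V * V | c p.1 p.2]| < K ^ 2.
Hypothesis K_gt : L + 3 < K ^ 2.
Hypothesis K_gt' : K * k0 + 1 < K ^ 2.
Hypotheses (cardSe : #|Se| = k) (cardSx : #|Sx| = k).
Hypothesis Se_far : 1 < #|Se :\: Sx|.

(** With [k0] copies of each vertex, [k] vertices weigh [k * k0 = L], as much as the ordered pairs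
    of distinct elements of a [k]-set. The [e] test vertices see only compatible pairs. The half
    graph occurs twice because a dirty set has to avoid the clean set left in the other copy. The
    [pad] vertices have no neighbour in [pH] and equalize the sides. *)
Definition pX : finType := ((V * V) + unit + (bool * 'I_d))%type.
Definition pY : finType := ((V * 'I_k0) + ('I_e + unit) + ((bool * 'I_d) + 'I_pad))%type.

Definition pH (x : pX) (y : pY) : bool :=
  match x, y with
  | inl (inl (u, u')), inl (inl (z, _)) => (z != u) && (z != u')
  | inl (inl (u, u')), inl (inr (inl _)) => c u u'
  | inl (inl (u, u')), inl (inr (inr _)) => ~~ ((u == u') && (u \in Se))
  | inl (inr _), inl (inl (z, _)) => z \in Sx
  | inl (inr _), inl (inr (inl _)) => false
  | inl (inr _), inl (inr (inr _)) => true
  | inr (b, i), inr (inl (b', j)) => (b == b') && half d L i j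
  | _, _ => false
  end.

Let m := #|V| ^ 2 + 1 + d.

Lemma card_pX : #|pX| = m + d.
Proof. by rewrite /pX !card_sum !card_prod card_bool card_ord card_unit /m -mulnn; clear; lia. Qed.

Lemma card_pY : #|pY| = m + d.
Proof. rewrite /pY !card_sum !card_prod card_bool !card_ord card_unit /m.
by move: card_core card_pad; clear; lia. Qed.

Local Notation cnY := (@cnY pX pY pH).
Local Notation cnX := (@cnX pX pY pH).

Definition xP (p : V * V) : pX := inl (inl p).
Definition xg : pX := inl (inr tt).
Definition xp (p : bool * 'I_d) : pX := inr p.
Definition yV (p : V * 'I_k0) : pY := inl (inl p).
Definition yt (i : 'I_e) : pY := inl (inr (inl i)).
Definition yf : pY := inl (inr (inr tt)).
Definition yq (p : bool * 'I_d) : pY := inr (inl p).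

Let L_gt0 : 0 < L. Proof. by rewrite muln_gt0 (ltnW k0_gt1). Qed.
Let dL : d - L = K ^ 2. Proof. by rewrite /d addnK. Qed.
Let L_lt : L.*2 + 2 < d. Proof. by rewrite /d; move: K_gt; clear; lia. Qed.

Let L_gt : k0 * k0 + 1 < L.
Proof. by rewrite /L /k mulSn; move: k0_gt1; clear; lia. Qed.
Let K_gt1 : 1 < K.
Proof. by case: K K_gt => [|[|n]] //; rewrite ?exp1n addn3. Qed.
Let K_sq : K.-1 ^ 2 + 1 < K ^ 2.
Proof. clear -K_gt1; rewrite -!mulnn; case: K K_gt1 => // n; nia. Qed.

(** One gadget vertex in [D] confines the common neighbours to its copy of the half graph, and one
    common neighbour in turn confines [D] to that copy, where the removed pairs apply. *)
Lemma gadgetX (D : {set pX}) b i : inr (b, i) \in D -> L <= #|D| ->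
  #|cnY D| < K ^ 2.
Proof.
move=> biD leD; have [C0|] := set_0Vmem (cnY D).
  by rewrite C0 cards0; lia.
case=> y0 y0C; pose A := [set i' | xp (b, i') \in D].
have DA : #|D| <= #|A|.
  apply: (@leq_card_of _ _ (fun i' => xp (b, i'))) => x xD.
  move/cnYP: y0C => h; have := h _ biD; have := h _ xD.
  case: y0 {h} => // -[] // [b' j]; case: x xD => [[[]|]|[b2 i2]] //= xD.
  move=> /andP[/eqP e1 _] /andP[/eqP e2 _]; exists i2; last by rewrite e1 -e2.
  by rewrite inE e2 -e1.
suff : #|cnY D| <= #|[set j : 'I_d | [forall i in A, half d L i j]]|.
  have := half_lower L_gt0 L_lt (leq_trans leD DA); rewrite dL => lt le; apply: leq_ltn_trans le lt.
apply: (@leq_card_of _ _ (fun j => yq (b, j))) => y /cnYP h.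
have := h _ biD; case: y h => // -[] // [b' j] h /= /andP[/eqP <- _].
exists j => //; rewrite inE; apply/forall_inP=> i'; rewrite inE => /h /=.
by case/andP.
Qed.

Lemma gadgetY (D : {set pY}) y : inr y \in D -> L <= #|D| ->
  #|cnX D| < K ^ 2.
Proof.
move=> biD leD; have [C0|] := set_0Vmem (cnX D).
  by rewrite C0 cards0; lia.
case=> y0 y0C; have := cnXP _ _ _ y0C _ biD.
case: y0 y0C => [[[]|]|[b i]] //= y0C; case: y biD => // -[b' j] /= bjD.
case/andP=> /eqP e1; subst b' => _; pose A := [set i' | yq (b, i') \in D].
have DA : #|D| <= #|A|.
  apply: (@leq_card_of _ _ (fun i' => yq (b, i'))) => x xD.
  have := cnXP _ _ _ y0C _ xD; case: x xD => [//|[[b2 i2]|//]] /= xD.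
  by case/andP=> /eqP e1 _; subst b2; exists i2; rewrite ?inE.
suff : #|cnX D| <= #|[set i : 'I_d | [forall j in A, half d L i j]]|.
  have := half_upper L_gt0 L_lt (leq_trans leD DA); rewrite dL => lt le; apply: leq_ltn_trans le lt.
apply: (@leq_card_of _ _ (fun j => xp (b, j))) => y /cnXP h.
have := h _ bjD; case: y h => [[[]|]|[b' i']] //= h /andP[/eqP e1 _]; subst b'.
exists i' => //; rewrite inE; apply/forall_inP=> j'; rewrite inE => /h /=.
by case/andP.
Qed.

(** More than [k0 * k0] pairs span at least [k] vertices, and every spanned vertex costs its [k0]
    copies among the common neighbours. The count is tight only for all off-diagonal pairs of a
    [k]-set, and compatibility is enforced by the test vertices. *)
Lemma coreX (D : {set pX}) : L <= #|D| -> K ^ 2 <= #|cnY D| ->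
  exists2 S : {set V}, [/\ #|S| = k, clique c S, #|D| = L & #|cnY D| <= K ^ 2] &
    (forall u v, xP (u, v) \in D -> (u \in S) && (v \in S)) /\
    (forall u v, u \in S -> v \in S -> u != v -> xP (u, v) \in D) /\
    (forall z i, z \notin S -> yV (z, i) \in cnY D).
Proof.
move=> leD leC.
have nogad b i : inr (b, i) \notin D.
  by apply: contraL leC => /gadgetX/(_ leD); rewrite ltnNge.
(* The gate [xg] sees only the [k * k0 = L] copies of elements of [Sx] and [yf]: fewer than [K ^ 2]
   vertices. *)
have nog : xg \notin D.
  apply: contraL leC => gD; rewrite -ltnNge.
  apply: (@leq_ltn_trans #|[set yV p | p in setX Sx setT] :|: [set yf]|).
    apply/subset_leq_card/subsetP=> y /cnYP/(_ _ gD).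
    case: y => // -[[z i]|[//|[]]] /= zS; rewrite !inE ?eqxx ?orbT //.
    by apply/orP; left; apply/imsetP; exists (z, i); rewrite ?inE ?zS.
  apply: leq_ltn_trans (leq_card_setU _ _) _; rewrite cards1.
  apply: leq_ltn_trans (leq_add (leq_imset_card _ _) (leqnn _)) _.
  rewrite cardsX cardSx cardsT card_ord -/L; lia.
pose A := [set p | xP p \in D].
have DA : #|D| = #|A|.
  apply/eqP; rewrite eqn_leq; apply/andP; split.
    apply: (@leq_card_of _ _ xP) => -[[p|[]]|[b i]] xD.
    - by exists p; rewrite ?inE.
    - by rewrite (negPf nog) in xD.
    - by rewrite (negPf (nogad b i)) in xD.
  rewrite -(card_imset (mem A) (f := xP)); last by move=> ? ? [].
  by apply/subset_leq_card/subsetP=> _ /imsetP[p + ->]; rewrite inE.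
pose S := [set z | [exists p in A, (z == p.1) || (z == p.2)]].
have AS p : p \in A -> (p.1 \in S) && (p.2 \in S).
  move=> pA; rewrite /S 2!in_set; apply/andP.
  by split; apply/exists_inP; exists p; rewrite // eqxx ?orbT.
have cardAS : #|A| <= #|S| * #|S|.
  by rewrite -cardsX; apply/subset_leq_card/subsetP=> -[u v] /AS; rewrite in_setX.
have leS : k <= #|S|.
  rewrite leqNgt; apply/negP=> lt; have : #|S| * #|S| <= k0 * k0 by apply: leq_mul.
  by move: cardAS leD L_gt; rewrite DA; clear; lia.
have cnV z i : yV (z, i) \in cnY D -> z \notin S.
  move/cnYP=> h; apply/negP; rewrite inE => /existsP[[u v]]; rewrite inE.
  by case/andP=> /h /= /andP[/negPf-> /negPf->].
have cardnS : #|~: S| = #|V| - #|S| by rewrite cardsCs setCK.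
(* An incompatible pair loses all the test vertices; at most [K * k0 + 1] common neighbours
   remain. *)
have compA p : p \in A -> c p.1 p.2.
  move=> pA; apply: contraLR leC => nc; rewrite -ltnNge.
  apply: (@leq_ltn_trans #|[set yV p | p in setX (~: S) setT] :|: [set yf]|).
    apply/subset_leq_card/subsetP=> -[[[z i]|[i|[]]]|y] yC.
    - rewrite inE; apply/orP; left; apply/imsetP; exists (z, i) => //.
      by rewrite in_setX in_setC in_setT andbT (cnV z i).
    - move/cnYP: yC; rewrite inE in pA => /(_ _ pA) /=.
      by case: p pA nc => u v /= _ /negPf->.
    - by rewrite !inE eqxx orbT.
    - by move/cnYP: yC; rewrite inE in pA => /(_ _ pA) /=; case: p pA nc.
  apply: leq_ltn_trans (leq_card_setU _ _) _; rewrite cards1.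
  apply: leq_ltn_trans (leq_add (leq_imset_card _ _) (leqnn _)) _.
  rewrite cardsX cardnS cardsT card_ord.
  have : (#|V| - #|S|) * k0 <= K * k0 by apply: leq_mul => //; lia.
  lia.
pose O := offdiag S.
have AO : A \subset O.
  apply/subsetP=> p pA; rewrite in_set; case/andP: (AS p pA) => -> -> /=.
  by apply: contraTneq (compA p pA) => ->; rewrite c_irr.
have cardO := card_offdiag S; rewrite -/O in cardO.
have cnle : #|cnY D| <= (#|V| - #|S|) * k0 + e + 1.
  pose B := [set yV p | p in setX (~: S) setT] :|: [set yt i | i in setT] :|: [set yf].
  apply: (@leq_trans #|B|).
    apply/subset_leq_card/subsetP=> -[[[z i]|[i|[]]]|y] yC.
    - rewrite !inE; apply/orP; left; apply/orP; left; apply/imsetP; exists (z, i) => //.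
      by rewrite in_setX in_setC in_setT andbT (cnV z i).
    - by rewrite !inE; apply/orP; left; apply/orP; right; apply/imsetP; exists i.
    - by rewrite !inE eqxx orbT.
    - have [D0|[x xD]] := set_0Vmem D; first by move: leD; rewrite D0 cards0; lia.
      case: x xD => [[p|[]]|[b i]] xD.
      + by move/cnYP: yC => /(_ _ xD) /=; case: p xD.
      + by rewrite (negPf nog) in xD.
      + by rewrite (negPf (nogad b i)) in xD.
  apply: leq_trans (leq_card_setU _ _) _; rewrite cards1 leq_add2r.
  apply: leq_trans (leq_card_setU _ _) _; apply: leq_add.
    apply: leq_trans (leq_imset_card _ _) _.
    by rewrite cardsX cardnS cardsT card_ord.
  by apply: leq_trans (leq_imset_card _ _) _; rewrite cardsT card_ord.
have SV : #|S| <= #|V| by apply: max_card.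
(* By [card_core] the copies, the test vertices and [yf] number [d] in all. The bound becomes
   [d - #|S| * k0], which equals [K ^ 2] exactly for [#|S| = k]. *)
have cnle2 : #|cnY D| + #|S| * k0 <= d by rewrite card_core mulnBl in cnle *; 
  have := leq_mul SV (leqnn k0); lia.
have Sk : #|S| = k.
  apply/eqP; rewrite eqn_leq leS andbT leqNgt; apply/negP=> lt.
  have : k.+1 * k0 <= #|S| * k0 by apply: leq_mul.
  move: cnle2 leC; rewrite /d /L mulSn; lia.
have kk : k * k = k + L by rewrite /L -mulnS.
have OL : #|O| = L by move: cardO; rewrite Sk kk; lia.
have AOeq : A = O.
  by apply/eqP; rewrite eqEcard AO -DA OL.
exists S; first split=> //.
- apply/cliqueP=> u v uS vS uv; apply: (compA (u, v)).
  by rewrite AOeq in_set /= uS vS.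
- by rewrite DA AOeq.
- by move: cnle2; rewrite Sk /d /L; lia.
split=> [u v uvD|]; first by apply: (AS (u, v)); rewrite inE.
split=> [u v uS vS uv|z i zS].
  have : (u, v) \in A by rewrite AOeq in_set /= uS vS.
  by rewrite inE.
apply/cnYP=> -[[[u v]|[]]|[b j]] xD.
- have /andP[/= uS vS] : ((u, v).1 \in S) && ((u, v).2 \in S).
    by apply: AS; rewrite inE.
  by apply/andP; split; apply: contraNneq zS => ->.
- by rewrite (negPf nog) in xD.
- by rewrite (negPf (nogad b j)) in xD.
Qed.

(** [L] copies need at least [k] vertices, and the common pairs avoid them, so at most [K ^ 2] pairs
    remain. A surplus dirty vertex can only be [yf], which forbids the diagonal pairs of [Se] and so
    forces [S = Se]; a surplus common neighbour can only be [xg], which forces [S = Sx]. *)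
Lemma coreY (D : {set pY}) : L <= #|D| -> K ^ 2 <= #|cnX D| ->
  exists2 S : {set V}, [/\ #|S| = k, L < #|D| -> S = Se &
      S != Sx -> #|cnX D| <= K ^ 2] &
    (forall u v, u \notin S -> v \notin S -> xP (u, v) \in cnX D) /\ (forall z, z \in S -> exists i, yV (z, i) \in D).
Proof.
move=> leD leC.
have nogad y : inr y \notin D.
  by apply: contraL leC => /gadgetY/(_ leD); rewrite ltnNge.
(* A test vertex leaves only the compatible pairs as common neighbours, fewer than [K ^ 2]. *)
have not i : yt i \notin D.
  apply: contraL leC => tD; rewrite -ltnNge; apply: leq_ltn_trans card_compat.
  apply: (@leq_card_of _ _ xP) => x /cnXP/(_ _ tD).
  by case: x => [[[u v]|[]]|[b j]] //= cuv; exists (u, v); rewrite ?inE.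
pose S := [set z | [exists i, yV (z, i) \in D]].
have DS z i : yV (z, i) \in D -> z \in S.
  by move=> h; rewrite inE; apply/existsP; exists i.
have leDS : #|D| <= #|S| * k0 + (yf \in D).
  apply: (@leq_trans #|[set yV p | p in setX S setT] :|: (if yf \in D then [set yf] else set0)|).
    apply/subset_leq_card/subsetP=> -[[[z i]|[i|[]]]|y] yD; rewrite in_setU.
    - by apply/orP; left; apply/imsetP; exists (z, i); rewrite // in_setX in_setT andbT (DS z i).
    - by rewrite (negPf (not i)) in yD.
    - by rewrite yD inE eqxx orbT.
    - by rewrite (negPf (nogad y)) in yD.
  apply: leq_trans (leq_card_setU _ _) _; apply: leq_add.
    by apply: leq_trans (leq_imset_card _ _) _; rewrite cardsX cardsT card_ord.
  by case: ifP; rewrite ?cards1 ?cards0.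
have leS : k <= #|S|.
  rewrite leqNgt; apply/negP=> lt; have : #|S| * k0 <= k0 * k0 by apply: leq_mul.
  by move: leD leDS L_gt; case: (yf \in D); clear; lia.
pose N1 := setX (~: S) (~: S).
have cnsub : cnX D \subset (if S \subset Sx then [set xg] else set0) :|: 
    [set xP p | p in if yf \in D then N1 :\: [set (u, u) | u in Se] else N1].
  apply/subsetP=> x /cnXP h; rewrite in_setU; case: x h => [[[u v]|[]]|[b i]] h.
  - apply/orP; right; apply/imsetP; exists (u, v) => //.
    have uvN : (u, v) \in N1.
      rewrite !inE; apply/andP; split; apply/negP=> /existsP[i /h /=].
        by rewrite eqxx.
      by rewrite eqxx andbF.
    case: ifP => // fD; rewrite inE uvN andbT; have := h _ fD => /=.
    by apply: contra => /imsetP[z zS [-> ->]]; rewrite eqxx.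
  - apply/orP; left; rewrite ifT ?inE //; apply/subsetP=> z.
    by rewrite inE => /existsP[i /h].
  - have /card_gt0P[y yD] : 0 < #|D| by lia.
    have := h _ yD; case: y yD => [//|y] yD.
    by rewrite (negPf (nogad y)) in yD.
have cardN1 : #|N1| = (#|V| - #|S|) ^ 2 by rewrite cardsX cardsCs setCK mulnn.
have cn1 : #|cnX D| <= (S \subset Sx) + #|if yf \in D then N1 :\: [set (u, u) | u in Se] else N1|.
  apply: leq_trans (subset_leq_card cnsub) _.
  apply: leq_trans (leq_card_setU _ _) _; apply: leq_add; last exact: leq_imset_card.
  by case: ifP; rewrite ?cards1 ?cards0.
have cn2 : #|cnX D| <= (S \subset Sx) + #|N1|.
  apply: leq_trans cn1 _; rewrite leq_add2l; case: ifP => // _.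
  exact: (subset_leq_card (subsetDl _ _)).
have Sk : #|S| = k.
  apply/eqP; rewrite eqn_leq leS andbT leqNgt; apply/negP=> lt.
  have le1 : #|V| - #|S| <= K.-1 by rewrite cardV; move: lt; clear; lia.
  have : (#|V| - #|S|) ^ 2 <= K.-1 ^ 2 by rewrite leq_exp2r.
  move: cn2 leC K_sq; rewrite cardN1; case: (S \subset Sx); clear; lia.
have cardN1' : #|N1| = K ^ 2 by rewrite cardN1 cardV Sk addnK.
have SSx : (S \subset Sx) = (S == Sx) by rewrite eqEcard Sk cardSx leqnn andbT.
have fE : yf \in D -> S = Se.
  move=> fD.
  have dcard : #|N1 :\: [set (u, u) | u in Se]| + #|Se :\: S| <= K ^ 2.
    rewrite -cardN1' -(cardsID [set (u, u) | u in Se] N1) addnC leq_add2r.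
    rewrite -(card_imset (mem (Se :\: S)) (f := fun u => (u, u))); last by move=> ? ? [].
    apply/subset_leq_card/subsetP=> _ /imsetP[u + ->]; rewrite in_setD => /andP[uS uSe].
    by rewrite in_setI in_setX !in_setC uS; apply/imsetP; exists u.
  have : #|Se :\: S| <= (S == Sx).
    by move: cn1 leC dcard; rewrite fD SSx; lia.
  (* Over [Sx] the gate [xg] could make up for one lost diagonal pair, but [Se_far] makes at least
     two of them lost. *)
  case: eqP => [eS|_]; first by move: Se_far; rewrite -eS; lia.
  rewrite leqn0 cards_eq0 setD_eq0 => sub; apply/esym/eqP.
  by rewrite eqEcard sub Sk cardSe leqnn.
exists S; first split=> //.
- move=> lt; apply: fE; apply: contraLR lt => nf; move: leDS.
  by rewrite (negPf nf) Sk -/L addn0 -leqNgt.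
- by move=> ne; move: cn2; rewrite SSx (negPf ne) cardN1'.
split=> [u v uS vS|z]; last by rewrite inE => /existsP.
apply/cnXP=> -[[[z i]|[i|[]]]|y] yD /=.
- by apply/andP; split; [apply: contraNneq uS|apply: contraNneq vS] => <-; apply: DS yD.
- by rewrite (negPf (not i)) in yD.
- by rewrite -(fE yD) (negPf uS) andbF.
- by rewrite (negPf (nogad y)) in yD.
Qed.

(** * Lower bound on the number of rounds by a potential *)

Section Potential.
Variable Phi : {set V} -> nat.
Hypothesis Phi_Se : Phi Se = 0.
Hypothesis clique_Se : clique c Se.
Hypothesis Phi_step : forall S S' : {set V}, #|S| = k -> #|S'| = k ->
  clique c S -> clique c S' -> #|S' :\: S| <= 1 -> Phi S' <= (Phi S).+1.

(** A clean set at the level contains everything outside a clique [S], which is what restricts the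
    next dirty set. The potential of [S] bounds the elapsed time from below, so the exit [Sx] is out
    of reach before round [Phi Sx]. *)
Let IX t (C : {set pX}) := t < Phi Sx -> #|C| < K ^ 2 \/
  #|C| <= K ^ 2 /\ exists S : {set V}, [/\ #|S| = k, clique c S, Phi S <= t &
    forall u v, u \notin S -> v \notin S -> xP (u, v) \in C].
Let IY t (C : {set pY}) := t < Phi Sx -> #|C| < K ^ 2 \/
  #|C| <= K ^ 2 /\ exists S : {set V}, [/\ #|S| = k, clique c S, Phi S <= t &
    forall z i, z \notin S -> yV (z, i) \in C].

(** Entering the level from below would leave more than [L] dirty vertices, which [coreX] excludes.
    At the level, the clique can be changed in this kind of round. *)
Lemma puzzle_stepXY t (C D : {set pX}) : IX t C -> [disjoint D & C] ->
  d <= #|C| + #|D| -> IY t.+1 (cnY D).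
Proof.
move=> IC dis le lt; have {}IC := IC (ltnW lt).
have [leC|] := leqP (K ^ 2) #|cnY D|; last by left.
have leD : L <= #|D|.
  by move: le IC; rewrite /d; clear => le [|[]]; lia.
have [S' [cS' qS' DL cle] [_ [inD inC]]] := coreX leD leC; right; split=> //.
case: IC => [ltC|[_ [S [cS qS PS SC]]]]; first by move: le; rewrite /d DL; clear -ltC; lia.
exists S'; split=> //; apply: leq_trans (_ : (Phi S).+1 <= _); last by [].
(* Two distinct new vertices would form a pair that is dirty, being inside [S'], and clean, being
   outside [S]. *)
apply: Phi_step => //; apply/card_le1_eqP=> u v; rewrite !inE.
move=> /andP[uS uS'] /andP[vS vS']; apply/eqP; apply: contraTT isT => uv.
by have := disjointFr dis (inD v u vS' uS' uv); rewrite SC.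
Qed.

(** From below the level the surplus dirty vertex forces [Se], of potential 0. At the level all the
    copies outside [S] are clean, so the dirty copies force [S' = S]. The gate stays closed because
    [Sx] has potential above [t]. *)
Lemma puzzle_stepYX t (C D : {set pY}) : IY t C -> [disjoint D & C] ->
  d <= #|C| + #|D| -> IX t.+1 (cnX D).
Proof.
move=> IC dis le lt; have {}IC := IC (ltnW lt).
have [leC|] := leqP (K ^ 2) #|cnX D|; last by left.
have leD : L <= #|D|.
  by move: le IC; rewrite /d; clear => le [|[]]; lia.
have [S' [cS' SSe ltSx] [inC inD]] := coreY leD leC; right.
suff [qS' PS'] : clique c S' /\ Phi S' <= t.
  split; last by exists S'; split=> //; apply: leq_trans PS' _.
  by apply: ltSx; apply: contraTneq PS' => ->; rewrite -ltnNge ltnW.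
case: IC => [ltC|[_ [S [cS qS PS SC]]]].
  have -> : S' = Se by apply: SSe; move: le; rewrite /d; clear -ltC; lia.
  by rewrite Phi_Se.
suff -> : S' = S by [].
apply/eqP; rewrite eqEcard cS cS' leqnn andbT; apply/subsetP=> z /inD[i ziD].
by apply: contraFT (disjointFr dis ziD); apply: SC.
Qed.

Lemma puzzle_long (s : seq {set dense_graph pH}) : winning m s ->
  Phi Sx <= size s.
Proof.
move=> ws; rewrite leqNgt; apply/negP=> lt.
have IX0 : IX 0 set0 by left; rewrite cards0; clear -K_gt; lia.
have mK : K ^ 2 < m + d by rewrite /d; clear -K_gt; lia.
have := winning_invariant card_pX card_pY IX0 puzzle_stepXY puzzle_stepYX ws.
case=> /(_ lt); rewrite cardsT ?card_pX ?card_pY; clear -mK; lia.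
Qed.

End Potential.

(** * A winning strategy from a walk between the two cliques *)

Local Notation caught := (@caught pX pY pH d).

Definition lowP b a : {set pX} := [set xp (b, i) | i in [set i : 'I_d | i < a]].
Definition highQ b a : {set pY} := [set yq (b, j) | j in [set j : 'I_d | a <= j]].

Lemma card_lowP b a : a <= d -> #|lowP b a| = a.
Proof. by move=> le; rewrite card_imset ?card_ord_ltn // => ? ? []. Qed.
Lemma card_highQ b a : #|highQ b a| = d - a.
Proof. by rewrite card_imset ?card_ord_geq // => ? ? []. Qed.

(** Rounds leaving [X] use copy [false] of the half graph and rounds leaving [Y] copy [true], so the
    vertices just cleaned never meet the next dirty set. *)
Lemma gadget_stepX a b (C : {set pX}) : a <= d -> d <= #|C| + a ->
  (forall i, xp (false, i) \notin C) ->
  (forall i j, i < a -> b <= j < d -> half d L i j) ->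
  caught (inr (highQ false b)) -> caught (inl C).
Proof.
move=> le leC dis ok; apply: (@caughtXY _ _ _ _ C (lowP false a)) => //.
- rewrite disjoint_subset; apply/subsetP=> _ /imsetP[i _ ->]; rewrite inE; exact: dis.
- by rewrite card_lowP.
- apply/subsetP=> _ /imsetP[j + ->]; rewrite inE => lej.
  apply/cnYP=> _ /imsetP[i + ->]; rewrite inE => lti /=.
  by rewrite ok // lej ltn_ord.
Qed.

Lemma gadget_stepY a b (C : {set pY}) : a <= d -> d <= #|C| + a ->
  (forall j, yq (true, j) \notin C) ->
  (forall i j, i < b -> d - a <= j < d -> half d L i j) ->
  caught (inl (lowP true b)) -> caught (inr C).
Proof.
move=> le leC dis ok; apply: (@caughtYX _ _ _ _ C (highQ true (d - a))) => //.
- rewrite disjoint_subset; apply/subsetP=> _ /imsetP[i _ ->]; rewrite inE; exact: dis.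
- by rewrite card_highQ subKn.
- apply/subsetP=> _ /imsetP[j + ->]; rewrite inE => lej.
  apply/cnXP=> _ /imsetP[i + ->]; rewrite inE => lti /=.
  by rewrite ok // lti ltn_ord.
Qed.

Lemma lowP_free b a i : xp (~~ b, i) \notin lowP b a.
Proof. by apply/imsetP=> -[j _ []]; case: b. Qed.
Lemma highQ_free b a j : yq (~~ b, j) \notin highQ b a.
Proof. by apply/imsetP=> -[i _ []]; case: b. Qed.
Lemma lowP_core b a x : inl x \notin lowP b a.
Proof. by apply/imsetP=> -[]. Qed.
Lemma highQ_core b a y : inl y \notin highQ b a.
Proof. by apply/imsetP=> -[]. Qed.

(** Here [a] counts the dirty vertices that have to be left. Below [L] no removed pair interferes,
    and the half graph lowers [a] by one in each round. *)
Lemma caught_low a : a < L ->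
  (forall C : {set pX}, d <= #|C| + a -> (forall i, xp (false, i) \notin C) ->
     caught (inl C)) /\
  (forall C : {set pY}, d <= #|C| + a -> (forall j, yq (true, j) \notin C) ->
     caught (inr C)).
Proof.
elim: a => [|a IH] lt.
  split=> C; rewrite addn0 => leC _.
    apply: (@caughtXY _ _ _ _ C set0 setT); rewrite ?cards0 ?addn0 //; last exact: caughtY.
      by rewrite -setI_eq0 set0I.
    by apply/subsetP=> y _; apply/cnYP=> x; rewrite inE.
  apply: (@caughtYX _ _ _ _ C set0 setT); rewrite ?cards0 ?addn0 //; last exact: caughtX.
    by rewrite -setI_eq0 set0I.
  by apply/subsetP=> y _; apply/cnXP=> x; rewrite inE.
have [IHX IHY] := IH (ltnW lt); have ltd : a.+1 < d by move: lt L_lt; clear; lia.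
split=> C leC dis.
  apply: (@gadget_stepX a.+1 a) => //; first exact: ltnW.
    by move: lt L_lt; rewrite /half /near; clear; lia.
  by apply: IHY => [|j]; [rewrite card_highQ; move: ltd; clear; lia | exact: (highQ_free false)].
apply: (@gadget_stepY a.+1 (d - a)) => //; first exact: ltnW.
  by move: lt L_lt; rewrite /half /near; clear; lia.
apply: IHX => [|j]; last exact: (lowP_free true).
by rewrite card_lowP ?leq_subr //; move: ltd; clear; lia.
Qed.

(** For a clique [S], [dX S] with [cY S] and [dY S] with [cX S] are the bicliques of shape
    [K_{L, K^2}]. The letters stand for dirty and clean at the level with [L] dirty vertices; at the
    dual level the roles are exchanged. *)
Definition cY (S : {set V}) : {set pY} :=
  [set y : pY | match y with inl (inl (z, _)) => z \notin S | inl _ => true | _ => false end].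
Definition cX (S : {set V}) : {set pX} := [set xP p | p in setX (~: S) (~: S)].
Definition dY (S : {set V}) : {set pY} := [set yV p | p in setX S setT].
Definition dX (S : {set V}) : {set pX} := [set xP p | p in offdiag S].

Lemma in_cX S u v : (xP (u, v) \in cX S) = (u \notin S) && (v \notin S).
Proof. by rewrite mem_imset ?in_setX ?in_setC // => ? ? []. Qed.
Lemma in_dY S z i : (yV (z, i) \in dY S) = (z \in S).
Proof. by rewrite mem_imset ?in_setX ?in_setT ?andbT // => ? ? []. Qed.
Lemma in_cY S z i : (yV (z, i) \in cY S) = (z \notin S).
Proof. by rewrite in_set. Qed.

Section Sizes.
Variable S : {set V}.
Hypothesis Sk : #|S| = k.

Lemma card_dY : #|dY S| = L.
Proof. by rewrite card_imset ?cardsX ?cardsT ?card_ord ?Sk // => ? ? []. Qed.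
Lemma card_dX : #|dX S| = L.
Proof.
rewrite card_imset; last by move=> ? ? [].
have kk : k * k = L + k by rewrite /L -mulnSr.
by have /eqP := card_offdiag S; rewrite Sk kk eqn_add2r => /eqP.
Qed.
Lemma card_cX : #|cX S| = K ^ 2.
Proof.
rewrite card_imset; last by move=> ? ? [].
by rewrite cardsX cardsCs setCK Sk cardV addnK mulnn.
Qed.
Lemma card_cY : #|cY S| = K ^ 2.
Proof.
pose A : {set pY} := [set inl y | y in [set: (V * 'I_k0) + ('I_e + unit)]].
have cA : #|A| = d.
  rewrite card_imset; last by move=> ? ? [].
  by rewrite cardsT !card_sum card_prod !card_ord card_unit card_core addnA.
have <- : A :\: dY S = cY S.
  apply/setP=> y; rewrite in_setD; case: y => [y|y]; last first.
    by rewrite [RHS]in_set; apply/andP=> -[_ /imsetP[]].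
  rewrite (_ : inl y \in A) ?andbT; last by apply/imsetP; exists y.
  case: y => [[z i]|y]; first by rewrite (in_dY S z i) in_cY.
  by rewrite [RHS]in_set; apply/imsetP=> -[].
rewrite cardsD (setIidPr _) ?card_dY ?cA ?dL //.
by apply/subsetP=> _ /imsetP[p _ ->]; apply/imsetP; exists (inl p).
Qed.
End Sizes.

Section Walk.
Hypothesis clique_Se : clique c Se.
Definition walk_step (S S' : {set V}) : bool :=
  [&& #|S| == k, #|S'| == k, clique c S, clique c S' & #|S' :\: S| <= 1].
Hypothesis walk : connect walk_step Se Sx.

Lemma walk_step_sym : symmetric walk_step.
Proof.
suff h S S' : walk_step S S' -> walk_step S' S by move=> S S'; apply/idP/idP; apply: h.
case/and5P=> cS cS' qS qS' le; rewrite /walk_step cS cS' qS qS' /=.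
apply: leq_trans le; rewrite !cardsD (eqP cS) (eqP cS') setIC; exact: leqnn.
Qed.

Lemma caught_walk (P : {set V} -> Prop) :
  (forall S S', walk_step S S' -> P S' -> P S) -> P Sx -> P Se.
Proof.
move=> h; suff step p S : path walk_step S p -> P (last S p) -> P S.
  by case/connectP: walk => p pth ->; apply: step.
by elim: p S => //= S' p IH S /andP[SS' /IH{}IH] /IH; apply: h.
Qed.

(** The dual level is traversed from [Sx] to [Se], so being caught propagates from [Se] back to
    [Sx]. *)
Lemma caught_walk_sym (P : {set V} -> Prop) :
  (forall S S', walk_step S S' -> P S -> P S') -> P Se -> P Sx.
Proof.
move=> h; suff step p S : path walk_step S p -> P S -> P (last S p).
  by case/connectP: walk => p pth ->; apply: step.
by elim: p S => //= S' p IH S /andP[/h{}h /IH{}IH] /h.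
Qed.

Lemma disjoint_walk S S' : #|S' :\: S| <= 1 -> [disjoint dX S' & cX S].
Proof.
move=> le; rewrite disjoint_subset; apply/subsetP=> _ /imsetP[[u v] + ->].
rewrite in_set /= => /and3P[uS' vS' uv]; rewrite inE in_cX; apply/negP=> /andP[uS vS].
move/card_le1_eqP: le => /(_ u v); rewrite !inE uS vS uS' vS' => /(_ isT isT) e1.
by rewrite e1 eqxx in uv.
Qed.

Lemma disjoint_dY_cY S : [disjoint dY S & cY S].
Proof.
rewrite disjoint_subset; apply/subsetP=> _ /imsetP[[z i] + ->].
by rewrite in_setX => /andP[zS _]; rewrite inE in_cY zS.
Qed.

Lemma dX_cY S : clique c S -> cY S \subset cnY (dX S).
Proof.
move=> /cliqueP qS; apply/subsetP=> y yC; apply/cnYP=> _ /imsetP[[u v] + ->].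
rewrite in_set /= => /and3P[uS vS uv]; case: y yC => [[[z i]|[i|[]]]|y].
- by rewrite in_cY => zS /=; apply/andP; split; apply: contraNneq zS => ->.
- by move=> _; apply: qS.
- by rewrite /= (negPf uv).
- by rewrite in_set.
Qed.

Lemma cX_dY S : dY S \subset cnY (cX S).
Proof.
apply/subsetP=> _ /imsetP[[z i] + ->]; rewrite in_setX => /andP[zS _].
apply/cnYP=> _ /imsetP[[u v] + ->]; rewrite in_setX !in_setC => /andP[uS vS] /=.
by apply/andP; split; apply: contraTneq zS => ->.
Qed.

Lemma dY_cX S : cX S \subset cnX (dY S).
Proof.
apply/subsetP=> x xC; apply/cnXP=> y yD; apply: (cnYP _ _ _ _ x xC).
exact: (subsetP (cX_dY S)).
Qed.

Lemma cY_dX S : clique c S -> dX S \subset cnX (cY S).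
Proof.
move=> qS; apply/subsetP=> x xC; apply/cnXP=> y yD; apply: (cnYP _ _ _ _ x xC).
exact: (subsetP (dX_cY qS)).
Qed.

(** Over [Sx] the gate [xg] is one more clean vertex, so [L - 1] dirty vertices are enough from then
    on and the half graph takes over. *)
Lemma caught_exit : caught (inr (cY Sx)).
Proof.
apply: (@caughtYX _ _ _ _ _ (dY Sx) (xg |: cX Sx)).
- exact: disjoint_dY_cY.
- by rewrite card_cY // card_dY.
- rewrite subUset dY_cX sub1set andbT; apply/cnXP=> _ /imsetP[[z i] + ->].
  by rewrite in_setX => /andP[].
- have [|h _] := @caught_low L.-1; first by rewrite prednK.
  have gC : xg \notin cX Sx by apply/imsetP=> -[].
  apply: h => [|i]; first by rewrite cardsU1 gC card_cX // /d; move: L_gt0; clear; lia.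
  by rewrite !inE negb_or /=; apply/imsetP=> -[].
Qed.

(** A walk step takes two rounds: [dY S] cleans [cX S]; then [dX S'], disjoint from it since at most
    one vertex is new, cleans [cY S']. *)
Lemma caught_entry : caught (inl (cX Se)).
Proof.
have : caught (inr (cY Se)).
  apply: (caught_walk (P := fun S => caught (inr (cY S)))); last exact: caught_exit.
  move=> S S' /and5P[/eqP cS /eqP cS' qS qS' le] w.
  apply: (@caughtYX _ _ _ _ _ (dY S) (cX S)).
  - exact: disjoint_dY_cY.
  - by rewrite card_cY // card_dY.
  - exact: dY_cX.
  - apply: (@caughtXY _ _ _ _ _ (dX S') (cY S')) => //.
    + exact: disjoint_walk.
    + by rewrite card_cX // card_dX.
    + exact: dX_cY.
apply: (@caughtXY _ _ _ _ _ (dX Se)).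
- by apply: disjoint_walk; rewrite setDv cards0.
- by rewrite card_cX // card_dX.
- exact: dX_cY.
Qed.

(** Descent from the dual level to the level. At [a = L + 1] on [Y] the dirty set is [yf] with the
    copies of [Se], so the core must be free of clean vertices; this explains the alternative. *)
Lemma caught_mid a : L < a < K ^ 2 ->
  (forall C : {set pX}, d <= #|C| + a -> (forall i, xp (false, i) \notin C) ->
     caught (inl C)) /\
  (forall C : {set pY}, d <= #|C| + a -> (forall j, yq (true, j) \notin C) ->
     L.+1 < a \/ (forall y, inl y \notin C) -> caught (inr C)).
Proof.
elim: a => [//|a IH] /andP[La aK].
have ltd : a.+1 < d by move: aK; rewrite /d; clear; lia.
have [eL|neL] := eqVneq a L.
  have wY (C : {set pY}) : d <= #|C| + L.+1 -> (forall y, inl y \notin C) -> caught (inr C).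
    move=> leC dis; apply: (@caughtYX _ _ _ _ _ (yf |: dY Se) (cX Se)).
    - rewrite disjoint_subset; apply/subsetP=> y /setU1P[->|]; first by rewrite inE; apply: dis.
      by case/imsetP=> p _ ->; rewrite inE; apply: dis.
    - have fD : yf \notin dY Se by apply/imsetP=> -[].
      by rewrite cardsU1 fD card_dY.
    - apply/subsetP=> _ /imsetP[[u v] + ->]; rewrite in_setX !in_setC => /andP[uS vS].
      apply/cnXP=> y /setU1P[->|/imsetP[[z i] + ->]]; first by rewrite /= (negPf uS) andbF.
      rewrite in_setX => /andP[zS _] /=.
      by apply/andP; split; apply: contraTneq zS => ->.
    - exact: caught_entry.
  rewrite eL; split=> C leC dis; last first.
    by case=> [|h]; [rewrite ltnn | apply: wY].
  (* On [X] the level cannot be entered. The rows [i <= L] clean the columns [j > L], which keeps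
     the size and passes the turn to [Y]. *)
  apply: (@gadget_stepX L.+1 L.+1) => //; first by move: ltd; rewrite eL => /ltnW.
    by move: L_lt; rewrite /half /near; clear; lia.
  apply: wY => [|y]; last exact: highQ_core.
  by rewrite card_highQ; move: L_lt; clear; lia.
have La' : L < a by rewrite ltn_neqAle eq_sym neL -ltnS.
have [|IHX IHY] := IH; first by rewrite La' ltnW.
have aK' : a.+1 < d - L by rewrite dL.
split=> C leC dis; last move=> _.
  apply: (@gadget_stepX a.+1 a) => //; first exact: ltnW.
    by move: aK' La' L_lt; rewrite /half /near; clear; lia.
  apply: IHY => [|j|]; last by right=> y; exact: highQ_core.
    by rewrite card_highQ; move: ltd; clear; lia.
  exact: (highQ_free false).
apply: (@gadget_stepY a.+1 (d - a)) => //; first exact: ltnW.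
  by move: aK' La' L_lt; rewrite /half /near; clear; lia.
apply: IHX => [|j]; last exact: (lowP_free true).
by rewrite card_lowP ?leq_subr //; move: ltd; clear; lia.
Qed.

(** At the dual level [K ^ 2] dirty vertices clean [L] others. It is left over [Se], where [yf] is
    one more clean vertex, after the walk has been made backwards. *)
Lemma caught_dual : caught (inr (dY Sx)).
Proof.
have w (S' : {set V}) : #|S'| = k -> #|S' :\: Se| <= 1 -> caught (inl (dX S')).
  move=> cS' le; apply: (@caughtXY _ _ _ _ _ (cX Se) (yf |: dY Se)).
  - by rewrite disjoint_sym; apply: disjoint_walk.
  - by rewrite card_cX // card_dX // addnC.
  - rewrite subUset cX_dY sub1set andbT; apply/cnYP=> _ /imsetP[[u v] + ->].
    by rewrite in_setX !in_setC => /andP[uS _] /=; rewrite (negPf uS) andbF.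
  - have [|_ h] := @caught_mid (K ^ 2).-1; first by move: K_gt; clear; lia.
    have fD : yf \notin dY Se by apply/imsetP=> -[].
    apply: h => [|j|].
    + by rewrite cardsU1 fD card_dY // /d; move: K_gt; clear; lia.
    + by rewrite !inE negb_or /=; apply/imsetP=> -[].
    + by left; move: K_gt; clear; lia.
have step (S : {set V}) : #|S| = k -> clique c S -> caught (inl (dX S)) -> caught (inr (dY S)).
  move=> cS qS h; apply: (@caughtYX _ _ _ _ _ (cY S) (dX S)) => //.
  - by rewrite disjoint_sym; apply: disjoint_dY_cY.
  - by rewrite card_cY // card_dY // addnC.
  - exact: cY_dX.
apply: (caught_walk_sym (P := fun S => caught (inr (dY S)))).
  move=> S S' /and5P[/eqP cS /eqP cS' qS qS' le] v; apply: step => //.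
  apply: (@caughtXY _ _ _ _ _ (cX S) (dY S)) => //.
  - by rewrite disjoint_sym; apply: disjoint_walk.
  - by rewrite card_cX // card_dX // addnC.
  - exact: cX_dY.
by apply: step => //; apply: w; rewrite ?setDv ?cards0.
Qed.

Lemma caught_high a : K ^ 2 < a <= d ->
  (forall C : {set pX}, d <= #|C| + a -> (forall i, xp (false, i) \notin C) ->
     (forall x, inl x \notin C) -> caught (inl C)) /\
  (forall C : {set pY}, d <= #|C| + a -> (forall j, yq (true, j) \notin C) ->
     caught (inr C)).
Proof.
elim: a => [//|a IH] /andP[La ad].
have [eL|neL] := eqVneq a (K ^ 2).
  have wX (C : {set pX}) : d <= #|C| + (K ^ 2).+1 -> (forall y, inl y \notin C) -> caught (inl C).
    move=> leC dis; apply: (@caughtXY _ _ _ _ _ (xg |: cX Sx) (dY Sx)).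
    - rewrite disjoint_subset; apply/subsetP=> y /setU1P[->|]; first by rewrite inE; apply: dis.
      by case/imsetP=> p _ ->; rewrite inE; apply: dis.
    - have fD : xg \notin cX Sx by apply/imsetP=> -[].
      by rewrite cardsU1 fD card_cX.
    - apply/subsetP=> y yD; apply/cnYP=> x /setU1P[->|xC].
        by case/imsetP: yD => -[z i] + ->; rewrite in_setX => /andP[].
      exact: (cnYP _ _ _ (subsetP (cX_dY Sx) y yD) x xC).
    - exact: caught_dual.
  rewrite eL; split=> C leC dis; first by move=> h; apply: wX.
  (* A round that keeps the size passes the turn to [X], where [xg] opens the dual level. *)
  apply: (@gadget_stepY (K ^ 2).+1 L.-1) => //; first by move: ad; rewrite eL.
    by rewrite -dL; move: L_lt L_gt0; rewrite /half /near; clear; lia.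
  apply: wX => [|y]; last exact: lowP_core.
  rewrite card_lowP; first by rewrite /d; move: L_gt0; clear; lia.
  by move: L_lt; clear; lia.
have La' : K ^ 2 < a by rewrite ltn_neqAle eq_sym neL -ltnS.
have [|IHX IHY] := IH; first by rewrite La' ltnW.
have aK' : d - L < a by rewrite dL.
split=> C leC dis; first move=> _.
  apply: (@gadget_stepX a.+1 a) => //.
    by move: aK' ad L_lt; rewrite /half /near; clear; lia.
  apply: IHY => [|j]; last exact: (highQ_free false).
  by rewrite card_highQ; move: ad; clear; lia.
apply: (@gadget_stepY a.+1 (d - a)) => //.
  by move: aK' ad L_lt; rewrite /half /near; clear; lia.
apply: IHX => [|j|x]; [|exact: (lowP_free true)|exact: lowP_core].
by rewrite card_lowP ?leq_subr //; move: ad; clear; lia.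
Qed.

Lemma puzzle_solvable : hn (dense_graph pH) <= m.
Proof.
apply: (caught_hn card_pX card_pY).
have [|h _] := @caught_high d.
  by rewrite leqnn andbT /d; move: L_gt0; clear; lia.
by apply: h => [|i|x]; rewrite ?cards0 ?inE.
Qed.

End Walk.

End Puzzle.

(** * The Chinese rings as a clique reconfiguration puzzle *)

(* Ring [j] has a value [inl y], with [y = None] while it is being moved, and a
   flag [inr z] that can only change while [y = None]; ring [j] may be moved only
   if ring [j - 1] is on and all the lower rings are off. *)
Definition ringV (r : nat) : finType := ('I_r * (option bool + bool) + 'I_(4 * r))%type.

Definition ring_below (i : nat) (a : option bool + bool) (j : nat)
    (b : option bool + bool) : bool :=
  if b is inl None then if a is inl y then y == Some (i.+1 == j) else true else true.

Definition ring_same (a b : option bool + bool) : bool :=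
  match a, b with
  | inl y, inr z | inr z, inl y => if y is Some x then x == z else true
  | _, _ => false
  end.

Definition ring_compat (r : nat) (u v : ringV r) : bool :=
  match u, v with
  | inl (i, a), inl (j, b) =>
      if i == j then ring_same a b
      else if i < j then ring_below i a j b else ring_below j b i a
  | _, _ => false
  end.

Lemma ring_irr r : irreflexive (@ring_compat r).
Proof. by case=> [[i [y|z]]|i] //=; rewrite eqxx. Qed.

(** The position in the reflected Gray code: when the top bit is on, the lower bits run
    backwards. *)
Fixpoint gray_rank (n : nat) (b : nat -> bool) : nat :=
  if n is n'.+1 then
    if b n' then 2 ^ n - 1 - gray_rank n' b else gray_rank n' b
  else 0.

Lemma gray_rank_lt n b : gray_rank n b < 2 ^ n.
Proof.
elim: n => //= n IH; have : 0 < 2 ^ n by rewrite expn_gt0.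
by rewrite expnS; case: (b n); lia.
Qed.

Lemma eq_gray_rank n b b' : (forall i, i < n -> b i = b' i) ->
  gray_rank n b = gray_rank n b'.
Proof.
by elim: n => //= n IH h; rewrite IH ?h // => i lt; apply: h; apply: ltnW.
Qed.

Lemma gray_rank0 n b : (forall i, i < n -> b i = false) -> gray_rank n b = 0.
Proof. by elim: n => //= n IH h; rewrite IH ?h // => i lt; apply: h; apply: ltnW. Qed.

Lemma gray_rank_top n b : (forall i, i < n -> b i = (i.+1 == n)) ->
  gray_rank n b = 2 ^ n - 1.
Proof.
case: n => //= n h; rewrite h // eqxx gray_rank0 ?subn0 // => i lt.
by rewrite h 1?ltnW // eqSS ltn_eqF.
Qed.

(** The condition on the lower bits gives them the last rank [2 ^ j - 1]; reflection at bit [j]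
    makes it a neighbour of [2 ^ j]. Higher bits at most reverse the order. *)
Lemma gray_rank_flip n j b b' : j < n ->
  (forall i, i < n -> i != j -> b i = b' i) ->
  (forall i, i < j -> b i = (i.+1 == j)) ->
  gray_rank n b' <= (gray_rank n b).+1 /\ gray_rank n b <= (gray_rank n b').+1.
Proof.
elim: n => // n IH; rewrite ltnS leq_eqVlt => /predU1P[ej|jn] eb bj /=.
  rewrite ej in eb bj.
  have e1 : gray_rank n b' = gray_rank n b.
    by apply: eq_gray_rank => i lt; rewrite -eb ?ltn_eqF // ltnW.
  rewrite e1 (gray_rank_top bj) expnS; have : 0 < 2 ^ n by rewrite expn_gt0.
  by move: (2 ^ n) => x; case: (b n); case: (b' n); clear; lia.
have {}IH := IH jn (fun i lt => eb i (ltnW lt)) bj; move: IH => [].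
rewrite -(eb n) ?ltnSn ?gtn_eqF //.
have := gray_rank_lt n b; have := gray_rank_lt n b'; rewrite expnS.
by move: (2 ^ n) => x; case: (b n); clear; lia.
Qed.

(** * Cliques of size [2 r] as positions of the rings *)

Section Rings.
Variable r : nat.
Hypothesis r_gt1 : 1 < r.
Local Notation V := (ringV r).
Local Notation c := (@ring_compat r).

Definition ring_bit (S : {set V}) (j : nat) : bool :=
  [exists i : 'I_r, (val i == j) && ((inl (i, inr true) : V) \in S)].

Definition ring_rank (S : {set V}) : nat := gray_rank r (ring_bit S).

Section CliqueShape.
Variable S : {set V}.
Hypotheses (qS : clique c S) (cS : #|S| = r.*2).

Lemma ring_clique_inl u : u \in S -> exists p, u = inl p.
Proof.
case: u => [p|x] xS; first by exists p.
have /card_gt0P[v] : 0 < #|S :\ inr x|.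
  have := cardsD1 (inr x : V) S; rewrite xS cS add1n; case: #|_| r_gt1 => //; lia.
rewrite !inE => /andP[vx vS].
by have := cliqueP _ _ qS v (inr x) vS xS vx; case: v {vx vS} => [[]|].
Qed.

Lemma ring_clique_uniq i a b : (inl (i, a) : V) \in S -> (inl (i, b) : V) \in S ->
  (a == b) || ring_same a b.
Proof.
move=> aS bS; have [//|ne] := eqVneq a b.
have := cliqueP _ _ qS _ _ aS bS; rewrite /= eqxx; apply.
by apply: contra ne => /eqP[->].
Qed.

Definition ring_slot (u : V) : option ('I_r * bool) :=
  if u is inl (i, a) then Some (i, if a is inl _ then false else true) else None.

(** A clique has no isolated vertex and at most one value and one flag per ring. With [2 r] elements
    it fills all the slots, so it describes a position of every ring. *)
Lemma ring_clique_all : [set ring_slot u | u in S] = [set Some p | p in setT].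
Proof.
apply/eqP; rewrite eqEcard; apply/andP; split.
  by apply/subsetP=> _ /imsetP[u /ring_clique_inl[[i a] ->] ->]; apply/imsetP;
    exists (i, if a is inl _ then false else true).
rewrite card_imset; last by move=> ? ? [].
rewrite cardsT card_prod card_ord card_bool card_in_imset ?cS ?muln2 //.
move=> u v uS vS; have [[i a] eu] := ring_clique_inl uS; have [[j b] ev] := ring_clique_inl vS.
rewrite eu ev /= => -[ij eab]; rewrite -ij in ev *; congr (inl (_, _)); apply/eqP.
have := @ring_clique_uniq i a b; rewrite -eu -ev uS vS => /(_ isT isT).
by case: a b eab {eu ev} => [y|z] [y'|z'] //=; rewrite ?orbF.
Qed.

Lemma ring_clique_y (i : 'I_r) : exists y, (inl (i, inl y) : V) \in S.
Proof.
have : Some (i, false) \in [set ring_slot u | u in S].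
  by rewrite ring_clique_all; apply/imsetP; exists (i, false).
by case/imsetP=> -[[j [y|z]]|x] uS // [->]; exists y.
Qed.

Lemma ring_clique_z (i : 'I_r) : (inl (i, inr (ring_bit S i)) : V) \in S.
Proof.
have : Some (i, true) \in [set ring_slot u | u in S].
  by rewrite ring_clique_all; apply/imsetP; exists (i, true).
case/imsetP=> -[[j [y|z]]|x] uS // [ei]; rewrite -ei in uS.
suff -> : ring_bit S i = z by [].
apply/existsP/idP => [[i' /andP[/eqP/val_inj-> tS]]|zt].
  by have := ring_clique_uniq tS uS; rewrite orbF => /eqP[<-].
by exists i; rewrite eqxx; case: z zt uS => //.
Qed.

Lemma ring_clique_bit (i : 'I_r) z : (inl (i, inr z) : V) \in S -> ring_bit S i = z.
Proof. by move=> /(ring_clique_uniq (ring_clique_z i)); rewrite orbF => /eqP[]. Qed.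

End CliqueShape.

(** If a flag changes, it is the only new vertex. The value of its ring is then in both cliques and
    compatible with both flags, hence [None]; this fixes the lower rings, and no other flag
    changes. *)
Lemma ring_rank_step (S S' : {set V}) : #|S| = r.*2 -> #|S'| = r.*2 ->
  clique c S -> clique c S' -> #|S' :\: S| <= 1 -> ring_rank S' <= (ring_rank S).+1.
Proof.
move=> cS cS' qS qS' le1; rewrite /ring_rank.
have [/existsP[j jne]|same] := boolP [exists j : 'I_r, ring_bit S' j != ring_bit S j]; last first.
  rewrite (@eq_gray_rank r (ring_bit S') (ring_bit S)) => [|i lt]; first exact: leqnSn.
  move: same; rewrite negb_exists => /forallP/(_ (Ordinal lt)).
  by rewrite negbK => /eqP.
have jS' := ring_clique_z qS' cS' j; have jS := ring_clique_z qS cS j.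
have jnS : (inl (j, inr (ring_bit S' j)) : V) \notin S.
  by apply: contra jne => /(ring_clique_bit qS cS)->.
have only u : u \in S' -> u != inl (j, inr (ring_bit S' j)) -> u \in S.
  move=> uS' ne; apply: contraNT ne => unS; apply/eqP.
  by move/card_le1_eqP: le1; apply; rewrite inE ?unS ?jnS.
have [y yS'] := ring_clique_y qS' cS' j.
have yS : (inl (j, inl y) : V) \in S by apply: only => //; apply/eqP=> -[].
have y0 : y = None.
  case: y yS yS' => [b|//] yS yS'.
  have := ring_clique_uniq qS yS jS; have := ring_clique_uniq qS' yS' jS' => /=.
  by move=> /eqP e1 /eqP e2; move: jne; rewrite -e1 -e2 eqxx.
apply: (proj1 (@gray_rank_flip r j _ _ (ltn_ord j) _ _)).
  move=> i lt ne; rewrite -[i]/(val (Ordinal lt)).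
  have := ring_clique_z qS' cS' (Ordinal lt) => zi.
  apply: (ring_clique_bit qS cS); apply: only => //.
  by apply: contra ne => /eqP[/(congr1 val)/= -> _].
move=> i lt; have ir := ltn_trans lt (ltn_ord j).
have [yi yiS] := ring_clique_y qS cS (Ordinal ir).
have zi := ring_clique_z qS cS (Ordinal ir).
have : c (inl (Ordinal ir, inl yi)) (inl (j, inl y)).
  apply: (cliqueP _ _ qS) => //; apply/eqP=> -[e1 _].
  by move: lt; rewrite -e1 /= ltnn.
rewrite /= -val_eqE /= ltn_eqF // lt y0 /= => /eqP eyi.
by have := ring_clique_uniq qS yiS zi; rewrite eyi /= => /eqP.
Qed.

Definition ring_state (y : nat -> option bool) (z : nat -> bool) : {set V} :=
  [set u : V | match u with
               | inl (j, inl a) => y j == a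
               | inl (j, inr b) => z j == b
               | inr _ => false
               end].

Lemma card_ring_state y z : #|ring_state y z| = r.*2.
Proof.
pose f (p : 'I_r * bool) : V := inl (p.1, if p.2 then inr (z p.1) else inl (y p.1)).
have <- : f @: setT = ring_state y z.
  apply/setP=> u; rewrite inE; apply/imsetP/idP => [[[j []] _ ->] /=|].
  - exact: eqxx.
  - exact: eqxx.
  - by case: u => [[j [a|b]]|//] /eqP<-; [exists (j, false)|exists (j, true)].
rewrite card_imset; first by rewrite cardsT card_prod card_ord card_bool muln2.
by move=> [i []] [j []] //= [->].
Qed.

Lemma clique_ring_state y z :
  (forall j b, y j = Some b -> z j = b) ->
  (forall i j, y j = None -> i < j -> y i = Some (i.+1 == j)) ->
  clique c (ring_state y z).
Proof.
move=> yz yy; apply/cliqueP=> -[[i a]|x]; last by rewrite inE.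
move=> [[j b]|x]; last by move=> _; rewrite inE.
rewrite !inE => ai bj ne /=.
have below i' a' j' b' : i' < j' -> match a' with inl y' => y i' == y' | inr z' => z i' == z' end ->
   match b' with inl y' => y j' == y' | inr z' => z j' == z' end -> ring_below i' a' j' b'.
  move=> lt ha hb; case: b' hb => [[//|]|//] /eqP hb /=; case: a' ha => // y' /eqP<-.
  by rewrite (yy _ _ hb lt).
case: (eqVneq i j) => [eij|nij]; last first.
  by case: ltngtP => [lt|lt|/val_inj e1]; [apply: below|apply: below|rewrite e1 eqxx in nij].
rewrite -eij in bj ne.
case: a b ai bj ne => [ya|za] [yb|zb] /eqP<- /eqP<- /=; rewrite ?eqxx //.
  by case e1: (y i) => [x|//] _; rewrite (yz _ _ e1).
by case e1: (y i) => [x|//] _; rewrite (yz _ _ e1).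
Qed.

Lemma ring_state_ext y y' z z' : (forall i, i < r -> y i = y' i) ->
  (forall i, i < r -> z i = z' i) -> ring_state y z = ring_state y' z'.
Proof.
by move=> ey ez; apply/setP=> -[[j [a|b]]|x]; rewrite !inE ?ey ?ez.
Qed.

Local Notation step := (@walk_step V c (r.*2).-1).

Lemma ring_stepI (S S' : {set V}) (u : V) : #|S| = r.*2 -> #|S'| = r.*2 ->
  clique c S -> clique c S' -> S' :\: S \subset [set u] -> step S S'.
Proof.
move=> cS cS' qS qS' /subset_leq_card; rewrite cards1 => le1.
by rewrite /walk_step cS cS' prednK ?eqxx ?qS ?qS' //; lia.
Qed.

Definition settled (b : nat -> bool) := ring_state (fun i => Some (b i)) b.

Lemma clique_settled b : clique c (settled b).
Proof. by apply: clique_ring_state => // j x []. Qed.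

Definition flip (b : nat -> bool) (j i : nat) := if i == j then ~~ b i else b i.

(** Three exchanges of one vertex: the value is lifted to [None], the flag is changed, the value is
    set again. *)
Lemma settled_flip (b : nat -> bool) j : j < r ->
  (forall i, i < j -> b i = (i.+1 == j)) ->
  connect step (settled b) (settled (flip b j)).
Proof.
move=> jr bj; pose y i := if i == j then None else Some (b i).
have qs z : (forall i, i != j -> z i = b i) -> clique c (ring_state y z).
  move=> ez; apply: clique_ring_state => [i x|i i']; rewrite /y.
    by case: eqVneq => // ne [<-]; apply: ez.
  by case: eqVneq => // -> _ lt; rewrite ltn_eqF // bj.
have q1 : clique c (ring_state y b) by apply: qs.
have q2 : clique c (ring_state y (flip b j)).
  by apply: qs => i ne; rewrite /flip (negPf ne).
apply: connect_trans (_ : connect step (ring_state y b) _).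
  apply/connect1/(@ring_stepI _ _ (inl (Ordinal jr, inl None)));
    rewrite ?card_ring_state ?clique_settled //.
  apply/subsetP=> -[[i [a|x]]|x]; rewrite !inE ?andbF //; last by rewrite andNb.
  rewrite /y; case: (eqVneq (val i) j) => [e1 /andP[_ /eqP<-]|_]; last by rewrite andNb.
  by apply/eqP; congr (inl (_, _)); apply: val_inj.
apply: connect_trans (_ : connect step (ring_state y (flip b j)) _).
  apply/connect1/(@ring_stepI _ _ (inl (Ordinal jr, inr (~~ b j))));
    rewrite ?card_ring_state //.
  apply/subsetP=> -[[i [a|x]]|x]; rewrite !inE ?andbF //; first by rewrite andNb.
  rewrite /flip; case: (eqVneq (val i) j) => [e1 /andP[_ /eqP<-]|_]; last by rewrite andNb.
  by apply/eqP; rewrite e1; congr (inl (_, _)); apply: val_inj.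
apply/connect1/(@ring_stepI _ _ (inl (Ordinal jr, inl (Some (~~ b j)))));
  rewrite ?card_ring_state ?clique_settled //.
apply/subsetP=> -[[i [a|x]]|x]; rewrite !inE ?andbF //; last by rewrite andNb.
rewrite /flip /y; case: (eqVneq (val i) j) => [e1 /andP[_ /eqP<-]|_]; last by rewrite andNb.
by apply/eqP; rewrite e1; congr (inl (_, _)); apply: val_inj.
Qed.

Definition turn_on (b : nat -> bool) (n i : nat) := (i.+1 == n) || b i.

(** The classical recursion: turn on the ring below, flip this ring, and undo the first phase, which
    is possible since walks are reversible. *)
Lemma settled_turn_on n b : n <= r -> (forall i, i < n -> b i = false) ->
  connect step (settled b) (settled (turn_on b n)).
Proof.
have symc : connect_sym step by apply/sym_connect_sym/walk_step_sym.
elim: n b => [|n IH] b le b0; first exact: connect0.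
apply: connect_trans (IH b (ltnW le) _) _; first by move=> i lt; apply: b0; apply: ltnW.
apply: connect_trans (settled_flip le _) _.
  by move=> i lt; rewrite /turn_on b0 ?orbF // ltnW.
rewrite symc; set b2 := flip _ _; set b3 := turn_on b n.+1.
have e23 i : turn_on b3 n i = b2 i.
  rewrite /b3 /b2 /turn_on /flip eqSS; case: (ltngtP i n) => [lt|lt|->].
  - by [].
  - by [].
  - by rewrite gtn_eqF //= b0.
have <- : settled (turn_on b3 n) = settled b2 by apply: ring_state_ext => i _; rewrite e23.
by apply: IH (ltnW le) _ => i lt; rewrite /b3 /turn_on eqSS ltn_eqF //= b0 // ltnW.
Qed.

Lemma ring_rank_settled b : ring_rank (settled b) = gray_rank r b.
Proof.
apply: eq_gray_rank => i lt; rewrite -[i in LHS]/(val (Ordinal lt)).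
apply: ring_clique_bit; rewrite ?clique_settled ?card_ring_state //.
by rewrite inE /= eqxx.
Qed.

Definition ring_start := settled (fun=> false).
Definition ring_goal := settled (fun i => i.+1 == r).

Lemma ring_walk : connect step ring_start ring_goal.
Proof.
have -> : ring_goal = settled (turn_on (fun=> false) r).
  by apply: ring_state_ext => i _; rewrite /turn_on orbF.
exact: settled_turn_on.
Qed.

Lemma ring_far : 1 < #|ring_start :\: ring_goal|.
Proof.
have lt : r.-1 < r by lia.
have rE : r.-1.+1 = r by lia.
apply/card_gt1P; exists (inl (Ordinal lt, inl (Some false))), (inl (Ordinal lt, inr false)).
by split; [rewrite !inE /= rE eqxx | rewrite !inE /= rE eqxx | apply/eqP=> -[]].
Qed.

Lemma card_ringV : #|V| = 9 * r.
Proof.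
by rewrite card_sum card_prod !card_ord card_sum card_option card_bool; lia.
Qed.

Lemma card_ring_compat : #|[set p : V * V | c p.1 p.2]| <= (5 * r) ^ 2.
Proof.
pose A : {set V} := [set inl p | p in setT].
have -> : (5 * r) ^ 2 = #|setX A A|.
  rewrite cardsX /A card_imset; last by move=> ? ? [].
  by rewrite cardsT card_prod !card_ord card_sum card_option card_bool mulnn mulnC.
apply/subset_leq_card/subsetP=> -[[p|x] [q|x']]; rewrite !inE //=; last by case: p.
by move=> _; apply/andP; split; apply/imsetP; [exists p|exists q].
Qed.

End Rings.

(** * Parameters of the ring graphs and superpolynomial length *)

Definition ring_d r := (7 * r) ^ 2 + (r.*2).-1.+1 * (r.*2).-1.

(** Here [k = 2 r] and [K = 7 r]. The [4 r] isolated vertices of [ringV] bring the total to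
    [K + k = 9 r] while the compatible pairs, at most [25 r^2], stay below [K^2 = 49 r^2]. *)
Definition ring_graph (r : nat) : sgraph :=
  dense_graph (@pH (ringV r) (@ring_compat r) (r.*2).-1 (7 * r)
    (ring_d r - 9 * r * (r.*2).-1 - 1) ((9 * r) ^ 2 + 1 - ring_d r)
    (ring_start r) (ring_goal r)).

Lemma ring_graph_spec r : 1 < r ->
  #|ring_graph r| <= 400 * r ^ 2 /\ r <= #|ring_graph r| /\
  forall s : seq {set ring_graph r}, winning (hn (ring_graph r)) s -> 2 ^ r - 1 <= size s.
Proof.
move=> r1.
have kE : (r.*2).-1.+1 = r.*2 by lia.
have dE : ring_d r + 2 * r = 53 * r ^ 2 by rewrite /ring_d kE -!mulnn; nia.
have cV := card_ringV r1.
have h1 : #|ringV r| = 7 * r + (r.*2).-1.+1 by rewrite cV kE; lia.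
have h2 : 1 < (r.*2).-1 by lia.
have h3 : ring_d r = #|ringV r| * (r.*2).-1 + (ring_d r - 9 * r * (r.*2).-1 - 1) + 1.
  rewrite cV; have : 9 * r * (r.*2).-1 + 1 <= ring_d r by rewrite /ring_d -mulnn; nia.
  lia.
have h4 : #|ringV r| ^ 2 + 1 = ring_d r + ((9 * r) ^ 2 + 1 - ring_d r).
  rewrite cV; have : ring_d r <= (9 * r) ^ 2 + 1 by rewrite -mulnn; move: dE; rewrite -mulnn; nia.
  lia.
have h5 : #|[set p : ringV r * ringV r | ring_compat p.1 p.2]| < (7 * r) ^ 2.
  by apply: leq_ltn_trans (card_ring_compat r) _; rewrite ltn_exp2r //; lia.
have h6 : (r.*2).-1.+1 * (r.*2).-1 + 3 < (7 * r) ^ 2 by rewrite -mulnn; nia.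
have h7 : (7 * r) * (r.*2).-1 + 1 < (7 * r) ^ 2 by rewrite -mulnn; nia.
have h8 b : #|@settled r b| = (r.*2).-1.+1 by rewrite kE card_ring_state.
have cG : #|ring_graph r| = (#|ringV r| ^ 2 + 1 + ring_d r + ring_d r).*2.
  by rewrite card_sum card_pX (card_pY h3 h4) addnn.
have far := ring_far r1.
split; first by rewrite cG cV -!mulnn; move: dE; rewrite -mulnn; nia.
split; first by rewrite cG cV -!mulnn; nia.
move=> s [hs ws].
have le := puzzle_solvable h1 h2 h3 h4 h6 (h8 _) (h8 _) (clique_settled _ _) (ring_walk r1).
(* The lower bound holds for [m] hunters, hence also for the possibly smaller number [hn]. *)
have ws' : winning (#|ringV r| ^ 2 + 1 + ring_d r) s.
  by split=> // F Fs; apply: leq_trans (hs F Fs) le.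
have p0 : ring_rank (ring_start r) = 0 by rewrite ring_rank_settled // gray_rank0.
have := puzzle_long (@ring_irr r) h1 h2 h3 h4 h5 h6 h7 (h8 _) (h8 _) far p0
  (clique_settled _ _) _ ws'.
rewrite ring_rank_settled // gray_rank_top //; apply=> S S'; rewrite kE.
exact: ring_rank_step.
Qed.

(** For exponent [c.+1], let [a = 2 (c + 1)] and [s = r / a]. Once [a <= s],
    [r < a (s + 1) <= (s + 1)^2], so [r ^ c.+1 < (s + 1) ^ a <= 2 ^ (s a) <= 2 ^ r]. *)
Lemma expn_lt_exp2 c : exists R, forall r, R <= r -> r ^ c < 2 ^ r.
Proof.
case: c => [|c]; first by exists 1 => r lt; rewrite expn0 -(expn0 2) ltn_exp2l.
set a := (c.+1).*2; exists (a * a) => r le; pose s := r %/ a.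
have a_gt0 : 0 < a by rewrite /a; lia.
have as_ : a <= s by rewrite leq_divRL.
have r_lt : r < a * s.+1 by rewrite mulnC; apply: ltn_ceil.
apply: (@leq_trans ((a * s.+1) ^ c.+1)); first by rewrite ltn_exp2r.
apply: (@leq_trans ((s.+1 * s.+1) ^ c.+1)).
  by rewrite leq_exp2r // leq_mul2r ltnW ?orbT // ltnS.
rewrite mulnn -expnM mul2n -/a; apply: leq_trans (_ : (2 ^ s) ^ a <= _).
  by rewrite leq_exp2r //; apply: ltn_expl.
by rewrite -expnM leq_exp2l // leq_trunc_div.
Qed.

Lemma poly_lt_exp c : exists R, forall r, R <= r -> (400 * r ^ 2) ^ c < 2 ^ r - 1.
Proof.
(* From [r >= 401] on, the factor 400 is absorbed by one more power of [r]. *)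
have [R hR] := expn_lt_exp2 (3 * c).+1; exists (maxn R 401) => r.
rewrite geq_max => /andP[/hR lt r1].
have le : (400 * r ^ 2) ^ c <= r ^ (3 * c).
  rewrite expnM; case: c {hR lt} => // c; rewrite leq_exp2r //.
  by rewrite [r ^ 3]expnS leq_mul2r ltnW ?orbT.
move: lt; rewrite expnS => lt.
have : 0 < r ^ (3 * c) by rewrite expn_gt0; case: r r1 {lt le}.
move: le lt r1; move: ((400 * r ^ 2) ^ c) (r ^ (3 * c)) (2 ^ r) => x y z; clear; nia.
Qed.

Theorem superpolynomial_hunting :
  exists Fam : sgraph -> Prop, infinite_family Fam /\
    forall c : nat, exists N : nat, forall G : sgraph,
      Fam G -> N <= #|G| ->
      forall s : seq {set G}, shortest_winning (hn G) s -> #|G| ^ c < size s.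
Proof.
exists (fun G => exists2 r, 1 < r & G = ring_graph r); split.
  move=> n; exists (ring_graph n.+2); split; first by exists n.+2.
  by have [//|_ [h _]] := @ring_graph_spec n.+2; apply: leq_trans h; apply: ltnW.
move=> c; have [R Rlt] := poly_lt_exp c; exists (400 * R ^ 2).+1 => G [r r1 ->] leG s [ws _].
have [le [_ long]] := ring_graph_spec r1.
have Rr : R <= r.
  rewrite leqNgt; apply/negP=> lt; move: (leq_trans leG le); rewrite ltnNge.
  by rewrite leq_mul2l leq_exp2r // ltnW.
apply: leq_ltn_trans (leq_trans (Rlt r Rr) (long s ws)).
by case: c {Rlt} => // c; rewrite leq_exp2r.
Qed.

(** * Cliques and the hunting number *)

(** One pair per window, in contrast with [half]: the level only has to resist crossing, so only
    shapes with [d + 1] vertices are blocked. *)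
Definition half_skip (a b i j : nat) : bool :=
  (i <= j) && ~~ ((i == j) && ((i.+1 == a) || (i.+1 == b))).

(** Both sides of the graph carry the same vertices and the relation is symmetric, so one argument
    covers the rounds on either side. *)
Definition cliqueT (U : finType) (d : nat) : finType :=
  (U * U + U + ('I_d + 'I_d))%type.

Definition cliqueH (U : finType) (compat : U -> U -> bool) (a b d : nat)
    (x y : cliqueT U d) : bool :=
  match x, y with
  | inl (inl (u, v)), inl (inr z) | inl (inr z), inl (inl (u, v)) =>
      [&& compat u v, z != u & z != v]
  | inr (inl i), inr (inr j) | inr (inr j), inr (inl i) => half_skip a b i j
  | _, _ => false
  end.

Section CliqueGraph.
Variables (U : finType) (compat : U -> U -> bool) (k q : nat).
Hypothesis cardU : #|U| = k * q.
Hypotheses (k_gt1 : 1 < k) (q_gt1 : 1 < q) (q_le_k : q <= k).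
Let a := k * k.
Let b := k * q.-1.
Let d := (a + b).-1.
Local Notation T := (cliqueT U d).
Local Notation H := (@cliqueH U compat a b d).
Let m := k * q * (k * q) + k * q + d.

Let b_gt0 : 0 < b. Proof. by rewrite muln_gt0; lia. Qed.
Let a_gt0 : 0 < a. Proof. by rewrite muln_gt0; lia. Qed.
Let dE : d.+1 = a + b. Proof. by rewrite prednK // addn_gt0 a_gt0. Qed.
Let UE : #|U| = k + b. Proof. by rewrite cardU /b; case: q q_gt1 => // q' _; rewrite mulnS. Qed.
Let U_le : #|U| <= a. Proof. by rewrite cardU leq_mul2l q_le_k orbT. Qed.
(** If the levels [a] and [b] were consecutive, the vertices cleaned at one would be the dirty ones
    at the next. Residues modulo [k] keep them apart. *)
Let ab_apart : (a != b.+1) /\ (b != a.+1).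
Proof.
rewrite /a /b; split; apply/eqP=> e.
  by have := congr1 (modn^~ k) e; rewrite modnMl -addn1 mulnC modnMDl modn_small.
by have := congr1 (modn^~ k) e; rewrite modnMr -addn1 modnMDl modn_small.
Qed.

Lemma card_cliqueT : #|T| = m + d.
Proof. by rewrite !card_sum card_prod !card_ord cardU /m addnA. Qed.

Lemma cliqueH_sym x y : H x y = H y x.
Proof. by case: x y => [[[u v]|z]|[i|i]] [[[u' v']|z']|[j|j]]. Qed.

Lemma cnX_cnY (D : {set T}) : @cnX T T H D = @cnY T T H D.
Proof.
by apply/setP=> x; rewrite !inE; apply: eq_forallb => y; rewrite cliqueH_sym.
Qed.

Section NoClique.
Hypothesis noclique : forall S : {set U}, #|S| = k ->
  ~ forall u v, u \in S -> v \in S -> compat u v.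

(** At least [k^2] compatible pairs span at least [k] vertices, and exactly [k] would give a clique;
    so fewer than [b] vertices remain outside. Dirty sets of vertices would be all of [U] since
    [#|U| <= a], leaving no pair; in the half graph the skipped pair is missing. *)
Lemma cn_noclique (D : {set T}) : a <= #|D| -> #|@cnY T T H D| < b.
Proof.
move=> leD; have /card_gt0P[x0 x0D] : 0 < #|D| by apply: leq_trans leD.
have [->|[y0 /cnYP y0C]] := set_0Vmem (@cnY T T H D); first by rewrite cards0.
case: x0 x0D (y0C _ x0D) => [[[u0 v0]|z0]|[i0|j0]] x0D.
- case: y0 y0C => [[|z0]|[]] // y0C _.
  pose A := [set p : U * U | (inl (inl p) : T) \in D].
  have DA : #|D| <= #|A|.
    apply: (@leq_card_of _ _ (fun p => inl (inl p) : T)) => x xD.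
    by have := y0C _ xD; case: x xD => [[p|]|[]] // pD _; exists p; rewrite ?inE.
  pose S := [set z | [exists p in A, (z == p.1) || (z == p.2)]].
  have AS p : p \in A -> (p.1 \in S) && (p.2 \in S).
    move=> pA; rewrite /S 2!in_set; apply/andP.
    by split; apply/exists_inP; exists p; rewrite // eqxx ?orbT.
  have AC p : p \in A -> compat p.1 p.2.
    by case: p => u v; rewrite inE => /y0C /=; case/and3P.
  have cardAS : #|A| <= #|S| * #|S|.
    by rewrite -cardsX; apply/subset_leq_card/subsetP=> -[u v] /AS; rewrite in_setX.
  have leS : k <= #|S|.
    rewrite leqNgt; apply/negP=> lt; have : #|S| * #|S| < k * k by apply: ltn_mul.
    by rewrite ltnNge (leq_trans leD) // (leq_trans DA).
  have neS : #|S| != k.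
    apply/eqP=> Sk; case: (noclique Sk) => u v uS vS.
    apply: (AC (u, v)); suff -> : A = setX S S by rewrite in_setX uS vS.
    apply/eqP; rewrite eqEcard cardsX Sk (leq_trans leD DA) andbT.
    by apply/subsetP=> -[u' v'] /AS; rewrite in_setX.
  have : #|@cnY T T H D| <= #|~: S|.
    apply: (@leq_card_of _ _ (fun z => inl (inr z) : T)) => y /cnYP yC.
    have := yC _ x0D; case: y yC => [[|z]|[]] // yC _; exists z => //.
    rewrite in_setC; apply/negP; rewrite inE => /exists_inP[[u v]].
    by rewrite inE => /yC /= /and3P[_ /negPf-> /negPf->].
  have -> : #|~: S| = k + b - #|S| by rewrite cardsCs setCK UE.
  by move/leq_ltn_trans; apply; move: leS neS b_gt0; clear; lia.
- case: y0 y0C => [[[u v]|]|[]] // y0C _.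
  have UD : #|D| <= #|[set z : U | (inl (inr z) : T) \in D]|.
    apply: (@leq_card_of _ _ (fun z => inl (inr z) : T)) => x xD.
    by have := y0C _ xD; case: x xD => [[[]|z]|[]] // zD _; exists z; rewrite ?inE.
  have /eqP UT : [set z : U | (inl (inr z) : T) \in D] == setT.
    by rewrite eqEcard subsetT cardsT (leq_trans U_le) // (leq_trans leD).
  have : u \in [set z : U | (inl (inr z) : T) \in D] by rewrite UT.
  by rewrite inE => /y0C /=; rewrite eqxx andbF.
- case: y0 y0C => [[[u v]|z0]|[|j0]] // y0C _.
  pose A := [set i : 'I_d | (inr (inl i) : T) \in D].
  have DA : #|D| <= #|A|.
    apply: (@leq_card_of _ _ (fun i => inr (inl i) : T)) => x xD.
    by have := y0C _ xD; case: x xD => [[[]|z]|[i|]] // iD _; exists i; rewrite ?inE.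
  have [i iA maxi] := max_of_set (leq_trans a_gt0 (leq_trans leD DA)).
  have lei : a <= i.+1.
    apply: leq_trans leD (leq_trans DA _); rewrite -(@card_ord_ltn d i.+1) //.
    by apply/subset_leq_card/subsetP=> j /maxi; rewrite inE.
  have : #|@cnY T T H D| <= #|[set j : 'I_d | a <= j]|.
    apply: (@leq_card_of _ _ (fun i => inr (inr i) : T)) => y /cnYP yC.
    rewrite inE in iA; have := yC _ iA; case: y yC => [[[]|]|[|j]] // yC /= h.
    exists j => //; rewrite inE; move: h lei; rewrite /half_skip; clear; lia.
  by rewrite card_ord_geq; move: dE b_gt0; clear; lia.
- case: y0 y0C => [[[u v]|z0]|[i0|]] // y0C _.
  pose A := [set i : 'I_d | (inr (inr i) : T) \in D].
  have DA : #|D| <= #|A|.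
    apply: (@leq_card_of _ _ (fun i => inr (inr i) : T)) => x xD.
    by have := y0C _ xD; case: x xD => [[[]|z]|[|i]] // iD _; exists i; rewrite ?inE.
  have [i iA mini] := min_of_set (leq_trans a_gt0 (leq_trans leD DA)).
  have lei : a <= d - i.
    apply: leq_trans leD (leq_trans DA _); rewrite -card_ord_geq.
    by apply/subset_leq_card/subsetP=> j /mini; rewrite inE.
  have : #|@cnY T T H D| <= #|[set j : 'I_d | j < b.-1]|.
    apply: (@leq_card_of _ _ (fun i => inr (inl i) : T)) => y /cnYP yC.
    rewrite inE in iA; have := yC _ iA; case: y yC => [[[]|]|[j|]] // yC /= h.
    exists j => //; rewrite inE; have := ltn_ord i.
    move: h lei dE b_gt0; rewrite /half_skip; clear; lia.
  by rewrite card_ord_ltn; move: dE a_gt0 b_gt0; clear; lia.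
Qed.

Lemma noclique_hn : m < hn (dense_graph H).
Proof.
rewrite ltnNge; apply/negP=> /hn_leP[s ws].
pose I (t : nat) (C : {set T}) := #|C| < b.
have stepI t (C D : {set T}) : I t C -> [disjoint D & C] -> d <= #|C| + #|D| ->
    I t.+1 (@cnY T T H D).
  by rewrite /I => IC _ le; apply: cn_noclique; move: IC le dE; clear; lia.
have [] := @winning_invariant T T H m d card_cliqueT card_cliqueT I I _ stepI _ s ws.
- by rewrite /I cards0.
- by move=> t C D; rewrite cnX_cnY; apply: stepI.
- by rewrite /I cardsT card_cliqueT; move: dE a_gt0; clear; lia.
- by rewrite /I cardsT card_cliqueT; move: dE a_gt0; clear; lia.
Qed.

End NoClique.

Section HasClique.
Variable S : {set U}.
Hypotheses (Sk : #|S| = k) (SC : forall u v, u \in S -> v \in S -> compat u v).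

Let setE : {set T} := [set inl (inl p) | p in setX S S].
Let setV : {set T} := [set inl (inr z) | z in ~: S].
Let setP n : {set T} := [set inr (inl i) | i in [set i : 'I_d | i < n]].
Let setQ n : {set T} := [set inr (inr i) | i in [set i : 'I_d | n <= i]].

(** The biclique with [n] dirty and [d + 1 - n] clean vertices: from the half graph, except at [a]
    and [b], where the clique provides it in either orientation. *)
Let dirty n := if n == a then setE else if n == b then setV else setP n.
Let clean n := if n == a then setV else if n == b then setE else setQ n.-1.

Let card_setE : #|setE| = a.
Proof. by rewrite card_imset ?cardsX ?Sk // => ? ? []. Qed.
Let card_setV : #|setV| = b.
Proof.
rewrite card_imset; last by move=> ? ? [].
by rewrite cardsCs setCK Sk UE addKn.
Qed.

Lemma card_dirty n : n <= d -> #|dirty n| = n.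
Proof.
rewrite /dirty; case: eqP => [-> //|_]; case: eqP => [-> //|_] le.
by rewrite card_imset ?card_ord_ltn // => ? ? [].
Qed.

Lemma card_clean n : 0 < n <= d -> n + #|clean n| = d.+1.
Proof.
rewrite /clean; case: eqP => [->|_]; first by rewrite card_setV dE.
case: eqP => [->|_]; first by rewrite card_setE dE addnC.
move=> h; rewrite card_imset; last by move=> ? ? [].
by rewrite card_ord_geq; move: h; clear; lia.
Qed.

Lemma clean_dirty n x y : x \in dirty n -> y \in clean n -> H x y.
Proof.
rewrite /dirty /clean; case: eqVneq => [_|na]; last case: eqVneq => [_|nb].
- case/imsetP=> -[u v] + -> /imsetP[z + ->]; rewrite in_setX in_setC => /andP[uS vS] zS.
  by apply/and3P; split; [apply: SC|apply: contraNneq zS => ->|apply: contraNneq zS => ->].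
- case/imsetP=> z + -> /imsetP[[u v] + ->]; rewrite in_setX in_setC => zS /andP[uS vS].
  by apply/and3P; split; [apply: SC|apply: contraNneq zS => ->|apply: contraNneq zS => ->].
case/imsetP=> i + -> /imsetP[j + ->]; rewrite !inE /= /half_skip; move: na nb; clear; lia.
Qed.

Lemma disjoint_dirty_clean n : 0 < n -> [disjoint dirty n.-1 & clean n].
Proof.
move=> n0; rewrite disjoint_subset; apply/subsetP=> x; rewrite [x \in [predC _]]inE /dirty /clean.
case: eqVneq => [na|_]; last case: eqVneq => [nb|_].
- have nb : n != a by rewrite -na; move: n0; clear; lia.
  have -> : (n == b) = false.
    by apply/negP=> /eqP e; move: ab_apart; rewrite -e -na; move: n0; clear; lia.
  by rewrite (negPf nb); case/imsetP=> p _ ->; apply/imsetP=> -[].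
- have -> : (n == a) = false.
    by apply/negP=> /eqP e; move: ab_apart; rewrite -e -nb; move: n0; clear; lia.
  have -> : (n == b) = false by apply/negbTE; rewrite -nb; move: n0; clear; lia.
  by case/imsetP=> p _ ->; apply/imsetP=> -[].
case/imsetP=> i _ ->; case: ifP => _; last case: ifP => _; by apply/imsetP=> -[].
Qed.

Lemma caught_clique n : n <= d -> forall C : {set T}, d <= #|C| + n ->
  [disjoint dirty n & C] ->
  @caught T T H d (inl C) /\ @caught T T H d (inr C).
Proof.
elim: n => [|n IH] le C leC dis.
  have full : [set: T] \subset @cnY T T H set0.
    by apply/subsetP=> y _; apply/cnYP=> x; rewrite inE.
  have dis0 : [disjoint (set0 : {set T}) & C] by rewrite -setI_eq0 set0I.
  split.
    by apply: (@caughtXY _ _ _ _ C set0 setT); rewrite ?cards0 //; exact: caughtY.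
  by apply: (@caughtYX _ _ _ _ C set0 setT); rewrite ?cards0 ?cnX_cnY //; exact: caughtX.
have [] := IH (ltnW le) (clean n.+1).
- by have := @card_clean n.+1 le; clear; lia.
- exact: (@disjoint_dirty_clean n.+1).
have sub : clean n.+1 \subset @cnY T T H (dirty n.+1).
  by apply/subsetP=> y yC; apply/cnYP=> x xD; apply: clean_dirty yC.
have le' : d <= #|C| + #|dirty n.+1| by rewrite card_dirty.
move=> cX cY; split.
  by apply: (@caughtXY _ _ _ _ C (dirty n.+1) (clean n.+1)).
by apply: (@caughtYX _ _ _ _ C (dirty n.+1) (clean n.+1)); rewrite ?cnX_cnY.
Qed.

Lemma clique_hn : hn (dense_graph H) <= m.
Proof.
apply: (caught_hn card_cliqueT card_cliqueT).
have [] // := @caught_clique d (leqnn d) set0.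
  by rewrite cards0.
by rewrite -setI_eq0 setI0.
Qed.

End HasClique.

Theorem hn_cliqueP : hn (dense_graph H) <= m <->
  exists2 S : {set U}, #|S| = k & forall u v, u \in S -> v \in S -> compat u v.
Proof.
split=> [le|[S Sk SC]]; last exact: clique_hn SC.
apply: contrapT => no; move: le; rewrite leqNgt => /negP; apply.
by apply: noclique_hn => S Sk SC; apply: no; exists S.
Qed.

End CliqueGraph.

(** * Computation tableaux as cliques *)

(** As many elements as cells and one value per cell make a clique a total assignment. The pairs
    [p = p'] are included, so [compat] can also express unary constraints. *)
Lemma clique_assignment (Cell Val : finType) (compat : rel (Cell * Val)) :
  (forall c v v', compat (c, v) (c, v') -> v = v') ->
  (exists2 S : {set Cell * Val}, #|S| = #|Cell| &
     forall p p', p \in S -> p' \in S -> compat p p') <->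
  exists f : Cell -> Val, forall c c', compat (c, f c) (c', f c').
Proof.
move=> uniq_val; split=> [[S cS compS]|[f compf]]; last first.
  exists [set (c, f c) | c in setT].
    by rewrite card_imset ?cardsT // => c c' [].
  by move=> _ _ /imsetP[c _ ->] /imsetP[c' _ ->].
suff h c : exists v, (c, v) \in S.
  have [f fS] := fin_all_exists h.
  by exists f => c c'; apply: compS.
have /eqP fT : [set p.1 | p in S] == setT.
  rewrite eqEcard subsetT cardsT card_in_imset ?cS ?leqnn //.
  move=> [c1 v1] [c2 v2] /= S1 S2 e; rewrite -e in S2 *; congr (_, _).
  exact: uniq_val (compS _ _ S1 S2).
have : c \in [set p.1 | p in S] by rewrite fT.
by case/imsetP=> -[c' v] cS' ->; exists v.
Qed.

(** One alphabet serves two purposes: [mGuess] labels the columns of the tableau whose initial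
    symbol is free, while [mStart] and [mEnd] delimit the tapes of the reduction program, which
    keeps these labels on a tape. *)
Definition mark : finType := (bool * bool)%type.
Definition msym : finType := option (bool + mark).
Definition mStart : msym := Some (inr (false, false)).
Definition mEnd : msym := Some (inr (false, true)).
Definition mGuess : msym := Some (inr (true, false)).

Definition code_prefix (w : seq bool) : seq bool :=
  flatten [seq [:: b; b] | b <- w] ++ [:: true; false].

Lemma pair_codeE w u : pair_code w u = code_prefix w ++ u.
Proof. by rewrite /pair_code /code_prefix -catA. Qed.

Lemma size_code_prefix w : size (code_prefix w) = (size w).*2 + 2.
Proof. by rewrite size_cat /=; congr (_ + _); elim: w => //= b w ->. Qed.

Definition bits (Gamma : finType) (u : seq bool) : seq (symbol Gamma) :=
  [seq Some (inl b) | b <- u].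

(** Bits followed only by blanks spell a word; in this way a guess zone of fixed size accommodates
    all shorter certificates. *)
Lemma bit_prefix_guess (Gamma : finType) (l : seq (symbol Gamma)) :
  (forall j, j < size l -> nth None l j = None \/ exists b, nth None l j = Some (inl b)) ->
  (forall j, j.+1 < size l -> nth None l j = None -> nth None l j.+1 = None) ->
  forall j, nth None (bits Gamma (bit_prefix l)) j = nth None l j.
Proof.
elim: l => [|x l IH] // ok mono; have := ok 0 isT; case=> [x0|[b xb]]; last first.
  rewrite (xb : x = _); case=> [//|j] /=; apply: IH => i lt.
    exact: (ok i.+1).
  exact: (mono i.+1).
have all0 j : j <= size l -> nth None (x :: l) j = None.
  by elim: j => // j IHj lt; apply: mono => //; apply: IHj; apply: ltnW.
move=> j; have -> : bit_prefix (x :: l) = [::] by rewrite (x0 : x = _).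
rewrite nth_nil; have [le|lt] := leqP j (size l); first by rewrite all0.
by rewrite nth_default.
Qed.

Lemma size_bit_prefix (Gamma : finType) (l : seq (symbol Gamma)) :
  size (bit_prefix l) <= size l.
Proof. by elim: l => //= -[[b|g]|] l IH /=. Qed.

(** * Local constraints of a tableau and their correctness *)

Section Machine.
Variable M : machine.
Local Notation I := 'I_(ntapes M).+1.
Local Notation sym := (symbol (aux M)).

Definition reading : finType := {ffun I -> option (bool + aux M)}.

(* The value of a cell: state of the machine, symbols under the heads, and
   symbols of the tapes at the position of the cell relative to the heads. *)
Definition cellval : finType := (state M * reading * reading)%type.

Definition is_move (d e : move) : bool :=
  match d, e with Left, Left | Stay, Stay | Right, Right => true | _, _ => false end.

Definition action (q : state M) (r : reading) : state M * (I -> sym * move) :=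
  if halt q then (q, fun i => (r i, Stay)) else delta q r.

(** A head that moves by [e] shifts its tape the opposite way relative to itself. Each displacement
    between consecutive rows therefore constrains only the tapes whose head makes the corresponding
    move. *)
Definition vert_ok (e : move) (xA : bool) (v v' : cellval) : bool :=
  (v'.1.1 == (action v.1.1 v.1.2).1) &&
  [forall i, is_move e ((action v.1.1 v.1.2).2 i).2 ==>
     (v'.2 i == (if xA then ((action v.1.1 v.1.2).2 i).1 else v.2 i))].

Definition init_ok (s : reading) (cx : msym) : bool :=
  [forall i, (i != ord0) ==> (s i == None)] &&
  match cx with
  | Some (inl b) => s ord0 == Some (inl b)
  | _ => if cx == mGuess then
           if s ord0 is Some (inr _) then false else true
         else s ord0 == None
  end.

Definition unary_ok (v : cellval) (t0 tA xA : bool) (cx : msym) : bool :=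
  [&& xA ==> (v.2 == v.1.2),
      t0 ==> (v.1.1 == start M) && init_ok v.2 cx &
      tA && xA ==> (v.2 ord_max == Some (inl true))].

(** State and symbols read are repeated in all the cells of a row, so each cell can evaluate the
    transition function by itself. In the initial row, a blank in the guess zone forces a blank to
    its right. *)
Definition row_ok (v v' : cellval) (t0 : bool) (cx cx' : msym) : bool :=
  (v.1 == v'.1) &&
  ([&& t0, cx == mGuess, cx' == mGuess & v.2 ord0 == None] ==> (v'.2 ord0 == None)).

Definition compat_fun (v v' : cellval) (teq tsucc xeq xsucc xpred t0 tA xA : bool)
    (cx cx' : msym) : bool :=
  if teq && xeq then (v == v') && unary_ok v t0 tA xA cx
  else if teq && xsucc then row_ok v v' t0 cx cx'
  else if tsucc && xeq then vert_ok Stay xA v v'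
  else if tsucc && xsucc then vert_ok Left xA v v'
  else if tsucc && xpred then vert_ok Right xA v v'
  else true.

Variables (w : seq bool) (A B Z : nat).

Definition cells_x : seq msym :=
  nseq A None ++ [seq Some (inl b) | b <- code_prefix w] ++ nseq B mGuess ++ nseq Z None.

Definition width := A + ((size w).*2 + 2) + B + Z.

Lemma size_cells_x : size cells_x = width.
Proof. by rewrite !size_cat !size_nseq size_map size_code_prefix /width !addnA. Qed.

Definition cell : finType := ('I_A.+1 * 'I_width)%type.

Definition cell_compat (p p' : cell * cellval) : bool :=
  let: ((t, x), v) := p in let: ((t', x'), v') := p' in
  compat_fun v v' (t == t' :> nat) (t.+1 == t') (x == x' :> nat) (x.+1 == x')
    (x'.+1 == x) (t == 0 :> nat) (t == A :> nat) (x == A :> nat)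
    (nth None cells_x x) (nth None cells_x x').

Definition sat (c : config M) (x : nat) (i : I) : sym :=
  if A <= x then nth None (c.2 i).2 (x - A) else nth None (c.2 i).1 (A.-1 - x).

Definition reads (c : config M) : reading := [ffun i => read (c.2 i)].

Lemma reads_sat c i : reads c i = sat c A i.
Proof. by rewrite ffunE /sat leqnn subnn /read; case: (c.2 i).2. Qed.

Lemma step_state c : (step c).1 = (action c.1 (reads c)).1.
Proof.
rewrite /step /action; case: ifP => // _.
by rewrite /reads; case: (delta _ _).
Qed.

Lemma sat_step c e x y i : is_move e ((action c.1 (reads c)).2 i).2 ->
  match e with Left => y = x.+1 | Stay => y = x | Right => x = y.+1 end ->
  sat (step c) y i = if x == A then ((action c.1 (reads c)).2 i).1 else sat c x i.
Proof.
rewrite /step /action; case: ifP => h /=.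
  by case: e => //= _ ->; case: eqP => // ->; rewrite reads_sat.
rewrite -/(reads c); case: (delta _ _) => q act /=; rewrite /sat /=.
case: (c.2 i) => l r; case: (act i) => s [] /=; case: e => //= _.
- move=> ->; case: (ltngtP x A) => [lt|lt|->].
  + have [le|lt'] := leqP A x.+1.
      have -> : x.+1 - A = 0 by lia.
      have -> : A.-1 - x = 0 by lia.
      by case: l.
    have -> : A.-1 - x = (A.-1 - x.+1).+1 by lia.
    by case: l => [|a l] /=; rewrite ?nth_nil.
  + rewrite (ltnW (leqW lt)); have -> : x.+1 - A = (x - A).+1 by lia.
    have -> : x - A = (x - A).-1.+1 by lia.
    by case: r => [|a r] /=; rewrite ?nth_nil.
  + by rewrite leqnSn subSn ?subnn.
- move=> ->; case: (ltngtP x A) => [lt|lt|->].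
  + by [].
  + have -> : x - A = (x - A).-1.+1 by lia.
    by case: r => [|a r] /=; rewrite ?nth_nil.
  + by rewrite subnn.
- move=> ->; case: (ltngtP y.+1 A) => [lt|lt|e].
  + rewrite leqNgt (ltnW lt) /=.
    by have -> : A.-1 - y = (A.-1 - y.+1).+1 by lia.
  + rewrite -ltnS lt; have -> : y.+1 - A = (y - A).+1 by lia.
    by case: r => [|a r] /=; rewrite ?nth_nil.
  + by rewrite leqNgt -e ltnSn /= subnn.
Qed.

Variable V : seq bool -> bool.
Variable c' : nat.
Hypothesis MV : forall x, let final := iter (size x ^ c' + c') (@step M) (init M x) in
  halt final.1 /\ output final = [:: V x].
Hypothesis A_ge : forall n, n <= (size w).*2 + 2 + B -> n ^ c' + c' <= A.
Hypothesis Z_ge : A < (size w).*2 + 2 + Z.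

Lemma iter_step_halt c n : halt c.1 -> iter n (@step M) c = c.
Proof. by move=> hc; elim: n => //= n ->; rewrite /step hc. Qed.

Lemma output_iter x : size x <= (size w).*2 + 2 + B ->
  output (iter A (@step M) (init M x)) = [:: V x].
Proof.
move=> le; have [hf <-] := MV x.
by rewrite -(subnKC (A_ge le)) addnC iterD iter_step_halt.
Qed.

Lemma output_head (c : config M) b : output c = [:: b] ->
  (sat c A ord_max == Some (inl true)) = b.
Proof.
rewrite /sat leqnn subnn /output; case: (c.2 ord_max).2 => [|[[x|g]|] r] //=.
by case=> -> _; case: b.
Qed.

Lemma sat_init x y i : sat (init M x) y i =
  if (i == ord0) && (A <= y) then nth None (bits (aux M) x) (y - A) else None.
Proof.
by rewrite /sat /=; case: (i == ord0); case: leqP; rewrite /= ?nth_nil.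
Qed.

Lemma nth_cells_x (x : nat) : nth None cells_x x =
  if x < A then None else if x - A < (size w).*2 + 2 then
    Some (inl (nth false (code_prefix w) (x - A)))
  else if x - A < (size w).*2 + 2 + B then mGuess else None.
Proof.
rewrite nth_cat size_nseq nth_nseq; case: ltnP => // le.
rewrite nth_cat size_map size_code_prefix; case: ltnP => [lt|le2].
  by rewrite (nth_map false) ?size_code_prefix.
rewrite nth_cat size_nseq !nth_nseq -(ltn_subLR _ le2); case: ltnP => // _.
by case: ifP.
Qed.

Lemma tableau_complete u : size u <= B -> V (pair_code w u) ->
  exists f : cell -> cellval, forall p p', cell_compat (p, f p) (p', f p').
Proof.
move=> leu Vu; set x0 := pair_code w u.
have sx0 : size x0 <= (size w).*2 + 2 + B.
  by rewrite /x0 pair_codeE size_cat size_code_prefix leq_add2l.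
pose conf t := iter t (@step M) (init M x0).
pose sats c x : reading := [ffun i => sat c x i].
pose row (t x : nat) : cellval := ((conf t).1, reads (conf t), sats (conf t) x).
have satsE c x i : sats c x i = sat c x i by rewrite ffunE.
exists (fun p : cell => row p.1 p.2).
move=> [t x] [t' x'] /=; rewrite /compat_fun.
have vert e : t.+1 = t' -> match e with Left => x' = x.+1 :> nat | Stay => x' = x :> nat | Right => x = x'.+1 :> nat end ->
    vert_ok e (x == A :> nat) (row t x) (row t' x').
  move=> <- ex; rewrite /vert_ok /= -step_state eqxx; apply/forallP=> i.
  by apply/implyP=> mv; rewrite !satsE (sat_step mv ex).
case: (eqVneq (t : nat) t') => [tt|_] /=.
  case: (eqVneq (x : nat) x') => [xx|_] /=.
    rewrite -(val_inj tt) -(val_inj xx) eqxx /unary_ok /=; apply/and3P; split.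
    - by apply/implyP=> /eqP xA; apply/eqP/ffunP=> i; rewrite reads_sat satsE xA.
    - apply/implyP=> /eqP t0; rewrite t0 /= eqxx andTb /init_ok; apply/andP; split.
        by apply/forallP=> i; apply/implyP=> ne; rewrite satsE sat_init (negPf ne).
      rewrite satsE sat_init eqxx /= nth_cells_x ltnNge; case: (leqP A x) => //= le.
      rewrite /x0 pair_codeE /bits map_cat nth_cat size_map size_code_prefix.
      case: ltnP => [lt|ge]; first by rewrite (nth_map false) ?size_code_prefix.
      case: ltnP => [lt|ge2].
        rewrite eqxx; case: (ltnP (x - A - ((size w).*2 + 2)) (size u)) => [lt2|ge3].
          by rewrite (nth_map false).
        by rewrite nth_default // size_map.
      by rewrite nth_default // size_map; move: ge2 leu; clear; lia.
    - apply/implyP=> /andP[/eqP tA /eqP xA]; rewrite satsE tA xA.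
      by rewrite (output_head (output_iter sx0)).
  case: (eqVneq x.+1 (x' : nat)) => [xx|_] /=.
    rewrite /row_ok -(val_inj tt) /= eqxx; apply/implyP=> /and4P[/eqP t0].
    rewrite !satsE t0 !sat_init !eqxx -xx /= !nth_cells_x.
    case: (ltnP x A) => // le; case: ltnP => // ge _ _.
    rewrite leqW // /x0 pair_codeE /bits map_cat !nth_cat size_map size_code_prefix.
    have -> : x.+1 - A = (x - A).+1 by move: le; clear; lia.
    rewrite !ltnNge ge leqW //= subSn //; set j := _ - _ => /eqP j0.
    rewrite nth_default // size_map; rewrite leqNgt; apply/negP=> lt.
    by move: j0; rewrite (nth_map false) // ltnW.
  by rewrite -tt (gtn_eqF (ltnSn t)).
case: (eqVneq t.+1 (t' : nat)) => [tt|_] //=.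
case: (eqVneq (x : nat) x') => [xx|_] /=; first exact: vert.
case: (eqVneq x.+1 (x' : nat)) => [xx|_] /=; first exact: vert.
by case: (eqVneq x'.+1 (x : nat)) => [xx|_] //=; apply: vert.
Qed.

Section Soundness.
Variable f : cell -> cellval.
Hypothesis compf : forall p p', cell_compat (p, f p) (p', f p').

Let ltW2 : A.*2 < width. Proof. by rewrite /width; move: Z_ge; clear; lia. Qed.

(* The values indexed by natural numbers; out-of-range indices are mapped to
   [inord], so that bounds are required below. *)
Let g (t x : nat) : cellval := f (inord t, insubd (Ordinal (leq_ltn_trans (leq0n _) ltW2)) x).

Let gE (t : 'I_A.+1) (x : 'I_width) : g t x = f (t, x).
Proof. by rewrite /g inord_val valKd. Qed.

Let unary_g t x : t <= A -> x < width ->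
  unary_ok (g t x) (t == 0) (t == A) (x == A) (nth None cells_x x).
Proof.
move=> lt lx; rewrite -ltnS in lt.
have := compf (Ordinal lt, Ordinal lx) (Ordinal lt, Ordinal lx).
by rewrite -gE /cell_compat /compat_fun !eqxx /=.
Qed.

Let row_g t x : t <= A -> x.+1 < width ->
  row_ok (g t x) (g t x.+1) (t == 0) (nth None cells_x x) (nth None cells_x x.+1).
Proof.
move=> lt lx; rewrite -ltnS in lt.
have := compf (Ordinal lt, Ordinal (ltnW lx)) (Ordinal lt, Ordinal lx).
by rewrite -!gE /cell_compat /compat_fun !eqxx /= (ltn_eqF (ltnSn x)).
Qed.

Let vert_g e t x y : t < A -> x < width -> y < width ->
  match e with Left => y = x.+1 | Stay => y = x | Right => x = y.+1 end ->
  vert_ok e (x == A) (g t x) (g t.+1 y).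
Proof.
move=> lt lx ly exy; have lt1 : t < A.+1 by apply: ltnW.
have := compf (Ordinal lt1, Ordinal lx) (Ordinal (lt : t.+1 < A.+1), Ordinal ly).
rewrite -!gE /cell_compat /compat_fun /= (ltn_eqF (ltnSn t)) !eqxx /=.
case: e exy => ->; rewrite ?eqxx ?(ltn_eqF (ltnSn _)) ?(gtn_eqF (ltnSn _)) //=.
by rewrite gtn_eqF // ltnW.
Qed.

Let row_const t x : t <= A -> x < width -> (g t x).1 = (g t 0).1.
Proof.
move=> lt; elim: x => // x IH lx; rewrite -IH; last exact: ltnW.
by have /andP[/eqP-> _] := row_g lt lx.
Qed.

Let u := bit_prefix [seq (g 0 (A + ((size w).*2 + 2) + j)).2 ord0 | j <- iota 0 B].

Let size_u : size u <= B.
Proof. by apply: leq_trans (size_bit_prefix _) _; rewrite size_map size_iota. Qed.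

Let init_g x : x < width -> init_ok (g 0 x).2 (nth None cells_x x).
Proof. by move=> lx; have /and3P[_ /andP[]] := @unary_g 0 x (leq0n _) lx. Qed.

Let guess_u j : j < B ->
  nth None (bits (aux M) u) j = (g 0 (A + ((size w).*2 + 2) + j)).2 ord0.
Proof.
have guess i : i < B -> nth None cells_x (A + ((size w).*2 + 2) + i) = mGuess.
  move=> lt; rewrite nth_cells_x ltnNge -addnA leq_addr /= addKn.
  by rewrite ltnNge leq_addr /= ltn_add2l lt.
have inW i : i < B -> A + ((size w).*2 + 2) + i < width.
  by rewrite /width; clear; lia.
move=> lt; rewrite bit_prefix_guess; first by rewrite (nth_map 0) ?size_iota // nth_iota.
  move=> i; rewrite size_map size_iota => lti; rewrite (nth_map 0) ?size_iota // nth_iota //.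
  have := init_g (inW i lti); rewrite /init_ok guess // => /andP[_] /=.
  by rewrite add0n; case: (_ ord0) => [[b|//]|] _; [right; exists b|left].
move=> i; rewrite size_map size_iota => lti; rewrite !(nth_map 0) ?size_iota // 1?ltnW // !nth_iota // 1?ltnW //.
rewrite !add0n => /eqP e0; have lt1 : (A + ((size w).*2 + 2) + i).+1 < width by rewrite -addnS inW.
have /andP[_ /implyP h] := @row_g 0 _ (leq0n _) lt1.
by apply/eqP; rewrite addnS; apply: h; rewrite -addnS !guess ?e0 // ltnW.
Qed.

Let conf t := iter t (@step M) (init M (pair_code w u)).

Let row0 x i : x < width -> (g 0 x).2 i = sat (conf 0) x i.
Proof.
move=> lx; rewrite /conf /= sat_init; have /andP[/forallP/(_ i) h0 hx] := init_g lx.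
case: eqVneq => [ei|ni] /=; last by move: h0; rewrite ni => /eqP.
rewrite ei; move: hx; rewrite nth_cells_x ltnNge; case: (leqP A x) => [le|_] /=; last by move/eqP.
rewrite pair_codeE /bits map_cat nth_cat size_map size_code_prefix.
case: ltnP => [lt /eqP->|ge]; first by rewrite (nth_map false) ?size_code_prefix.
case: ltnP => [lt _|ge2 /eqP->].
  rewrite -/(bits _ u) guess_u; last by move: lt ge; clear; lia.
  by congr ((g 0 _).2 _); move: le ge; clear; lia.
by rewrite nth_default // size_map; move: size_u ge2; clear; lia.
Qed.

(** The border columns are not fully constrained by the previous row, and errors can spread inwards
    by one column per step. The columns from [t] to [2 A - t] stay correct; at [t = A] this is just
    the head column, where acceptance is tested. *)
Let cone t : t <= A -> (g t 0).1 = ((conf t).1, reads (conf t)) /\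
  forall x i, t <= x -> x + t <= A.*2 -> (g t x).2 i = sat (conf t) x i.
Proof.
have center t' : t' <= A ->
    (forall x i, t' <= x -> x + t' <= A.*2 -> (g t' x).2 i = sat (conf t') x i) ->
    (g t' 0).1.2 = reads (conf t').
  move=> le h; have lA : A < width by apply: leq_ltn_trans ltW2; rewrite -addnn leq_addr.
  have /and3P[/implyP/(_ (eqxx _))/eqP e _ _] := unary_g le lA.
  rewrite -(row_const le lA) -e; apply/ffunP=> i; rewrite reads_sat h //.
  by rewrite -addnn leq_add2l.
elim: t => [_|t IH lt].
  have h x i : 0 <= x -> x + 0 <= A.*2 -> (g 0 x).2 i = sat (conf 0) x i.
    by rewrite addn0 => _ le; apply: row0; apply: leq_ltn_trans ltW2.
  split=> //; rewrite [LHS]surjective_pairing (center 0) //; congr (_, _).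
  have /and3P[_ /implyP/(_ (eqxx _))/andP[/eqP e _] _] := @unary_g 0 0 (leq0n _) (leq_ltn_trans (leq0n _) ltW2).
  exact: e.
have [eg IHx] := IH (ltnW lt).
have gx x : x < width -> (g t x).1 = ((conf t).1, reads (conf t)).
  by move=> lx; rewrite row_const ?eg // ltnW.
have h x i : t.+1 <= x -> x + t.+1 <= A.*2 -> (g t.+1 x).2 i = sat (conf t.+1) x i.
  move=> lex lex2.
  have [e mv] : exists e, is_move e ((action (conf t).1 (reads (conf t))).2 i).2.
    by exists ((action (conf t).1 (reads (conf t))).2 i).2; case: (_.2).
  have [y eyx [ty yt]] : exists2 y,
      match e with Left => x = y.+1 | Stay => x = y | Right => y = x.+1 end &
      t <= y /\ y + t <= A.*2.
    case: e {mv}; [exists x.-1|exists x|exists x.+1]; move: lex lex2; clear; lia.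
  have ly : y < width by apply: leq_ltn_trans ltW2; apply: leq_trans yt; apply: leq_addr.
  have lx : x < width by apply: leq_ltn_trans ltW2; move: lex2; clear; lia.
  have := vert_g lt ly lx eyx; rewrite /vert_ok gx //= => /andP[_ /forallP/(_ i)].
  rewrite mv /= => /eqP->; rewrite (sat_step mv eyx).
  by case: ifP => // _; rewrite IHx.
split=> //; rewrite [LHS]surjective_pairing (center t.+1) //; congr (_, _).
have l0 : 0 < width by apply: leq_ltn_trans ltW2.
have := @vert_g Stay t 0 0 lt l0 l0 erefl; rewrite /vert_ok gx //= => /andP[/eqP-> _].
by rewrite -step_state.
Qed.

Lemma tableau_sound : exists u, size u <= B /\ V (pair_code w u).
Proof.
exists u; split=> //.
have lA : A < width by apply: leq_ltn_trans ltW2; rewrite -addnn leq_addr.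
have /and3P[_ _ /implyP] := unary_g (leqnn A) lA; rewrite eqxx => /(_ isT).
have [_ h] := cone (leqnn A).
rewrite h ?addnn // (output_head (b := V (pair_code w u))) // output_iter //.
by rewrite pair_codeE size_cat size_code_prefix leq_add2l.
Qed.

End Soundness.

Theorem tableauP :
  (exists2 S : {set cell * cellval}, #|S| = #|cell| &
     forall p p', p \in S -> p' \in S -> cell_compat p p') <->
  exists u, size u <= B /\ V (pair_code w u).
Proof.
rewrite clique_assignment; last first.
  move=> [t x] v v'; rewrite /cell_compat /compat_fun !eqxx /=.
  by case/andP=> /eqP.
split=> [[f /tableau_sound] //|[u [leu Vu]]].
exact: tableau_complete leu Vu.
Qed.

End Machine.

(** * Structured programs for multi-tape machines *)

Definition poly_bounded (f : nat -> nat) : Prop :=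
  exists c, forall n, f n <= n ^ c + c.

Section Programs.
Variables (K Gamma : finType).
Local Notation sym := (option (bool + Gamma)).

(* Head position and contents of a tape that is never used to the left of its
   initial head position. *)
Definition atape : Type := nat * (nat -> sym).
Definition store : Type := K -> atape.
Definition readout : finType := {ffun K -> sym}.
Definition acts : Type := K -> sym * move.

Definition rd (s : store) : readout := [ffun k => (s k).2 (s k).1].

Definition do1 (t : atape) (a : sym * move) : atape :=
  (match a.2 with Left => t.1.-1 | Stay => t.1 | Right => t.1.+1 end,
   fun i => if i == t.1 then a.1 else t.2 i).

Definition doA (a : acts) (s : store) : store := fun k => do1 (s k) (a k).

Definition okA (a : acts) (s : store) : Prop :=
  forall k, is_move Left (a k).2 -> 0 < (s k).1.

Inductive prog : Type :=
| Act of (readout -> acts)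
| Seq of prog & prog
| If of (readout -> bool) & prog & prog
| While of (readout -> bool) & prog.

Inductive exec : prog -> store -> store -> nat -> Prop :=
| exec_act f s : okA (f (rd s)) s -> exec (Act f) s (doA (f (rd s)) s) 1
| exec_seq p q s1 s2 s3 t1 t2 : exec p s1 s2 t1 -> exec q s2 s3 t2 ->
    exec (Seq p q) s1 s3 (t1 + t2)
| exec_ift (b : readout -> bool) p q s s' t : b (rd s) -> exec p s s' t -> exec (If b p q) s s' t.+1
| exec_iff (b : readout -> bool) p q s s' t : ~~ b (rd s) -> exec q s s' t -> exec (If b p q) s s' t.+1
| exec_whilef (b : readout -> bool) p s : ~~ b (rd s) -> exec (While b p) s s 1
| exec_whilet (b : readout -> bool) p s1 s2 s3 t1 t2 : b (rd s1) -> exec p s1 s2 t1 ->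
    exec (While b p) s2 s3 t2 -> exec (While b p) s1 s3 (t1 + t2).+1.

Definition nop (r : readout) : acts := fun k => (r k, Stay).

Lemma do1_same (t : atape) : do1 t (t.2 t.1, Stay) = t.
Proof.
case: t => p c; rewrite /do1 /=; congr (_, _).
by apply/funext=> i; case: eqP => [->|].
Qed.

Lemma doA_nop s : doA (nop (rd s)) s = s.
Proof. by apply/funext=> k; rewrite /doA /nop ffunE do1_same. Qed.

(** The extra state [None] of [If] and [While] performs the test, at the price of one step that
    changes no tape. *)
Fixpoint St (p : prog) : finType :=
  match p with
  | Act _ => unit
  | Seq p q => (St p + St q)%type
  | If _ p q => option (St p + St q)%type
  | While _ p => option (St p)
  end.

Fixpoint entry (p : prog) : St p :=
  match p return St p with
  | Act _ => tt
  | Seq p q => inl (entry p)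
  | If _ p q => None
  | While _ p => None
  end.

Fixpoint next (p : prog) : St p -> readout -> option (St p) * acts :=
  match p return St p -> readout -> option (St p) * acts with
  | Act f => fun _ r => (None, f r)
  | Seq p q => fun s r =>
      match s with
      | inl s => let: (o, a) := next s r in
                 (if o is Some s' then Some (inl s') else Some (inr (entry q)), a)
      | inr s => let: (o, a) := next s r in (omap inr o, a)
      end
  | If b p q => fun s r =>
      match s with
      | None => (Some (Some (if b r then inl (entry p) else inr (entry q))), nop r)
      | Some (inl s) => let: (o, a) := next s r in (omap (fun s' => Some (inl s')) o, a)
      | Some (inr s) => let: (o, a) := next s r in (omap (fun s' => Some (inr s')) o, a)
      end
  | While b p => fun s r =>
      match s with
      | None => (if b r then Some (Some (entry p)) else None, nop r)
      | Some s => let: (o, a) := next s r in (Some o, a)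
      end
  end.

Inductive runs (p : prog) : St p -> store -> store -> nat -> Prop :=
| runs_exit z s a : next z (rd s) = (None, a) -> okA a s -> runs z s (doA a s) 1
| runs_step z z' s s' a t : next z (rd s) = (Some z', a) -> okA a s ->
    runs z' (doA a s) s' t -> runs z s s' t.+1.

Lemma exec_runs p s s' t : exec p s s' t -> runs (entry p) s s' t.
Proof.
elim=> {p s s' t} [f s ok|p q s1 s2 s3 t1 t2 _ r1 _ r2|b p q s s' t bs _ r|b p q s s' t bs _ r
  |b p s bs|b p s1 s2 s3 t1 t2 bs _ r1 _ r2].
- exact: runs_exit.
- rewrite /=; elim: r1 r2 => [z s a ez ok|z z' s s' a t ez ok _ IH] r2.
    by apply: (@runs_step (Seq p q) _ (inr (entry q)) _ _ a) => //=; rewrite ?ez //; elim: r2 => [z2 s4 a2 e2 ok2|z2 z3 s4 s5 a2 t3 e2 ok2 _ IH2];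
      [apply: runs_exit|apply: runs_step IH2]; rewrite //= e2.
  rewrite addSn; apply: (@runs_step (Seq p q) _ (inl z') _ _ a) => //=; first by rewrite ez.
  exact: IH.
- apply: (@runs_step (If b p q) None (Some (inl (entry p))) _ _ (nop (rd s))) => //=.
    by rewrite bs.
  rewrite doA_nop; elim: r {bs} => [z2 s4 a2 e2 ok2|z2 z3 s4 s5 a2 t3 e2 ok2 _ IH2];
      [apply: runs_exit|apply: runs_step IH2]; by rewrite //= e2.
- apply: (@runs_step (If b p q) None (Some (inr (entry q))) _ _ (nop (rd s))) => //=.
    by rewrite (negPf bs).
  rewrite doA_nop; elim: r {bs} => [z2 s4 a2 e2 ok2|z2 z3 s4 s5 a2 t3 e2 ok2 _ IH2];
      [apply: runs_exit|apply: runs_step IH2]; by rewrite //= e2.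
- rewrite -{2}[s]doA_nop; apply: runs_exit => //=.
  by rewrite (negPf bs).
apply: (@runs_step (While b p) None (Some (entry p)) _ _ (nop (rd s1))) => //=.
  by rewrite bs.
rewrite doA_nop; elim: r1 r2 {bs} => [z s a ez ok|z z' s s' a t ez ok _ IH] r2.
  by apply: (@runs_step (While b p) _ None _ _ a) => //=; rewrite ez.
rewrite addSn; apply: (@runs_step (While b p) _ (Some z') _ _ a) => //=; first by rewrite ez.
exact: IH.
Qed.

(** [catrev] lists the tape from its origin, and the length of the left part is the head position.
    Both stay valid because programs never move left of the origin. *)
Definition trel (t : tape Gamma) (a : atape) : Prop :=
  size t.1 = a.1 /\ forall i, nth None (catrev t.1 t.2) i = a.2 i.

Lemma trel_read t a : trel t a -> read t = a.2 a.1.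
Proof.
case: t a => l r [p c] [/= <- h]; rewrite /read /= -h catrevE nth_cat size_rev ltnn subnn.
by case: r {h}.
Qed.

Lemma trel_do t a x : trel t a -> (is_move Left x.2 -> 0 < a.1) ->
  trel (write_move t x) (do1 a x).
Proof.
case: t a x => l r [p c] [s mv] [/= sz h] ok.
have hs i : nth None (catrev l (s :: behead r)) i = if i == p then s else c i.
  rewrite -h !catrevE !nth_cat size_rev sz; case: (ltngtP i p) => [//|gt|->].
    have -> : i - p = (i - p).-1.+1 by move: gt; clear; lia.
    by case: r {h} => [|x r] /=; rewrite ?nth_nil.
  by rewrite subnn.
case: mv ok => /= ok; split=> //=; last by rewrite sz.
- by rewrite size_behead sz.
- move=> i; rewrite -hs; case: l sz {h hs} => [|x l] //= sz.
  by move: (ok isT); rewrite -sz.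
Qed.

Variables kin kout : K.
Hypothesis in_out : kin != kout.

(** The input is on the first tape of a machine and the output on the last, so named tapes are
    listed with [kin] first and [kout] last. *)
Definition tape_names : seq K :=
  kin :: rcons [seq k <- enum K | (k != kin) && (k != kout)] kout.

Definition ntp : nat := (size tape_names).-1.

Lemma mem_tape_names k : k \in tape_names.
Proof.
rewrite /tape_names inE mem_rcons inE mem_filter mem_enum andbT.
by case: (k == kin); case: (k == kout).
Qed.

Definition tname (i : 'I_ntp.+1) : K := nth kin tape_names i.
Definition tindex (k : K) : 'I_ntp.+1 := inord (index k tape_names).

Lemma tindexK k : tname (tindex k) = k.
Proof.
rewrite /tname inordK; first by rewrite nth_index ?mem_tape_names.
by rewrite /ntp prednK // index_mem mem_tape_names.
Qed.

Lemma tname_inj : injective tname.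
Proof.
have u : uniq tape_names.
  rewrite /= rcons_uniq mem_rcons inE (negPf in_out) !mem_filter !eqxx /= andbF /=.
  by rewrite filter_uniq ?enum_uniq.
by move=> i j /eqP; rewrite nth_uniq // => /eqP/val_inj.
Qed.

Lemma tname0 : tname ord0 = kin. Proof. by []. Qed.

Lemma tname_max : tname ord_max = kout.
Proof. by rewrite /tname /ntp /= size_rcons /= nth_rcons ltnn eqxx. Qed.

Definition machine_of (p : prog) : machine :=
  @Machine ntp Gamma (option (St p)) (Some (entry p)) (fun z => ~~ isSome z)
    (fun z r =>
       if z is Some z then
         let: (o, a) := next z [ffun k => r (tindex k)] in (o, fun i => a (tname i))
       else (None, fun i => (r i, Stay))).

Definition crel (p : prog) (c : config (machine_of p)) (z : option (St p)) (s : store) : Prop :=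
  c.1 = z /\ forall i, trel (c.2 i) (s (tname i)).

Lemma crel_runs p (z : St p) s s' t c : runs z s s' t -> crel c (Some z) s ->
  crel (iter t (@step (machine_of p)) c) None s'.
Proof.
have one z1 o a s1 c1 : next z1 (rd s1) = (o, a) -> okA a s1 -> crel c1 (Some z1) s1 ->
    crel (@step (machine_of p) c1) o (doA a s1).
  move=> e ok [c1z c1t]; rewrite /step c1z /=.
  have -> : [ffun k => [ffun i => read (c1.2 i)] (tindex k)] = rd s1.
    by apply/ffunP=> k; rewrite !ffunE (trel_read (c1t _)) tindexK.
  rewrite e; split=> //= i; apply: trel_do (c1t i) _; exact: ok.
move=> r; elim: r c => {z s s' t} [z s a e ok|z z' s s' a t e ok _ IH] c cr.
  exact: one e ok cr.
by rewrite iterSr; apply: IH; apply: one e ok cr.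
Qed.

Definition start_store (w : seq bool) : store :=
  fun k => (0, nth None (if k == kin then bits Gamma w else [::])).

Lemma bit_prefix_nth (r : seq (symbol Gamma)) u :
  (forall i, nth None r i = nth None (bits Gamma u) i) -> bit_prefix r = u.
Proof.
elim: u r => [|b u IH] [|x r] h //=.
- by have := h 0; rewrite /= => ->.
- by have := h 0.
- have := h 0; rewrite /= => ->; congr (_ :: _).
  by apply: IH => i; apply: (h i.+1).
Qed.

Theorem exec_polytime (p : prog) (f : seq bool -> seq bool) (tm : nat -> nat) :
  poly_bounded tm ->
  (forall w, exists s t, [/\ exec p (start_store w) s t, t <= tm (size w) &
     forall i, (s kout).2 ((s kout).1 + i) = nth None (bits Gamma (f w)) i]) ->
  polytime f.
Proof.
move=> [c hc] h; exists (machine_of p), c => w /=.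
have [s [t [/exec_runs r le out]]] := h w.
have c0 : crel (init (machine_of p) w) (Some (entry p)) (start_store w).
  split=> //= i; split=> //= j; rewrite /start_store /=.
  rewrite -tname0 (inj_eq tname_inj); by case: ifP.
have := crel_runs r c0; set cf := iter t _ _ => -[cz ct].
have hf : halt cf.1 by rewrite cz.
have -> : size w ^ c + c = (size w ^ c + c - t) + t by rewrite subnK // (leq_trans le).
rewrite iterD -/cf iter_step_halt //; split=> //.
apply: bit_prefix_nth => i; rewrite -out; have := ct ord_max.
rewrite tname_max; case: (cf.2 ord_max) => l r' [/= sz <-].
by rewrite catrevE nth_cat size_rev sz ltnNge leq_addr /= addKn.
Qed.

End Programs.

(** * Timed reasoning rules, loops over tapes and comparison of heads *)

Section Calculus.
Variable K : finType.
Local Notation store := (store K mark).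
Local Notation prog := (prog K mark).
Local Notation readout := (readout K mark).
Local Notation atape := (atape mark).
Implicit Types (s : store) (p q body : prog).

Definition trans p s s' (t : nat) : Prop := exists2 t', t' <= t & exec p s s' t'.

Lemma trans_le p s s' t t' : t <= t' -> trans p s s' t -> trans p s s' t'.
Proof. by move=> le [t1 le1 ex]; exists t1 => //; apply: leq_trans le. Qed.

Lemma trans_seq p q s1 s2 s3 t1 t2 :
  trans p s1 s2 t1 -> trans q s2 s3 t2 -> trans (Seq p q) s1 s3 (t1 + t2).
Proof.
by move=> [t le ex] [t' le' ex']; exists (t + t'); [apply: leq_add|apply: exec_seq ex ex'].
Qed.

Lemma trans_if (b : readout -> bool) p q s s' t :
  trans (if b (rd s) then p else q) s s' t -> trans (If b p q) s s' t.+1.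
Proof.
case: ifP => bs [t' le ex]; exists t'.+1 => //; first exact: exec_ift.
by apply: exec_iff; rewrite ?bs.
Qed.

Lemma trans_while (b : readout -> bool) p (F : nat -> store) n t :
  (forall i, i < n -> b (rd (F i)) /\ trans p (F i) (F i.+1) t) ->
  ~~ b (rd (F n)) -> trans (While b p) (F 0) (F n) (n * t.+1 + 1).
Proof.
elim: n F => [|n IH] F h nb; first by exists 1; rewrite ?addn1 //; apply: exec_whilef.
have [b0 [t0 le0 ex0]] := h 0 isT.
have [|t1 le1 ex1] := IH (fun i => F i.+1) _ nb; first by move=> i lt; apply: h.
exists (t0 + t1).+1; last exact: exec_whilet b0 ex0 ex1.
by move: le0 le1; rewrite mulSn; clear; lia.
Qed.

Definition shift (d : move) (n : nat) : nat :=
  match d with Left => n.-1 | Stay => n | Right => n.+1 end.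

Definition mvf (d : K -> move) : prog := Act (fun r k => (r k, d k)).

Lemma trans_mvf (d : K -> move) s s' : (forall k, is_move Left (d k) -> 0 < (s k).1) ->
  (forall k, s' k = (shift (d k) (s k).1, (s k).2)) -> trans (mvf d) s s' 1.
Proof.
move=> ok e; exists 1 => //.
have -> : s' = doA (fun k => (rd s k, d k)) s.
  apply/funext=> k; rewrite e /doA ffunE /do1 /=; congr (_, _).
  by apply/funext=> i; case: eqP => // ->.
exact: exec_act.
Qed.

Definition skip : prog := mvf (fun=> Stay).

Lemma trans_skip s : trans skip s s 1.
Proof. by apply: trans_mvf => // k; case: (s k). Qed.

Definition upd s (k0 : K) (a : atape) : store := fun k => if k == k0 then a else s k.
Definition putg (g : pred K) s (a : atape) : store := fun k => if g k then a else s k.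
Definition lt (l : seq msym) : atape := (size l, nth None l).

Lemma upd_putg (g : pred K) s k a b : ~~ g k -> upd (putg g s a) k b = putg g (upd s k b) a.
Proof.
move=> gk; apply/funext=> k'; rewrite /upd /putg; case: eqP => // ->.
by rewrite (negPf gk).
Qed.

Definition mv (g : pred K) (d : move) : prog := mvf (fun k => if g k then d else Stay).

Definition wr (g : pred K) (f : readout -> msym) (d : move) : prog :=
  Act (fun r k => if g k then (f r, d) else (r k, Stay)).

Lemma trans_wr (g : pred K) f d s s' : ~~ is_move Left d ->
  (forall k, s' k = if g k then
     (shift d (s k).1, fun i => if i == (s k).1 then f (rd s) else (s k).2 i) else s k) ->
  trans (wr g f d) s s' 1.
Proof.
move=> nl e; exists 1 => //.
have -> : s' = doA (fun k => if g k then (f (rd s), d) else (rd s k, Stay)) s.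
  apply/funext=> k; rewrite e /doA; case: ifP => // _.
  by rewrite ffunE do1_same.
apply: (exec_act (f := fun r k => if g k then (f r, d) else (r k, Stay))).
by move=> k; case: ifP => _ //= h; case/negP: nl.
Qed.

(** A head cannot sense where a tape begins, so the work tapes carry [mStart] in cell 0 and nowhere
    else. *)
Definition origin (c : nat -> msym) : Prop := forall i, (c i == mStart) = (i == 0).

Definition at_start (k : K) (r : readout) : bool := r k == mStart.

(* Moves the heads of the tapes of [g], which are at the same position as that of
   [k], back to the origin. *)
Definition rewind (k : K) (g : pred K) : prog :=
  While (fun r => ~~ at_start k r) (mv g Left).

Lemma trans_rewind k (g : pred K) s (p : nat) c : g k -> origin c ->
  trans (rewind k g) (putg g s (p, c)) (putg g s (0, c)) (p * 2 + 1).
Proof.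
move=> gk oc.
have := @trans_while (fun r => ~~ at_start k r) (mv g Left) (fun i => putg g s (p - i, c)) p 1.
rewrite subn0 subnn; apply=> [i lt|].
  split; first by rewrite /at_start ffunE /putg gk /= oc subn_eq0 -ltnNge.
  apply: trans_mvf => k'; rewrite /putg; case: ifP => // _ /=; last by case: (s k').
    by rewrite subn_gt0.
  by rewrite subnS.
by rewrite /at_start ffunE /putg gk /= oc.
Qed.

(** A for-loop whose counter is the content of tape [k] between its marks; the body may use the
    position of the head and the symbol under it. *)
Definition scan (k : K) body : prog :=
  Seq (mv (pred1 k) Right)
    (Seq (While (fun r => r k != mEnd) (Seq body (mv (pred1 k) Right)))
         (rewind k (pred1 k))).

Definition scannable (c : nat -> msym) (v : nat) : Prop :=
  origin c /\ (forall i, i < v -> c i.+1 != mEnd) /\ c v.+1 = mEnd.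

Lemma upd_id s k : upd s k (s k) = s.
Proof. by apply/funext=> k'; rewrite /upd; case: eqP => [->|]. Qed.

Lemma trans_right k s (p : nat) c : trans (mv (pred1 k) Right) (upd s k (p, c)) (upd s k (p.+1, c)) 1.
Proof.
apply: trans_mvf => k'; first by case: ifP.
by rewrite /upd /=; case: eqP => // _; case: (s k').
Qed.

Lemma trans_left k s (p : nat) c : trans (mv (pred1 k) Left) (upd s k (p.+1, c)) (upd s k (p, c)) 1.
Proof.
by apply: trans_mvf => k'; rewrite /upd /=; case: eqP => // _; case: (s k').
Qed.

Lemma trans_scan k body c v L (F : nat -> store) t : scannable c v -> v <= L ->
  (forall i, i <= v -> F i k = (0, c)) ->
  (forall i, i < v -> trans body (upd (F i) k (i.+1, c)) (upd (F i.+1) k (i.+1, c)) t) ->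
  trans (scan k body) (F 0) (F v) (L * (t + 4) + 6).
Proof.
move=> [oc [nE cE]] vL Fk hb.
apply: (@trans_le _ _ _ (1 + ((v * (t + 1).+1 + 1) + (v.+1 * 2 + 1)))).
  have := leq_mul vL (leqnn (t + 4)); rewrite !mulnDr !mulSn !mulnS; clear; lia.
apply: (@trans_seq _ _ _ (upd (F 0) k (1, c))).
  by rewrite -{1}(upd_id (F 0) k) Fk //; apply: trans_right.
apply: (@trans_seq _ _ _ (upd (F v) k (v.+1, c))).
  apply: (trans_while (F := fun i => upd (F i) k (i.+1, c))) => [i lt|]; last first.
    by rewrite ffunE /upd eqxx /= cE eqxx.
  split; first by rewrite ffunE /upd eqxx /=; apply: nE.
  by apply: trans_seq (hb i lt) _; apply: trans_right.
have := @trans_rewind k (pred1 k) (F v) v.+1 c (eqxx k) oc.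
have -> : putg (pred1 k) (F v) (v.+1, c) = upd (F v) k (v.+1, c) by [].
have -> : putg (pred1 k) (F v) (0, c) = F v; last by [].
by apply/funext=> k'; rewrite /putg /=; case: eqP => // ->; rewrite Fk.
Qed.

(** Quantifying over the earlier content [l] makes emission compose by concatenation. A whole group
    of tapes is written in lockstep, since nested loops need several copies of a counter. *)
Definition emits (g : pred K) p s (l0 : seq msym) (t : nat) : Prop :=
  forall l, trans p (putg g s (lt l)) (putg g s (lt (l ++ l0))) t.

Lemma emits_le g p s l0 t t' : t <= t' -> emits g p s l0 t -> emits g p s l0 t'.
Proof. by move=> le h l; apply: trans_le le (h l). Qed.

Lemma emits_seq g p q s l1 l2 t1 t2 :
  emits g p s l1 t1 -> emits g q s l2 t2 -> emits g (Seq p q) s (l1 ++ l2) (t1 + t2).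
Proof. by move=> h1 h2 l; rewrite catA; apply: trans_seq (h1 l) (h2 _). Qed.

Lemma emits_skip g s : emits g skip s [::] 1.
Proof. by move=> l; rewrite cats0; apply: trans_skip. Qed.

Lemma emits_wr g (f : readout -> msym) s x :
  (forall a, f (rd (putg g s a)) = x) -> emits g (wr g f Right) s [:: x] 1.
Proof.
move=> fx l; apply: trans_wr => // k; rewrite /putg; case: ifP => // _.
rewrite cats1 /lt size_rcons /=; congr (_, _); apply/funext=> i.
rewrite nth_rcons (_ : f _ = x); last exact: fx.
by case: ltngtP => // lt; rewrite ?nth_default // ltnW.
Qed.

Definition seqs (ps : seq prog) : prog := foldr (@Seq K mark) skip ps.

Lemma emits_seqs (A : eqType) g (ps : A -> prog) s (ls : A -> seq msym) t (r : seq A) :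
  (forall a, a \in r -> emits g (ps a) s (ls a) t) ->
  emits g (seqs (map ps r)) s (flatten (map ls r)) (size r * t + 1).
Proof.
elim: r => [|a r IH] h; first exact: emits_skip.
rewrite /= mulSn -addnA; apply: emits_seq; first by apply: h; rewrite inE eqxx.
by apply: IH => b br; apply: h; rewrite inE br orbT.
Qed.

Lemma emits_scan (g : pred K) k body s c v L (ls : nat -> seq msym) t : ~~ g k ->
  scannable c v -> v <= L -> s k = (0, c) ->
  (forall i, i < v -> emits g body (upd s k (i.+1, c)) (ls i) t) ->
  emits g (scan k body) s (flatten [seq ls i | i <- iota 0 v]) (L * (t + 4) + 6).
Proof.
move=> gk sc vL sk hb l.
pose F i := putg g s (lt (l ++ flatten [seq ls j | j <- iota 0 i])).
have -> : putg g s (lt l) = F 0 by rewrite /F /= cats0.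
apply: (trans_scan (F := F) sc vL) => i lt; rewrite /F; first by rewrite /putg (negPf gk).
have -> : flatten [seq ls j | j <- iota 0 i.+1] = flatten [seq ls j | j <- iota 0 i] ++ ls i.
  by rewrite -addn1 iotaD map_cat flatten_cat /= cats0.
by rewrite !upd_putg // catA; apply: hb.
Qed.

Lemma emits_scan_ord (g : pred K) k body s c v L (ls : 'I_v -> seq msym) t : ~~ g k ->
  scannable c v -> v <= L -> s k = (0, c) ->
  (forall i : 'I_v, emits g body (upd s k (i.+1, c)) (ls i) t) ->
  emits g (scan k body) s (flatten [seq ls i | i <- enum 'I_v]) (L * (t + 4) + 6).
Proof.
move=> gk sc vL sk hb.
have -> : [seq ls i | i <- enum 'I_v] =
    [seq (if insub j is Some i then ls i else [::]) | j <- iota 0 v].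
  by rewrite -val_enum_ord -map_comp; apply: eq_map => i /=; rewrite valK.
apply: emits_scan sc vL sk _ => // i lt; rewrite insubT; exact: hb (Ordinal lt).
Qed.

Definition cnt0 : atape := (0, nth None [:: mStart]).

Lemma origin_start : origin (nth None [:: mStart]).
Proof. by case=> [|[]]. Qed.

Section Compare.
Variables (tmp k1 k2 : K).
Hypotheses (n12 : k1 != k2) (n1 : k1 != tmp) (n2 : k2 != tmp).

Definition cmp_move (back : bool) : K -> move := fun k =>
  if (k == k1) || (k == k2) then (if back then Left else Right)
  else if k == tmp then (if back then Right else Left) else Stay.

Definition cmp_restore : prog := While (fun r => ~~ at_start tmp r) (mvf (cmp_move false)).

(** Head positions are compared, not contents: both heads go back until one is at its origin, and
    [tmp] records the distance for the way forth. The outcome is held by the finite control, so the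
    continuation [f] is instantiated once per outcome. *)
Definition cmp (f : bool -> bool -> prog) : prog :=
  Seq (While (fun r => ~~ at_start k1 r && ~~ at_start k2 r) (mvf (cmp_move true)))
    (If (at_start k1)
       (If (at_start k2) (Seq cmp_restore (f true true)) (Seq cmp_restore (f true false)))
       (Seq cmp_restore (f false true))).

Lemma trans_cmp f s s' (p1 : nat) c1 (p2 : nat) c2 t L : origin c1 -> origin c2 ->
  s k1 = (p1, c1) -> s k2 = (p2, c2) -> s tmp = cnt0 -> p1 <= L ->
  trans (f (p1 <= p2) (p2 <= p1)) s s' t -> trans (cmp f) s s' (4 * L + 4 + t).
Proof.
move=> o1 o2 e1 e2 e0 pL tf.
pose F j : store := fun k => if k == k1 then (p1 - j, c1) else if k == k2 then (p2 - j, c2)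
  else if k == tmp then (j, nth None [:: mStart]) else s k.
have n21 : (k2 == k1) = false by apply/negbTE; rewrite eq_sym.
have t1 : (tmp == k1) = false by apply/negbTE; rewrite eq_sym.
have t2 : (tmp == k2) = false by apply/negbTE; rewrite eq_sym.
have F0 : F 0 = s.
  apply/funext=> k; rewrite /F !subn0; case: eqP => [->//|_]; case: eqP => [->//|_].
  by case: eqP => [->//|].
have Fk1 j : at_start k1 (rd (F j)) = (p1 <= j).
  by rewrite /at_start ffunE /F eqxx /= o1 subn_eq0.
have Fk2 j : at_start k2 (rd (F j)) = (p2 <= j).
  by rewrite /at_start ffunE /F n21 eqxx /= o2 subn_eq0.
have Ft j : at_start tmp (rd (F j)) = (j == 0).
  by rewrite /at_start ffunE /F t1 t2 eqxx /= origin_start.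
pose n := minn p1 p2.
have n1' : n <= p1 by rewrite geq_minl.
have n2' : n <= p2 by rewrite geq_minr.
have nlt j : j < n -> (j < p1) /\ (j < p2) by rewrite leq_min => /andP.
have restore q s2 t' : trans q s s2 t' -> trans (Seq cmp_restore q) (F n) s2 (n * 2 + 1 + t').
  move=> tq; apply: trans_seq tq; rewrite -F0.
  have := @trans_while (fun r => ~~ at_start tmp r) (mvf (cmp_move false)) (fun i => F (n - i)) n 1.
  rewrite subn0 subnn; apply=> [i lt|]; last by rewrite Ft.
  split; first by rewrite Ft subn_eq0 -ltnNge.
  apply: trans_mvf => k; rewrite /cmp_move /F.
    case: eqP => //= _; case: eqP => //= _; case: eqP => //= _ _.
    by rewrite subn_gt0.
  case: eqP => [_|_] /=; first by congr (_, _); move: lt n1' n2'; clear; lia.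
  case: eqP => [_|_] /=; first by congr (_, _); move: lt n1' n2'; clear; lia.
  case: eqP => [_|_] /=; first by congr (_, _); move: lt n1' n2'; clear; lia.
  by case: (s k).
apply: (@trans_le _ _ _ ((n * 2 + 1) + (n * 2 + 1 + t).+2)).
  by move: n1' pL; clear; lia.
apply: (@trans_seq _ _ _ (F n)).
  rewrite -F0; apply: trans_while => [i lt|]; last first.
    by rewrite Fk1 Fk2 -negb_or negbK /n; clear; lia.
  have [l1 l2] := nlt i lt.
  split; first by rewrite Fk1 Fk2 -!ltnNge l1.
  apply: trans_mvf => k; rewrite /cmp_move /F.
    case: eqP => [_|_] /=; first by rewrite subn_gt0.
    case: eqP => [_|_] /=; first by rewrite subn_gt0.
    by case: eqP.
  case: eqP => [_|_] /=; first by rewrite subnS.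
  case: eqP => [_|_] /=; first by rewrite subnS.
  by case: eqP => [_|_] //=; case: (s k).
apply: trans_if; rewrite Fk1.
have -> : (p1 <= n) = (p1 <= p2) by rewrite /n leq_min leqnn.
case: ifP => le12.
  apply: trans_if; rewrite Fk2.
  have -> : (p2 <= n) = (p2 <= p1) by rewrite /n leq_min leqnn andbT.
  by case: ifP => le21; apply: restore; rewrite le12 le21 in tf.
apply: trans_le (leqnSn _) _; apply: restore.
have le21 : p2 <= p1 by rewrite ltnW // ltnNge le12.
by rewrite le12 le21 in tf.
Qed.

Definition if_eq (f : bool -> prog) : prog := cmp (fun a b => f (a && b)).

Definition if_succ (f : bool -> prog) : prog :=
  Seq (mv (pred1 k1) Right) (cmp (fun a b => Seq (mv (pred1 k1) Left) (f (a && b)))).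

Variable g : pred K.
Hypotheses (g1 : ~~ g k1) (g2 : ~~ g k2) (g0 : ~~ g tmp).

Lemma emits_cmp f s (p1 : nat) c1 (p2 : nat) c2 l0 t L : origin c1 -> origin c2 ->
  s k1 = (p1, c1) -> s k2 = (p2, c2) -> s tmp = cnt0 -> p1 <= L ->
  emits g (f (p1 <= p2) (p2 <= p1)) s l0 t -> emits g (cmp f) s l0 (4 * L + 4 + t).
Proof.
move=> o1 o2 e1 e2 e0 pL h l.
by apply: (trans_cmp o1 o2) (h l); rewrite /putg ?(negPf g1) ?(negPf g2) ?(negPf g0).
Qed.

Lemma emits_eq f s (p1 : nat) c1 (p2 : nat) c2 l0 t L : origin c1 -> origin c2 ->
  s k1 = (p1, c1) -> s k2 = (p2, c2) -> s tmp = cnt0 -> p1 <= L ->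
  emits g (f (p1 == p2)) s l0 t -> emits g (if_eq f) s l0 (4 * L + 10 + t).
Proof.
move=> o1 o2 e1 e2 e0 pL h; apply: (@emits_le _ _ _ _ (4 * L + 4 + t)).
  by rewrite leq_add2r leq_add2l.
by apply: emits_cmp o1 o2 e1 e2 e0 pL _; rewrite -eqn_leq.
Qed.

Lemma emits_succ f s (p1 : nat) c1 (p2 : nat) c2 l0 t L : origin c1 -> origin c2 ->
  s k1 = (p1, c1) -> s k2 = (p2, c2) -> s tmp = cnt0 -> p1 <= L ->
  emits g (f (p1.+1 == p2)) s l0 t -> emits g (if_succ f) s l0 (4 * L + 10 + t).
Proof.
move=> o1 o2 e1 e2 e0 pL h l.
have -> : 4 * L + 10 + t = 1 + (4 * L.+1 + 4 + (1 + t)) by rewrite mulnS; clear; lia.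
have n21 : (k2 == k1) = false by apply/negbTE; rewrite eq_sym.
have t1 : (tmp == k1) = false by apply/negbTE; rewrite eq_sym.
have eS : s = upd s k1 (p1, c1) by rewrite -e1 upd_id.
apply: (@trans_seq _ _ _ (putg g (upd s k1 (p1.+1, c1)) (lt l))).
  by rewrite {1}eS -!upd_putg //; apply: trans_right.
apply: (trans_cmp (p1 := p1.+1) (c1 := c1) (p2 := p2) (c2 := c2)) => //.
- by rewrite /putg (negPf g1) /upd eqxx.
- by rewrite /putg (negPf g2) /upd n21.
- by rewrite /putg (negPf g0) /upd t1.
apply: (@trans_seq _ _ _ (putg g s (lt l))).
  by rewrite {2}eS -!upd_putg //; apply: trans_left.
by rewrite -eqn_leq; apply: h.
Qed.

End Compare.

End Calculus.

(** * Enumeration order and closure of polynomial bounds *)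

Lemma flatten_enum_prod (A B : finType) (T : Type) (ls : A * B -> seq T) :
  flatten [seq flatten [seq ls (a, b) | b <- enum B] | a <- enum A] =
  flatten [seq ls p | p <- enum {: A * B}].
Proof.
rewrite [enum {: A * B}]enumT unlock /= /prod_enum.
elim: (enum A) => //= a r IH.
by rewrite map_cat flatten_cat IH -map_comp.
Qed.

Lemma flatten_enum_sum (A B : finType) (T : Type) (ls : A + B -> seq T) :
  flatten [seq ls (inl a) | a <- enum A] ++ flatten [seq ls (inr b) | b <- enum B] =
  flatten [seq ls p | p <- enum {: A + B}].
Proof.
rewrite [enum {: A + B}]enumT unlock /= /sum_enum map_cat flatten_cat.
by rewrite -!map_comp.
Qed.

Lemma poly_bounded_le (f g : nat -> nat) : (forall n, f n <= g n) ->
  poly_bounded g -> poly_bounded f.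
Proof. by move=> h [c hc]; exists c => n; apply: leq_trans (h n) (hc n). Qed.

Lemma poly_bounded_id : poly_bounded id.
Proof. by exists 1 => n; rewrite expn1 leq_addr. Qed.

Lemma poly_bounded_const a : poly_bounded (fun=> a).
Proof. by exists a => n; rewrite leq_addl. Qed.

(** For [n >= 2] the additive constant of each bound is absorbed by one more power of [n]; [n = 0]
    and [n = 1] are covered by the constant [(a + 1) * (b + 1)]. *)
Lemma poly_boundedM f g : poly_bounded f -> poly_bounded g ->
  poly_bounded (fun n => f n * g n).
Proof.
move=> [a ha] [b hb]; exists (a + b + 2 + (a + 1) * (b + 1)) => n.
apply: leq_trans (leq_mul (ha n) (hb n)) _.
case: n => [|[|n]].
- apply: leq_trans (leq_addl _ _); apply: leq_trans (leq_addl (a + b + 2) _).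
  have e x : 0 ^ x <= 1 by case: x => // x; rewrite exp0n.
  by apply: leq_mul; rewrite addnC leq_add2l.
- apply: leq_trans (leq_addl _ _); apply: leq_trans (leq_addl (a + b + 2) _).
  by rewrite !exp1n ![1 + _]addnC.
have bound c : n.+2 ^ c + c <= n.+2 ^ c.+1.
  have : c <= n.+2 ^ c by apply: ltnW; apply: ltn_expl.
  rewrite expnS !mulSn; move: (n.+2 ^ c) => x; clear; nia.
apply: leq_trans (leq_addr _ _); apply: leq_trans (leq_mul (bound a) (bound b)) _.
by rewrite -expnD leq_exp2l //; clear; nia.
Qed.

Lemma poly_boundedD f g : poly_bounded f -> poly_bounded g ->
  poly_bounded (fun n => f n + g n).
Proof.
move=> hf hg; apply: (@poly_bounded_le _ (fun n => (f n + 1) * (g n + 1))).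
  by move=> n; clear; nia.
have S h : poly_bounded h -> poly_bounded (fun n => h n + 1).
  move=> [c hc]; exists c.+2 => n; have := hc n; case: n => [|n].
    by case: c {hc} => [|c]; rewrite ?expn0 ?exp0n //; clear; lia.
  by have := @leq_pexp2l n.+1 c c.+2 isT (leqW (leqnSn c)); clear; lia.
by apply: poly_boundedM; apply: S.
Qed.

Lemma poly_boundedX f c : poly_bounded f -> poly_bounded (fun n => f n ^ c).
Proof.
move=> hf; elim: c => [|c IH]; first exact: poly_bounded_const.
by apply: (@poly_bounded_le _ (fun n => f n * f n ^ c)) (poly_boundedM hf IH) => n; rewrite expnS.
Qed.

(** * The reduction program *)

Definition repl (T : Type) (n : nat) (l : seq T) : seq T := flatten (nseq n l).

Lemma replD T m n (l : seq T) : repl (m + n) l = repl m l ++ repl n l.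
Proof. by rewrite /repl nseqD flatten_cat. Qed.

Lemma replM T m n (l : seq T) : repl (m * n) l = repl m (repl n l).
Proof. by elim: m => //= m IH; rewrite mulSn replD IH. Qed.

Lemma repl1 T (x : T) n : repl n [:: x] = nseq n x.
Proof. by elim: n => //= n IH; rewrite -[in RHS]IH. Qed.

Lemma flatten_const (A T : Type) (l : seq T) (r : seq A) :
  flatten [seq l | _ <- r] = repl (size r) l.
Proof. by elim: r => //= a r ->. Qed.

Lemma nth_rcons_fun (T : Type) (x0 x : T) l :
  (fun i => if i == size l then x else nth x0 l i) = nth x0 (rcons l x).
Proof.
apply/funext=> i; rewrite nth_rcons; case: ltngtP => // lt_i.
by rewrite nth_default // ltnW.
Qed.

Section Nest.
Variable K : finType.
Local Notation store := (store K mark).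
Implicit Types (s : store) (g : pred K).

Definition W g (x : msym) := wr g (fun=> x) Right.

Lemma emits_W g x s : emits g (W g x) s [:: x] 1.
Proof. exact: emits_wr. Qed.

Lemma emits_repeat g body l t s n : emits g body s l t ->
  emits g (seqs (nseq n body)) s (repl n l) (n * t + 1).
Proof.
move=> h; elim: n => [|n IH]; first exact: emits_skip.
by rewrite mulSn -addnA; apply: (emits_seq h IH).
Qed.

Definition nest (ks : seq K) body := foldr (@scan K) body ks.

Definition ts L t := L * (t + 4) + 6.

Lemma emits_scan_const g k body s c v L l t : ~~ g k -> scannable c v -> v <= L ->
  s k = (0, c) -> (forall s', (forall k', k' != k -> s' k' = s k') -> emits g body s' l t) ->
  emits g (scan k body) s (repl v l) (ts L t).
Proof.
move=> gk sc vL sk h.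
have := @emits_scan K g k body s c v L (fun=> l) t gk sc vL sk.
rewrite flatten_const size_iota; apply=> i _; apply: h => k' ne.
by rewrite /upd (negPf ne).
Qed.

Lemma emits_nest g ks body l t c v L : uniq ks -> (forall k, k \in ks -> ~~ g k) ->
  scannable c v -> v <= L -> (forall s, emits g body s l t) ->
  forall s, (forall k, k \in ks -> s k = (0, c)) ->
  emits g (nest ks body) s (repl (v ^ size ks) l) (iter (size ks) (ts L) t).
Proof.
move=> + + sc vL h; elim: ks => [|k ks IH] /= => [_ _ s _|/andP[kks uks] gks s sks].
  by rewrite /repl /= cats0.
rewrite expnS replM; apply: emits_scan_const sc vL _ _.
- by apply: gks; rewrite inE eqxx.
- by apply: sks; rewrite inE eqxx.
move=> s' es; apply: IH => // [k' k'ks|k' k'ks]; first by apply: gks; rewrite inE k'ks orbT.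
rewrite es; first by apply: sks; rewrite inE k'ks orbT.
by apply: contraNneq kks => <-.
Qed.

End Nest.

Definition plain (l : seq msym) := all (fun x => (x != mStart) && (x != mEnd)) l.

Definition taped (l : seq msym) : nat -> msym := nth None (mStart :: l ++ [:: mEnd]).

Lemma scannable_taped l : plain l -> scannable (taped l) (size l).
Proof.
move=> pl; have nl i : i < size l -> (nth None l i != mStart) && (nth None l i != mEnd).
  by move=> lt; apply: (allP pl); apply: mem_nth.
split; last split.
- case=> [|i] //=; rewrite /taped /= nth_cat; case: ltnP => [/nl/andP[/negPf-> _]//|le].
  by case: (i - size l) => [|[]].
- by move=> i lt; rewrite /taped /= nth_cat lt; case/andP: (nl i lt).
- by rewrite /taped /= nth_cat ltnn subnn.
Qed.

Lemma origin_nones n : origin (nth None (mStart :: nseq n None)).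
Proof. by case=> [|i] //=; rewrite nth_nseq; case: ifP. Qed.

Lemma plain_nones n : plain (nseq n None).
Proof. by apply/allP=> x /nseqP[->]. Qed.

(** The recursion behind repeated halving. It stops at quotient 0 because [binary 0] is not empty
    but a single digit. *)
Lemma binaryE m : 0 < m ->
  binary m = odd m :: (if m %/ 2 is 0 then [::] else binary (m %/ 2)).
Proof.
move=> m0; rewrite /binary /mkseq; have [lt|ge] := ltnP m 2.
  by have -> : m = 1 by move: m0 lt; clear; lia.
have d0 : 0 < m %/ 2 by rewrite divn_gt0.
have -> : trunc_log 2 m = (trunc_log 2 (m %/ 2)).+1.
  by rewrite trunc_log2S // divn2.
have -> : (match m %/ 2 with 0 => [::] | _ => [seq odd (m %/ 2 %/ 2 ^ i) | i <- iota 0 (trunc_log 2 (m %/ 2)).+1] end)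
   = [seq odd (m %/ 2 %/ 2 ^ i) | i <- iota 0 (trunc_log 2 (m %/ 2)).+1] by case: (m %/ 2) d0.
have iotaS k : iota 0 k.+1 = 0 :: [seq i.+1 | i <- iota 0 k] by rewrite -(iotaDl 1 0 k).
rewrite iotaS map_cons expn0 divn1 -map_comp; congr (_ :: _); apply: eq_map => i /=.
by rewrite expnS divnMA.
Qed.

Section Reduction.
Variables (M : machine) (c c' : nat).
Let q := #|cellval M|.

(** [rB] bounds the certificate, [rS] the input of the verifier and [rA] its running time. The
    summand [q] of [rT] ensures [q <= k], which the clique graph requires. *)
Definition rB n := n ^ c + c.
Definition rS n := n.*2 + 2 + rB n.
Definition rT n := rS n ^ c' + c' + rS n + q.
Definition rA n := (rT n).+1.
Definition rwidth n := rA n + (n.*2 + 2) + rB n + rT n.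
Definition rk n := (rA n).+1 * rwidth n.
Definition ra n := rk n * rk n.
Definition rb n := rk n * q.-1.
Definition rd' n := (ra n + rb n).-1.
Definition rm n := rk n * q * (rk n * q) + rk n * q + rd' n.

Definition K : finType := ('I_c.+1 + 'I_c'.+1 + 'I_18)%type.
Definition fx n (lt : n < 18) : K := inr (Ordinal lt).
Definition kin : K := @fx 0 isT.
Definition kout : K := @fx 1 isT.
Definition ktmp : K := @fx 2 isT.
Definition kM : K := @fx 3 isT.
Definition kt (b : bool) : K := if b then @fx 6 isT else @fx 4 isT.
Definition kt' (b : bool) : K := if b then @fx 7 isT else @fx 5 isT.
Definition kx (b : bool) : K := if b then @fx 10 isT else @fx 8 isT.
Definition kx' (b : bool) : K := if b then @fx 11 isT else @fx 9 isT.
Definition kp (b : bool) : K := if b then @fx 13 isT else @fx 12 isT.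
Definition kA : K := @fx 14 isT.
Definition kZ : K := @fx 15 isT.
Definition kAA : K := @fx 16 isT.
Definition kBB : K := @fx 17 isT.
(** The [c] nested loops that count to [n ^ c] need a copy of the input each; index [ord0] is kept
    for single loops. The copies [kS] do the same for powers of [rS n]. *)
Definition kN (i : 'I_c.+1) : K := inl (inl i).
Definition kS (i : 'I_c'.+1) : K := inl (inr i).
Definition pN : seq K := [seq kN (lift ord0 j) | j <- enum 'I_c].
Definition pS : seq K := [seq kS (lift ord0 j) | j <- enum 'I_c'].

(* The stage of the initialisation at which a tape gets its final contents. *)
Definition lev (k : K) : nat :=
  match k with
  | inl (inl _) => 1
  | inl (inr _) => 2
  | inr i => nth 0 [:: 0; 0; 10; 9; 3; 3; 3; 3; 4; 4; 4; 4; 8; 8; 5; 0; 6; 7] i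
  end.

Definition grp (j : nat) : pred K := fun k => lev k == j.

(** * Preparation of the unary counters *)

Section Word.
Variable w : seq bool.
Let n := size w.
Let wcells : seq msym := cells_x w (rA n) (rB n) (rT n).

(** A loop at index [i] has its head in cell [i + 1]. Heads in the cells 1 and [rA n + 1] thus mark
    the indices 0 and [A], whereas heads in the cells [ra n] and [rb n] mark the indices with
    [i + 1 = a] and [i + 1 = b], as tested by [half_skip]. *)
Definition stage (j : nat) : atape mark :=
  nth (lt [:: mStart])
    [:: lt [:: mStart]; (0, taped (bits mark w)); (0, taped (nseq (rS n) None));
        (0, taped (nseq (rA n).+1 None)); (0, taped wcells);
        lt (mStart :: nseq (rA n) None);
        (ra n, nth None (mStart :: nseq (ra n) None));
        (rb n, nth None (mStart :: nseq (rb n) None));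
        (0, taped (nseq (rd' n) None));
        (rm n, nth None (mStart :: nseq (rm n) None));
        (0, nth None [:: mStart])] j.

Definition mid (j : nat) : store K mark := fun k =>
  if k == kin then (n, nth None (bits mark w))
  else if lev k <= j then stage (lev k) else lt [:: mStart].

Lemma mid_put j : 0 < j -> putg (grp j) (mid j.-1) (stage j) = mid j.
Proof.
move=> j0; have nkin k : lev k == j -> (k == kin) = false.
  by move=> e; apply/eqP=> ek; move: e; rewrite ek /= eq_sym; case: j j0.
apply/funext=> k; rewrite /putg /grp /mid; case: (eqVneq (lev k) j) => [e|ne].
  by rewrite nkin ?e ?eqxx // leqnn.
case: ifP => // _; have -> // : (lev k <= j.-1) = (lev k <= j).
by rewrite -ltnS prednK // [in RHS]leq_eqVlt (negPf ne).
Qed.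

Lemma mid_phase j p t : 0 < j ->
  trans p (putg (grp j) (mid j.-1) (lt [:: mStart])) (putg (grp j) (mid j.-1) (stage j)) t ->
  trans p (mid j.-1) (mid j) t.
Proof.
move=> j0; have nkin k : lev k == j -> (k == kin) = false.
  by move=> e; apply/eqP=> ek; move: e; rewrite ek /= eq_sym; case: j j0.
have -> : putg (grp j) (mid j.-1) (lt [:: mStart]) = mid j.-1.
  apply/funext=> k; rewrite /putg /grp; case: ifP => // e; rewrite /mid (nkin _ e).
  by rewrite (eqP e) -ltnS prednK // ltnn.
by rewrite mid_put.
Qed.

Definition build (j : nat) (k : K) (body : prog K mark) :=
  Seq body (Seq (W (grp j) mEnd) (rewind k (grp j))).

Lemma trans_finish j k l : 0 < j -> grp j k -> plain l -> stage j = (0, taped l) ->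
  trans (Seq (W (grp j) mEnd) (rewind k (grp j)))
    (putg (grp j) (mid j.-1) (lt (mStart :: l))) (mid j) (1 + ((size l).+2 * 2 + 1)).
Proof.
move=> j0 gk pl sj; rewrite -(mid_put j0) sj; apply: trans_seq (emits_W _ _ _ _) _.
have -> : lt ((mStart :: l) ++ [:: mEnd]) = ((size l).+2, taped l).
  by rewrite /lt /taped /= size_cat /= addn1.
by apply: trans_rewind => //; case: (scannable_taped pl).
Qed.

Lemma trans_build j k body l t L : 0 < j -> grp j k -> plain l ->
  stage j = (0, taped l) -> size l <= L -> emits (grp j) body (mid j.-1) l t ->
  trans (build j k body) (mid j.-1) (mid j) (t + (L * 2 + 6)).
Proof.
move=> j0 gk pl sj lL eb.
apply: (@trans_le _ _ _ _ (t + (1 + ((size l).+2 * 2 + 1)))); first by move: lL; clear; lia.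
apply: mid_phase => //; rewrite (mid_put j0).
by apply: trans_seq (eb [:: mStart]) _; apply: trans_finish.
Qed.

Lemma trans_counter j body l t : 0 < j -> plain l ->
  stage j = (size l, nth None (mStart :: l)) -> emits (grp j) body (mid j.-1) l t ->
  trans (Seq body (mv (grp j) Left)) (mid j.-1) (mid j) (t + 1).
Proof.
move=> j0 pl sj eb; apply: mid_phase => //; rewrite sj.
apply: trans_seq (eb [:: mStart]) _; apply: trans_mvf => k; rewrite /putg; case: ifP => //= _.
by case: (mid _ k).
Qed.

Definition rL := n + rS n + (rA n).+1 + rwidth n + ra n + rb n + rm n + 4.

Lemma mid_at j k : k != kin -> lev k <= j -> mid j k = stage (lev k).
Proof. by move=> /negPf nk le; rewrite /mid nk le. Qed.

Lemma plain_bits (l : seq bool) : plain (bits mark l).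
Proof. by apply/allP=> x /mapP[b _ ->]. Qed.

Lemma scan_t : scannable (taped (nseq (rA n).+1 None)) (rA n).+1.
Proof. by have := scannable_taped (plain_nones (rA n).+1); rewrite size_nseq. Qed.

Lemma plain_wcells : plain wcells.
Proof.
rewrite /plain !all_cat; apply/and4P; split; try by apply/allP=> y /nseqP[->].
exact: plain_bits.
Qed.

Lemma scan_x : scannable (taped wcells) (rwidth n).
Proof. by have := scannable_taped plain_wcells; rewrite size_cells_x. Qed.

Lemma scan_p : scannable (taped (nseq (rd' n) None)) (rd' n).
Proof. by have := scannable_taped (plain_nones (rd' n)); rewrite size_nseq. Qed.

Section Loops.
Variables (g : pred K) (j : nat) (x : msym).
Hypothesis gj : forall k, g k -> j < lev k.
Let ng k : lev k <= j -> ~~ g k.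
Proof. by move=> le; apply/negP=> /gj; rewrite ltnNge le. Qed.

(** Powers become nested scans, while the additive constants, fixed with the verifier, are
    unrolled. *)
Definition Bloop body := Seq (nest pN body) (seqs (nseq c body)).
Definition Sloop body :=
  Seq (scan (kN ord0) (Seq body body)) (Seq (Seq body body) (Bloop body)).
Definition Tloop body :=
  Seq (nest pS body) (Seq (seqs (nseq c' body)) (Seq (scan (kS ord0) body) (seqs (nseq q body)))).

Definition tB L := iter c (ts L) 1 + (c * 1 + 1).
Definition tS L := ts L (1 + 1) + ((1 + 1) + tB L).
Definition tT L := iter c' (ts L) 1 + ((c' * 1 + 1) + (ts L 1 + (q * 1 + 1))).

Lemma uniq_pN : uniq pN.
Proof.
rewrite map_inj_uniq ?enum_uniq // => i i'.
by move/(congr1 (fun k : K => if k is inl (inl x) then x else ord0))/lift_inj.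
Qed.
Lemma uniq_pS : uniq pS.
Proof.
rewrite map_inj_uniq ?enum_uniq // => i i'.
by move/(congr1 (fun k : K => if k is inl (inr x) then x else ord0))/lift_inj.
Qed.

Lemma emits_Bloop y : 1 <= j -> emits g (Bloop (W g y)) (mid j) (nseq (rB n) y) (tB rL).
Proof.
move=> j1; rewrite -repl1 replD; apply: emits_seq; last by apply: emits_repeat; apply: emits_W.
have -> : c = size pN by rewrite size_map size_enum_ord.
have -> : n = size (bits mark w) by rewrite size_map.
have sc := scannable_taped (plain_bits w).
apply: emits_nest sc _ _ _ _; rewrite ?uniq_pN //.
- by move=> k /mapP[i _ ->]; apply: ng.
- by rewrite size_map /rL; clear; lia.
- by move=> s; apply: emits_W.
- by move=> k /mapP[i _ ->]; rewrite mid_at.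
Qed.

Lemma emits_Sloop : 1 <= j -> emits g (Sloop (W g None)) (mid j) (nseq (rS n) None) (tS rL).
Proof.
move=> j1; have -> : rS n = n.*2 + (2 + rB n) by rewrite /rS addnA.
rewrite nseqD [nseq (2 + _) _]nseqD; apply: emits_seq.
  have scN : scannable (taped (bits mark w)) n.
    by have := scannable_taped (plain_bits w); rewrite size_map.
  have -> : nseq n.*2 (None : msym) = repl n [:: None; None].
    by rewrite /repl; elim: n => //= m ->.
  apply: emits_scan_const scN _ _ _; rewrite ?mid_at //; first exact: ng.
    by rewrite /rL; clear; lia.
  by move=> s' _; apply: (emits_seq (l1 := [:: None])); apply: emits_W.
apply: emits_seq; last exact: emits_Bloop.
by apply: (emits_seq (l1 := [:: None])); apply: emits_W.
Qed.

Lemma emits_Tloop : 2 <= j -> emits g (Tloop (W g None)) (mid j) (nseq (rT n) None) (tT rL).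
Proof.
move=> j2; rewrite -repl1.
have -> : rT n = rS n ^ c' + (c' + (rS n + q)) by rewrite /rT !addnA.
rewrite 3!replD.
have sc : scannable (taped (nseq (rS n) None)) (rS n).
  by have := scannable_taped (plain_nones (rS n)); rewrite size_nseq.
have le : rS n <= rL by rewrite /rL; clear; lia.
apply: emits_seq.
  have {1 2}-> : c' = size pS by rewrite size_map size_enum_ord.
  apply: emits_nest sc le _ _ _; rewrite ?uniq_pS //.
  - by move=> k /mapP[i _ ->]; apply: ng.
  - by move=> s; apply: emits_W.
  - by move=> k /mapP[i _ ->]; rewrite mid_at.
apply: emits_seq; first by apply: emits_repeat; apply: emits_W.
apply: emits_seq; last by apply: emits_repeat; apply: emits_W.
apply: emits_scan_const sc le _ _; rewrite ?mid_at //; first exact: ng.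
by move=> s' _; apply: emits_W.
Qed.

Definition cloop (kt0 kx0 : K) body := scan kt0 (scan kx0 body).

Lemma emits_cloop kt0 kx0 body l t s : lev kt0 = 3 -> lev kx0 = 4 -> 4 <= j ->
  s kt0 = stage 3 -> s kx0 = stage 4 ->
  (forall s', (forall k, k != kt0 -> k != kx0 -> s' k = s k) -> emits g body s' l t) ->
  emits g (cloop kt0 kx0 body) s (repl (rk n) l) (ts rL (ts rL t)).
Proof.
move=> l3 l4 j4 st sx h; rewrite /rk replM.
have ne : kx0 != kt0 by apply/eqP=> e; move: l4; rewrite e l3.
apply: emits_scan_const scan_t _ st _.
- by apply: ng; rewrite l3; apply: leq_trans j4.
- by rewrite /rL; clear; lia.
move=> s1 e1; apply: emits_scan_const scan_x _ _ _.
- by apply: ng; rewrite l4.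
- by rewrite /rL; clear; lia.
- by rewrite e1.
by move=> s2 e2; apply: h => k n1 n2; rewrite e2 // e1.
Qed.

End Loops.


Lemma grp_gt j k : 0 < j -> grp j k -> j.-1 < lev k.
Proof. by move=> j0 /eqP->; rewrite ltn_predL. Qed.

(** The input tape has no [mStart] to rewind to; it is read once and copied to tapes that have
    one. *)
Definition prog1 : prog K mark :=
  Seq (wr (fun k => k != kin) (fun=> mStart) Right)
    (Seq (While (fun r => r kin != None)
            (Act (fun r k => if grp 1 k then (r kin, Right)
                             else if k == kin then (r k, Right) else (r k, Stay))))
       (Seq (W (grp 1) mEnd) (rewind (kN ord0) (grp 1)))).

Definition t1 L := 1 + ((L * 2 + 1) + (1 + ((L + 2) * 2 + 1))).

Lemma trans_prog1 : trans prog1 (start_store mark kin w) (mid 1) (t1 rL).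
Proof.
have nL : n <= rL by rewrite /rL; clear; lia.
apply: (@trans_le _ _ _ _ (1 + ((n * 2 + 1) + (1 + ((size (bits mark w)).+2 * 2 + 1))))).
  have -> : size (bits mark w) = n by rewrite size_map.
  by move: nL; rewrite /t1; clear; lia.
pose F i : store K mark := fun k => if k == kin then (i, nth None (bits mark w))
  else if grp 1 k then lt (mStart :: bits mark (take i w)) else lt [:: mStart].
apply: (@trans_seq _ _ _ _ (F 0)).
  apply: trans_wr => // k; rewrite /F /start_store take0; case: eqP => //= _.
  have -> : (fun i : nat => if i == 0 then mStart else nth None [::] i) = nth None [:: mStart].
    by apply/funext=> -[|i] //=; rewrite !nth_nil.
  by case: ifP.
apply: (@trans_seq _ _ _ _ (F n)).
  apply: trans_while => [i lt_in|]; last first.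
    by rewrite ffunE /F eqxx /= nth_default // size_map.
  have rk0 : rd (F i) kin = Some (inl (nth false w i)).
    by rewrite ffunE /F eqxx /= (nth_map false).
  split; first by rewrite rk0.
  exists 1 => //; set f := fun _ => _.
  have -> : F i.+1 = doA (f (rd (F i))) (F i); last first.
    by apply: exec_act => k; rewrite /f; case: ifP => //; case: ifP.
  apply/funext=> k; rewrite /doA /f rk0 [in LHS]/F.
  case: (eqVneq k kin) => [->|nk].
    rewrite /grp /= /do1 ffunE /F eqxx /=; congr (_, _).
    by apply/funext=> j; case: eqP => // ->.
  case: ifP => g1; last first.
    have -> : rd (F i) k = (F i k).2 (F i k).1 by rewrite ffunE.
    by rewrite do1_same /F (negPf nk) g1.
  rewrite /do1 /F (negPf nk) g1 /lt (take_nth false) // /bits map_rcons -rcons_cons.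
  by rewrite size_rcons; congr (_, _); symmetry; apply: nth_rcons_fun.
have -> : F n = putg (grp 1) (mid 0) (lt (mStart :: bits mark w)).
  apply/funext=> k; rewrite /F /putg /mid take_size; case: (eqVneq k kin) => [->//|nk].
  by case: ifP => // _; case: leqP => //; rewrite leqn0 => /eqP->.
apply: trans_finish => //; exact: plain_bits.
Qed.

Local Notation Wn j := (W (grp j) None).

Definition prog2 := build 2 (kS ord0) (Sloop (Wn 2)).
Lemma trans_prog2 : trans prog2 (mid 1) (mid 2) (tS rL + (rL * 2 + 6)).
Proof.
apply: (@trans_build 2 _ _ (nseq (rS n) None)) => //; first exact: plain_nones.
  by rewrite size_nseq /rL; clear; lia.
by apply: (@emits_Sloop (grp 2) 1) => // k; apply: (@grp_gt 2).
Qed.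

Definition prog3 := build 3 (kt false) (Seq (Tloop (Wn 3)) (Seq (Wn 3) (Wn 3))).
Lemma trans_prog3 : trans prog3 (mid 2) (mid 3) (tT rL + (1 + 1) + (rL * 2 + 6)).
Proof.
apply: (@trans_build 3 _ _ (nseq (rA n).+1 None)) => //; first exact: plain_nones.
  by rewrite size_nseq /rL; clear; lia.
have -> : (rA n).+1 = rT n + 2 by rewrite addn2.
rewrite nseqD; apply: emits_seq.
  by apply: (@emits_Tloop (grp 3) 2) => // k; apply: (@grp_gt 3).
by apply: (emits_seq (l1 := [:: None])); apply: emits_W.
Qed.

Definition Wcopy := wr (grp 4) (fun r => r (kN ord0)) Right.
Definition prog4 := build 4 (kx false)
  (Seq (Seq (Tloop (Wn 4)) (Wn 4))
     (Seq (Seq (scan (kN ord0) (Seq Wcopy Wcopy))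
             (Seq (W (grp 4) (Some (inl true))) (W (grp 4) (Some (inl false)))))
        (Seq (Bloop (W (grp 4) mGuess)) (Tloop (Wn 4))))).
Definition t4 L := (tT L + 1) + ((ts L (1 + 1) + (1 + 1)) + (tB L + tT L)) + (L * 2 + 6).
Lemma trans_prog4 : trans prog4 (mid 3) (mid 4) (t4 rL).
Proof.
have g4 k : grp 4 k -> 3 < lev k by apply: (@grp_gt 4).
apply: (@trans_build 4 _ _ wcells) => //; first exact: plain_wcells.
  by rewrite size_cells_x /rL /rwidth /width -/n; clear; lia.
rewrite /wcells /cells_x.
apply: emits_seq.
  have -> : rA n = rT n + 1 by rewrite addn1.
  rewrite nseqD; apply: emits_seq; last exact: emits_W.
  exact: (@emits_Tloop (grp 4) 3).
apply: emits_seq; last first.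
  by apply: emits_seq; [apply: (@emits_Bloop (grp 4) 3)|apply: (@emits_Tloop (grp 4) 3)].
rewrite /code_prefix map_cat; apply: emits_seq; last first.
  by apply: (emits_seq (l1 := [:: Some (inl true)])); apply: emits_W.
have scN : scannable (taped (bits mark w)) n.
  by have := scannable_taped (plain_bits w); rewrite size_map.
pose ls i : seq msym := [:: Some (inl (nth false w i)); Some (inl (nth false w i))].
have -> : [seq Some (inl b) | b <- flatten [seq [:: b; b] | b <- w]] =
    flatten [seq ls i | i <- iota 0 n].
  rewrite map_flatten -map_comp -{1}(mkseq_nth false w) /mkseq -map_comp.
  by congr flatten; apply: eq_map.
apply: (emits_scan (c := taped (bits mark w))) => //; first by rewrite /rL; clear; lia.
move=> i lti.
have rdN : taped (bits mark w) i.+1 = Some (inl (nth false w i)).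
  by rewrite /taped /= nth_cat size_map lti (nth_map false).
apply: (emits_seq (l1 := [:: Some (inl (nth false w i))])).
  by apply: emits_wr => a; rewrite ffunE; apply: rdN.
by apply: emits_wr => a; rewrite ffunE; apply: rdN.
Qed.

Definition prog5 := Seq (Tloop (Wn 5)) (Wn 5).
Lemma trans_prog5 : trans prog5 (mid 4) (mid 5) (tT rL + 1).
Proof.
apply: (@mid_phase 5) => //; suff h : emits (grp 5) prog5 (mid 4) (nseq (rA n) None) (tT rL + 1) by apply: h.
have -> : rA n = rT n + 1 by rewrite addn1.
rewrite nseqD; apply: emits_seq; last exact: emits_W.
by apply: (@emits_Tloop (grp 5) 4) => // k; apply: (@grp_gt 5).
Qed.

Definition aloop body := cloop (kt false) (kx false) (cloop (kt' false) (kx' false) body).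
Definition tcl L t := ts L (ts L t).
Lemma emits_aloop j body l t : 4 < j -> (forall s, emits (grp j) body s l t) ->
  emits (grp j) (aloop body) (mid j.-1) (repl (ra n) l) (tcl rL (tcl rL t)).
Proof.
move=> j4 h; have j4' : 4 <= j.-1 by rewrite -ltnS prednK // ltnW // ltnW // ltnW // ltnW.
have j3' : 3 <= j.-1 by apply: ltnW.
have gj k : grp j k -> j.-1 < lev k by apply: grp_gt; apply: leq_trans j4.
rewrite /ra replM; apply: (emits_cloop gj) => //; rewrite ?mid_at // => s1 e1.
apply: (emits_cloop gj) => //; first by rewrite e1 ?mid_at.
  by rewrite e1 ?mid_at.
Qed.

Definition bloop j := cloop (kt false) (kx false) (seqs (nseq q.-1 (Wn j))).
Lemma emits_bloop j : 4 < j ->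
  emits (grp j) (bloop j) (mid j.-1) (nseq (rb n) None) (tcl rL (q.-1 * 1 + 1)).
Proof.
move=> j4; have j4' : 4 <= j.-1 by rewrite -ltnS prednK // ltnW // ltnW // ltnW // ltnW.
have j3' : 3 <= j.-1 by apply: ltnW.
have gj k : grp j k -> j.-1 < lev k by apply: grp_gt; apply: leq_trans j4.
rewrite -repl1 /rb replM; apply: (emits_cloop gj) => //; rewrite ?mid_at // => s1 _.
by apply: emits_repeat; apply: emits_W.
Qed.

Definition prog6 := Seq (aloop (Wn 6)) (mv (grp 6) Left).
Lemma trans_prog6 : trans prog6 (mid 5) (mid 6) (tcl rL (tcl rL 1) + 1).
Proof.
apply: (@trans_counter 6 _ (nseq (ra n) None)) => //; first exact: plain_nones.
  by rewrite size_nseq.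
by rewrite -repl1; apply: (@emits_aloop 6) => // s; apply: emits_W.
Qed.

Definition prog7 := Seq (bloop 7) (mv (grp 7) Left).
Lemma trans_prog7 : trans prog7 (mid 6) (mid 7) (tcl rL (q.-1 * 1 + 1) + 1).
Proof.
apply: (@trans_counter 7 _ (nseq (rb n) None)) => //; first exact: plain_nones.
  by rewrite size_nseq.
exact: (@emits_bloop 7).
Qed.

Definition prog8 := Seq (Seq (aloop (Wn 8)) (bloop 8)) (Seq (mv (grp 8) Left)
  (Seq (W (grp 8) mEnd) (rewind (kp false) (grp 8)))).
Definition t8 L := (tcl L (tcl L 1) + tcl L (q.-1 * 1 + 1)) + (1 + (L * 2 + 6)).

Lemma ra_gt0 : 0 < ra n.
Proof. by rewrite /ra /rk !muln_gt0 /rwidth; clear; lia. Qed.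

Lemma trans_prog8 : trans prog8 (mid 7) (mid 8) (t8 rL).
Proof.
apply: (@mid_phase 8) => //; rewrite (@mid_put 8) //.
apply: (@trans_seq _ _ _ _ (putg (grp 8) (mid 7) (lt (mStart :: nseq (ra n + rb n) None)))).
  suff h : emits (grp 8) (Seq (aloop (Wn 8)) (bloop 8)) (mid 7) (nseq (ra n + rb n) None)
      (tcl rL (tcl rL 1) + tcl rL (q.-1 * 1 + 1)) by apply: h.
  rewrite nseqD; apply: emits_seq; last exact: (@emits_bloop 8).
  by rewrite -repl1; apply: (@emits_aloop 8) => // s; apply: emits_W.
have ab : ra n + rb n = (rd' n).+1 by rewrite /rd' prednK // addn_gt0 ra_gt0.
(* One step to the left drops a blank, because [d = a + b - 1]. *)
apply: (@trans_seq _ _ _ _ (putg (grp 8) (mid 7) (lt (mStart :: nseq (rd' n) None)))).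
  apply: trans_mvf => k; rewrite /putg; case: ifP => // _; last by rewrite /=; case: (mid 7 k).
  rewrite ab /lt /= size_nseq; congr (_, _); apply/funext=> -[//|i].
  have z j m : nth (None : msym) (nseq m None) j = None by rewrite nth_nseq if_same.
  transitivity (None : msym); first by first [exact: (z i (rd' n)) | exact: (z i (rd' n).+1)].
  by symmetry; first [exact: (z i (rd' n).+1) | exact: (z i (rd' n))].
apply: trans_le (trans_finish (l := nseq (rd' n) None) _ _ _ _) => //; last exact: plain_nones.
have dle : rd' n <= rL by rewrite /rL; move: ab; clear; lia.
by rewrite size_nseq; move: dle; clear; lia.
Qed.

Definition prog9 := Seq (Seq (Seq
   (cloop (kt false) (kx false) (seqs (nseq q (cloop (kt' false) (kx' false) (seqs (nseq q (Wn 9)))))))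
   (cloop (kt false) (kx false) (seqs (nseq q (Wn 9)))))
   (scan (kp false) (Wn 9))) (mv (grp 9) Left).
Definition t9 L := (tcl L (q * tcl L (q * 1 + 1) + 1) + tcl L (q * 1 + 1)) + ts L 1 + 1.

Lemma trans_prog9 : trans prog9 (mid 8) (mid 9) (t9 rL).
Proof.
have gj k : grp 9 k -> 8 < lev k by apply: (@grp_gt 9).
apply: (@trans_counter 9 _ (nseq (rm n) None)) => //; first exact: plain_nones.
  by rewrite size_nseq.
rewrite -(repl1 (None : msym) (rm n)) /rm 2!replD; apply: emits_seq; last first.
  apply: emits_scan_const scan_p _ _ _; rewrite ?mid_at //.
    by rewrite /rL /rm; clear; lia.
  by move=> s _; apply: emits_W.
apply: emits_seq; last first.
  rewrite replM; apply: (emits_cloop gj) => //; rewrite ?mid_at // => s1 _.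
  by apply: emits_repeat; apply: emits_W.
rewrite replM replM; apply: (emits_cloop gj) => //; rewrite ?mid_at // => s1 e1.
apply: emits_repeat; rewrite replM; apply: (emits_cloop gj) => //; rewrite ?e1 ?mid_at //.
by move=> s2 _; apply: emits_repeat; apply: emits_W.
Qed.

Definition prog10 : prog K mark := Seq (@skip K) (mv (grp 10) Left).
Lemma trans_prog10 : trans prog10 (mid 9) (mid 10) (1 + 1).
Proof. by apply: (@trans_counter 10 _ [::]) => //; apply: emits_skip. Qed.

Definition prog_init := Seq prog1 (Seq prog2 (Seq prog3 (Seq prog4 (Seq prog5 (Seq prog6
  (Seq prog7 (Seq prog8 (Seq prog9 prog10)))))))).

Definition tinit L := t1 L + ((tS L + (L * 2 + 6)) + ((tT L + (1 + 1) + (L * 2 + 6)) + (t4 L + ((tT L + 1) +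
  ((tcl L (tcl L 1) + 1) + ((tcl L (q.-1 * 1 + 1) + 1) + (t8 L + (t9 L + (1 + 1))))))))).

Lemma trans_init : trans prog_init (start_store mark kin w) (mid 10) (tinit rL).
Proof.
apply: trans_seq trans_prog1 _; apply: trans_seq trans_prog2 _.
apply: trans_seq trans_prog3 _; apply: trans_seq trans_prog4 _.
apply: trans_seq trans_prog5 _; apply: trans_seq trans_prog6 _.
apply: trans_seq trans_prog7 _; apply: trans_seq trans_prog8 _.
apply: trans_seq trans_prog9 _; exact: trans_prog10.
Qed.


(** * Emission of the adjacency matrix *)

Definition gO : pred K := pred1 kout.
Definition at_t (i : nat) : atape mark := (i.+1, taped (nseq (rA n).+1 None)).
Definition at_x (i : nat) : atape mark := (i.+1, taped wcells).
Definition at_p (i : nat) : atape mark := (i.+1, taped (nseq (rd' n) None)).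

Definition rU : finType := (cell w (rA n) (rB n) (rT n) * cellval M)%type.
Definition rV : finType := cliqueT rU (rd' n).

(** The part of a vertex known to the finite control: cell values are unrolled in the program text,
    whereas times, columns and half graph indices are head positions. *)
Inductive desc := DE of cellval M & cellval M | DV of cellval M | DP | DQ.

Definition vdesc (a : rV) : desc :=
  match a with
  | inl (inl (u, u')) => DE u.2 u'.2
  | inl (inr u) => DV u.2
  | inr (inl _) => DP
  | inr (inr _) => DQ
  end.

Definition ust (s : store K mark) (kt0 kx0 : K) (u : rU) :=
  upd (upd s kt0 (at_t u.1.1)) kx0 (at_x u.1.2).

Definition vst (s : store K mark) (b : bool) (a : rV) : store K mark :=
  match a with
  | inl (inl (u, u')) => ust (ust s (kt b) (kx b) u) (kt' b) (kx' b) u'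
  | inl (inr u) => ust s (kt b) (kx b) u
  | inr (inl i) => upd s (kp b) (at_p i)
  | inr (inr i) => upd s (kp b) (at_p i)
  end.

Definition uloop (kt0 kx0 : K) (f : cellval M -> prog K mark) :=
  scan kt0 (scan kx0 (seqs [seq f v | v <- enum {: cellval M}])).

Definition tu L t := tcl L (q * t + 1).

Lemma emits_uloop kt0 kx0 f s (ls : rU -> seq msym) t :
  ~~ gO kt0 -> ~~ gO kx0 -> kx0 != kt0 -> s kt0 = stage 3 -> s kx0 = stage 4 ->
  (forall u, emits gO (f u.2) (ust s kt0 kx0 u) (ls u) t) ->
  emits gO (uloop kt0 kx0 f) s (flatten [seq ls u | u <- enum {: rU}]) (tu rL t).
Proof.
move=> gt gx ne st sx h; rewrite -flatten_enum_prod.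
rewrite -(flatten_enum_prod (fun p => flatten [seq ls (p, v) | v <- enum {: cellval M}])).
apply: (emits_scan_ord gt scan_t) st _ => [|i]; first by rewrite /rL; clear; lia.
apply: (emits_scan_ord gx scan_x) => [||j]; first by rewrite /rL; clear; lia.
  by rewrite /upd (negPf ne).
have -> : q = size (enum {: cellval M}) by rewrite -cardE.
by apply: emits_seqs => v _; apply: (h ((i, j), v)).
Qed.

Definition vloop b (body : desc -> prog K mark) :=
  Seq (Seq (uloop (kt b) (kx b) (fun v => uloop (kt' b) (kx' b) (fun v' => body (DE v v'))))
           (uloop (kt b) (kx b) (fun v => body (DV v))))
      (Seq (scan (kp b) (body DP)) (scan (kp b) (body DQ))).

Definition tv L t := (tu L (tu L t) + tu L t) + (ts L t + ts L t).

Definition rest (b : bool) (s : store K mark) : Prop :=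
  [/\ s (kt b) = stage 3, s (kt' b) = stage 3, s (kx b) = stage 4, s (kx' b) = stage 4 &
     s (kp b) = stage 8].

Lemma emits_vloop b body s (ls : rV -> seq msym) t : rest b s ->
  (forall a, emits gO (body (vdesc a)) (vst s b a) (ls a) t) ->
  emits gO (vloop b body) s (flatten [seq ls a | a <- enum {: rV}]) (tv rL t).
Proof.
case=> st st' sx sx' sp h; rewrite -flatten_enum_sum.
have dL : rd' n <= rL by rewrite /rL /rm; clear; lia.
apply: emits_seq.
  rewrite -(flatten_enum_sum (fun a => ls (inl a))); apply: emits_seq.
    rewrite -flatten_enum_prod; apply: emits_uloop => //; try by case: (b).
    move=> u; apply: emits_uloop; try by case: (b).
    - by rewrite -st'; case: (b).
    - by rewrite -sx'; case: (b).
    - by move=> u'; apply: (h (inl (inl (u, u')))).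
  apply: emits_uloop => //; try by case: (b).
  by move=> u; apply: (h (inl (inr u))).
rewrite -(flatten_enum_sum (fun a => ls (inr a))); apply: emits_seq.
  apply: (emits_scan_ord _ scan_p dL sp) => [|i]; first by case: (b).
  exact: (h (inr (inl i))).
apply: (emits_scan_ord _ scan_p dL sp) => [|i]; first by case: (b).
exact: (h (inr (inr i))).
Qed.

Definition okk (k : K) := [&& k != kin, k != kout & k != ktmp].

Definition good (s : store K mark) : Prop :=
  s ktmp = cnt0 /\ forall k, okk k -> origin (s k).2 /\ (s k).1 <= rL.

Lemma good_upd s k a : okk k -> origin a.2 -> a.1 <= rL -> good s -> good (upd s k a).
Proof.
move=> /and3P[_ _ nt] oa la [st h]; split; first by rewrite /upd eq_sym (negPf nt).
by move=> k' ok'; rewrite /upd; case: ifP => // _; apply: h.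
Qed.

Lemma stage_good j : origin (stage j).2 /\ (stage j).1 <= rL.
Proof.
have oT l : plain l -> origin (taped l) /\ 0 <= rL by move=> /scannable_taped[].
have oN a m : a <= rL -> origin (nth None (mStart :: nseq m None)) /\ a <= rL.
  by move=> le; split=> //; apply: origin_nones.
have o1 : origin (nth None [:: mStart]) /\ 1 <= rL.
  by split; [exact: origin_start | rewrite /rL addn4].
have o0 := conj origin_start (leq0n rL).
case: j => [|[|[|[|[|[|[|[|[|[|[|j]]]]]]]]]]].
- exact: o1.
- exact: (oT _ (plain_bits w)).
- exact: (oT _ (plain_nones (rS n))).
- exact: (oT _ (plain_nones (rA n).+1)).
- exact: (oT _ plain_wcells).
- rewrite -[(stage 5).1]/(size (nseq (rA n) (None : msym))).+1 size_nseq.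
  by apply: (oN (rA n).+1); rewrite /rL; clear; lia.
- by apply: (oN (ra n)); rewrite /rL; clear; lia.
- by apply: (oN (rb n)); rewrite /rL; clear; lia.
- exact: (oT _ (plain_nones (rd' n))).
- by apply: (oN (rm n)); rewrite /rL; clear; lia.
- exact: o0.
by rewrite /stage nth_default.
Qed.

Lemma lev_le k : lev k <= 10.
Proof.
case: k => [[]|[i lti]] //=.
by do 18?[case: i lti => [|i] lti //].
Qed.

Lemma good_mid : good (mid 10).
Proof.
split=> // k /and3P[/negPf ni _ _]; rewrite /mid ni lev_le; exact: stage_good.
Qed.

Lemma good_vst s b a : good s -> good (vst s b a).
Proof.
have gt i k : i < (rA n).+1 -> okk k -> forall s, good s -> good (upd s k (at_t i)).
  move=> lti ok s1; apply: good_upd => //; first by case: scan_t.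
  by rewrite /rL /=; move: lti; clear; lia.
have gx i k : i < rwidth n -> okk k -> forall s, good s -> good (upd s k (at_x i)).
  move=> lti ok s1; apply: good_upd => //; first by case: scan_x.
  by rewrite /rL /=; move: lti; clear; lia.
have gp i k : i < rd' n -> okk k -> forall s, good s -> good (upd s k (at_p i)).
  move=> lti ok s1; apply: good_upd => //; first by case: scan_p.
  by rewrite /rL /rm /=; move: lti; clear; lia.
have gu k k' u : okk k -> okk k' -> forall s, good s -> good (ust s k k' u).
  move=> ok ok' s1 g1.
  exact: (gx _ _ (ltn_ord u.1.2) ok' _ (gt _ _ (ltn_ord u.1.1) ok _ g1)).
have [okt okx] : okk (kt b) /\ okk (kx b) by case: (b).
have [okt' okx'] : okk (kt' b) /\ okk (kx' b) by case: (b).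
have okp : okk (kp b) by case: (b).
move=> gs; case: a => [[[u u']|u]|[i|i]] /=.
- exact: (gu _ _ u' okt' okx' _ (gu _ _ u okt okx _ gs)).
- exact: (gu _ _ u okt okx _ gs).
- exact: (gp _ _ (ltn_ord i) okp _ gs).
- exact: (gp _ _ (ltn_ord i) okp _ gs).
Qed.

Definition tq L t := 4 * L + 10 + t.

Lemma emits_eqG k1 k2 f s l t : good s -> k1 != k2 -> okk k1 -> okk k2 ->
  emits gO (f ((s k1).1 == (s k2).1)) s l t -> emits gO (if_eq ktmp k1 k2 f) s l (tq rL t).
Proof.
move=> [s0 gs] n12 o1 o2; have [or1 l1] := gs _ o1; have [or2 l2] := gs _ o2.
case/and3P: o1 => i1 u1 m1; case/and3P: o2 => i2 u2 m2.
apply: (emits_eq n12 m1 m2) or1 or2 _ _ s0 l1 => //; exact: surjective_pairing.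
Qed.

Lemma emits_succG k1 k2 f s l t : good s -> k1 != k2 -> okk k1 -> okk k2 ->
  emits gO (f ((s k1).1.+1 == (s k2).1)) s l t -> emits gO (if_succ ktmp k1 k2 f) s l (tq rL t).
Proof.
move=> [s0 gs] n12 o1 o2; have [or1 l1] := gs _ o1; have [or2 l2] := gs _ o2.
case/and3P: o1 => i1 u1 m1; case/and3P: o2 => i2 u2 m2.
apply: (emits_succ n12 m1 m2) or1 or2 _ _ s0 l1 => //; exact: surjective_pairing.
Qed.

Lemma emits_cmpG k1 k2 f s l t : good s -> k1 != k2 -> okk k1 -> okk k2 ->
  emits gO (f ((s k1).1 <= (s k2).1) ((s k2).1 <= (s k1).1)) s l t ->
  emits gO (cmp ktmp k1 k2 f) s l (tq rL t).
Proof.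
move=> [s0 gs] n12 o1 o2; have [or1 l1] := gs _ o1; have [or2 l2] := gs _ o2.
case/and3P: o1 => i1 u1 m1; case/and3P: o2 => i2 u2 m2 h.
apply: (@emits_le _ _ _ _ _ (4 * rL + 4 + t)); first by rewrite leq_add2r leq_add2l.
apply: (emits_cmp n12 m1 m2) or1 or2 _ _ s0 l1 h => //; exact: surjective_pairing.
Qed.

Definition emitb (b : bool) : prog K mark := W gO (Some (inl b)).

(** The pair [(u, u')] is held by the loop level [b] and the vertex [z] by the other level. Each
    test continues with the rest of the program, so all the outcomes are known when the bit is
    written. *)
Definition evp (b : bool) (v v' vz : cellval M) : prog K mark :=
  if_eq ktmp (kt b) (kt' b) (fun teq => if_succ ktmp (kt b) (kt' b) (fun tsucc =>
  if_eq ktmp (kx b) (kx' b) (fun xeq => if_succ ktmp (kx b) (kx' b) (fun xsucc =>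
  if_succ ktmp (kx' b) (kx b) (fun xpred => if_eq ktmp (kt b) kZ (fun t0 =>
  if_eq ktmp (kt b) kA (fun tA => if_eq ktmp (kx b) kA (fun xA =>
  if_eq ktmp (kt (~~ b)) (kt b) (fun e1 => if_eq ktmp (kx (~~ b)) (kx b) (fun e2 =>
  if_eq ktmp (kt (~~ b)) (kt' b) (fun e3 => if_eq ktmp (kx (~~ b)) (kx' b) (fun e4 =>
  wr gO (fun r => Some (inl (~~ [&&
    compat_fun v v' teq tsucc xeq xsucc xpred t0 tA xA (r (kx b)) (r (kx' b)),
    ~~ [&& e1, e2 & vz == v] & ~~ [&& e3, e4 & vz == v']]))) Right)))))))))))).

Definition tev L := iter 12 (tq L) 1.

Lemma emits_evp b v v' vz s : good s ->
  emits gO (evp b v v' vz) s [:: Some (inl (~~ [&&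
    compat_fun v v' ((s (kt b)).1 == (s (kt' b)).1) ((s (kt b)).1.+1 == (s (kt' b)).1)
      ((s (kx b)).1 == (s (kx' b)).1) ((s (kx b)).1.+1 == (s (kx' b)).1)
      ((s (kx' b)).1.+1 == (s (kx b)).1) ((s (kt b)).1 == (s kZ).1)
      ((s (kt b)).1 == (s kA).1) ((s (kx b)).1 == (s kA).1)
      ((s (kx b)).2 (s (kx b)).1) ((s (kx' b)).2 (s (kx' b)).1),
    ~~ [&& (s (kt (~~ b))).1 == (s (kt b)).1, (s (kx (~~ b))).1 == (s (kx b)).1 & vz == v] &
    ~~ [&& (s (kt (~~ b))).1 == (s (kt' b)).1, (s (kx (~~ b))).1 == (s (kx' b)).1 &
        vz == v']]))] (tev rL).
Proof.
move=> gs; rewrite /evp /tev /=.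
apply: emits_eqG => //; try by case: (b).
apply: emits_succG => //; try by case: (b).
apply: emits_eqG => //; try by case: (b).
apply: emits_succG => //; try by case: (b).
apply: emits_succG => //; try by case: (b).
apply: emits_eqG => //; try by case: (b).
apply: emits_eqG => //; try by case: (b).
apply: emits_eqG => //; try by case: (b).
apply: emits_eqG => //; try by case: (b).
apply: emits_eqG => //; try by case: (b).
apply: emits_eqG => //; try by case: (b).
apply: emits_eqG => //; try by case: (b).
by apply: emits_wr => a; rewrite !ffunE /putg; case: (b).
Qed.

Definition pqp (b : bool) : prog K mark :=
  cmp ktmp (kp b) (kp (~~ b)) (fun le ge => if_eq ktmp (kp b) kAA (fun e1 =>
    if_eq ktmp (kp b) kBB (fun e2 => emitb (~~ (le && ~~ (le && ge && (e1 || e2))))))).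

Lemma emits_pqp b s : good s ->
  emits gO (pqp b) s [:: Some (inl (~~ (((s (kp b)).1 <= (s (kp (~~ b))).1) &&
    ~~ (((s (kp b)).1 == (s (kp (~~ b))).1) &&
        (((s (kp b)).1 == (s kAA).1) || ((s (kp b)).1 == (s kBB).1))))))] (iter 3 (tq rL) 1).
Proof.
move=> gs; rewrite /pqp /=.
apply: emits_cmpG => //; try by case: (b).
apply: emits_eqG => //; try by case: (b).
apply: emits_eqG => //; try by case: (b).
by rewrite -eqn_leq; apply: emits_W.
Qed.

Definition matentry (s1 s2 : bool) (d1 d2 : desc) : prog K mark :=
  if s1 == s2 then emitb false else
  match d1, d2 with
  | DE v v', DV z => evp false v v' z
  | DV z, DE v v' => evp true v v' z
  | DP, DQ => pqp false
  | DQ, DP => pqp true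
  | _, _ => emitb true
  end.

Definition rH := @cliqueH rU (@cell_compat M w (rA n) (rB n) (rT n)) (ra n) (rb n) (rd' n).
Definition rG : sgraph := dense_graph rH.
Definition vside (b : bool) (a : rV) : rG := if b then inr a else inl a.

Definition tme L := tev L + iter 3 (tq L) 1 + 1.

Lemma taped_x (i : 'I_(rwidth n)) : taped wcells i.+1 = nth None wcells i.
Proof.
have sz : size wcells = rwidth n by exact: size_cells_x.
by rewrite /taped -[LHS]/(nth None (wcells ++ [:: mEnd]) i) nth_cat sz ltn_ord.
Qed.

Lemma ev_bit b (u u' z : rU) (s : store K mark) :
  s (kt b) = at_t u.1.1 -> s (kx b) = at_x u.1.2 -> s (kt' b) = at_t u'.1.1 ->
  s (kx' b) = at_x u'.1.2 -> s (kt (~~ b)) = at_t z.1.1 -> s (kx (~~ b)) = at_x z.1.2 ->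
  s kZ = stage 0 -> s kA = stage 5 -> good s ->
  emits gO (evp b u.2 u'.2 z.2) s
    [:: Some (inl (~~ [&& cell_compat u u', z != u & z != u']))] (tev rL).
Proof.
move=> e1 e2 e3 e4 e5 e6 e7 e8 gs; have := emits_evp b u.2 u'.2 z.2 gs.
rewrite e1 e2 e3 e4 e5 e6 e7 e8 /= size_nseq !eqSS.
case: u {e1 e2} => [[t x] v]; case: u' {e3 e4} => [[t' x'] v']; case: z {e5 e6} => [[t3 x3] v3] /=.
rewrite !xpair_eqE -!andbA (taped_x x) (taped_x x').
by [].
Qed.

Lemma emits_matentry s1 s2 a1 a2 :
  emits gO (matentry s1 s2 (vdesc a1) (vdesc a2)) (vst (vst (mid 10) false a1) true a2)
    [:: Some (inl (edge (vside s1 a1) (vside s2 a2)))] (tme rL).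
Proof.
have gs : good (vst (vst (mid 10) false a1) true a2).
  by apply: good_vst; apply: good_vst; exact: good_mid.
have l1 : 1 <= tme rL by rewrite /tme; clear; lia.
have l2 : tev rL <= tme rL by rewrite /tme; clear; lia.
have l3 : iter 3 (tq rL) 1 <= tme rL by rewrite /tme; clear; lia.
have eb b : emits gO (emitb b) (vst (vst (mid 10) false a1) true a2) [:: Some (inl b)] (tme rL).
  by apply: emits_le l1 _; apply: emits_W.
rewrite /matentry; case: eqP => [<-|ne]; first by rewrite /vside; case: s1.
have edgeE : edge (vside s1 a1) (vside s2 a2) = ~~ rH a1 a2.
  case: s1 s2 ne => [] [] //= _; by rewrite /rH cliqueH_sym.
rewrite edgeE {edgeE}.
case: a1 a2 gs eb => [[[u u']|u]|[i|i]] [[[z z']|z]|[j|j]] gs eb; try exact: eb.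
- by apply: emits_le l2 _; apply: (@ev_bit false u u' z).
- by apply: emits_le l2 _; rewrite /rH cliqueH_sym; apply: (@ev_bit true z z' u).
- apply: emits_le l3 _; have := emits_pqp false gs; rewrite /upd /=.
  by rewrite ltnS eqSS /rH /= /half_skip.
- apply: emits_le l3 _; have := emits_pqp true gs; rewrite /upd /=.
  by rewrite ltnS eqSS /rH /= /half_skip.
Qed.

Definition sides (b : bool) (f : bool -> desc -> prog K mark) :=
  Seq (vloop b (f false)) (vloop b (f true)).

Lemma emits_sides b f s (ls : rG -> seq msym) t : rest b s ->
  (forall sd a, emits gO (f sd (vdesc a)) (vst s b a) (ls (vside sd a)) t) ->
  emits gO (sides b f) s (flatten [seq ls a | a <- enum rG]) (tv rL t + tv rL t).
Proof.
move=> rs h; have <- := flatten_enum_sum ls; apply: emits_seq.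
  by apply: emits_vloop => // a; apply: (h false).
by apply: emits_vloop => // a; apply: (h true).
Qed.

Definition prog_graph : prog K mark :=
  Seq (sides false (fun _ _ => emitb true))
    (Seq (emitb false)
       (sides false (fun s1 d1 => sides true (fun s2 d2 => matentry s1 s2 d1 d2)))).

Definition tgraph L := (tv L 1 + tv L 1) + (1 +
  (tv L (tv L (tme L) + tv L (tme L)) + tv L (tv L (tme L) + tv L (tme L)))).

Lemma emits_graph : emits gO prog_graph (mid 10)
  (bits mark (nseq #|rG| true ++ false :: adjacency rG)) (tgraph rL).
Proof.
have r0 : rest false (mid 10) by [].
have r1 a : rest true (vst (mid 10) false a).
  by case: a => [[[u u']|u]|[i|i]]; split.
rewrite /bits map_cat; apply: emits_seq.
  have := @emits_sides false (fun _ _ => emitb true) (mid 10) (fun=> [:: Some (inl true)]) 1 r0.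
  rewrite flatten_const repl1 -cardE map_nseq; apply=> sd a; exact: emits_W.
have adjE : bits mark (adjacency rG) =
   flatten [seq flatten [seq [:: Some (inl (edge x y)) : msym] | y <- enum rG] | x <- enum rG].
  rewrite /bits /adjacency map_flatten -map_comp; congr flatten; apply: eq_map => x /=.
  by rewrite -map_comp; elim: (enum rG) => //= y r ->.
apply: (emits_seq (l1 := [:: Some (inl false)]) (l2 := bits mark (adjacency rG))).
  exact: emits_W.
rewrite adjE; apply: emits_sides => // s1 a1; apply: emits_sides => // s2 a2.
exact: emits_matentry.
Qed.

(** * Binary expansion of the number of hunters *)

Definition hst (m i : nat) (o : atape mark) : store K mark := fun k =>
  if k == kout then o else if k == kM then (m, nth None (mStart :: nseq (rm n) None))
  else if k == ktmp then (i, nth None [:: mStart]) else mid 10 k.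

Definition hmove (d1 d2 : move) : prog K mark :=
  mvf (fun k => if k == kM then d1 else if k == ktmp then d2 else Stay).

(** The head of [kM] goes back two cells for each cell of [ktmp]. If it meets the origin halfway,
    the number is odd and the provisional bit [false] is overwritten. *)
Definition hinner : prog K mark :=
  While (fun r => ~~ at_start kM r)
    (Seq (hmove Left Stay)
       (If (at_start kM) (wr gO (fun=> Some (inl true)) Stay) (hmove Left Right))).

Definition hbody : prog K mark :=
  Seq (wr gO (fun=> Some (inl false)) Stay)
    (Seq hinner (Seq (mv gO Right) (While (fun r => ~~ at_start ktmp r) (hmove Right Left)))).

Definition halve : prog K mark := While (fun r => ~~ at_start kM r) hbody.

Lemma hst_M m i o : at_start kM (rd (hst m i o)) = (m == 0).
Proof. by rewrite /at_start ffunE /hst /= origin_nones. Qed.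

Lemma hst_tmp m i o : at_start ktmp (rd (hst m i o)) = (i == 0).
Proof. by rewrite /at_start ffunE /hst /= origin_start. Qed.

Lemma trans_hmove d1 d2 m i o m' i' :
  (is_move Left d1 -> 0 < m) -> (is_move Left d2 -> 0 < i) ->
  m' = shift d1 m -> i' = shift d2 i ->
  trans (hmove d1 d2) (hst m i o) (hst m' i' o) 1.
Proof.
move=> h1 h2 -> ->; apply: trans_mvf => k; rewrite /hst.
  case: (eqVneq k kM) => [->|nM] /=; first exact: h1.
  by case: (eqVneq k ktmp) => [->|nt] //=; exact: h2.
case: (eqVneq k kM) => [->|nM] //=; case: (eqVneq k ktmp) => [->|nt] //=.
by case: ifP => _; [case: (o)|case: (mid 10 k)].
Qed.

Definition wbit (l : seq msym) (b : bool) : atape mark :=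
  (size l, fun i => if i == size l then Some (inl b) else nth None l i).

Lemma trans_hinner m l :
  trans hinner (hst m 0 (wbit l false)) (hst 0 m./2 (wbit l (odd m))) (m * 4 + 1).
Proof.
(* For odd [m] the last double step is incomplete; the second case is the store after it. *)
pose F i := if i.*2 <= m then hst (m - i.*2) i (wbit l false) else hst 0 m./2 (wbit l true).
have F0 : F 0 = hst m 0 (wbit l false) by rewrite /F /= subn0.
have Fn : F (uphalf m) = hst 0 m./2 (wbit l (odd m)).
  rewrite /F; case om: (odd m).
    have -> : ((uphalf m).*2 <= m) = false by move: om; clear; lia.
    by [].
  have -> : (uphalf m).*2 <= m by move: om; clear; lia.
  by congr hst; move: om; clear; lia.
rewrite -F0 -Fn; apply: (@trans_le _ _ _ _ (uphalf m * 4 + 1)).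
  by rewrite leq_add2r leq_mul2r orbC; apply/orP; left; clear; lia.
apply: trans_while => [i lti|]; last by rewrite Fn hst_M.
have le : i.*2 < m by move: lti; clear; lia.
rewrite /F (ltnW le) hst_M subn_eq0 -ltnNge; split=> //.
apply: (@trans_seq _ _ _ _ (hst (m - i.*2).-1 i (wbit l false)) _ 1 2).
  by apply: trans_hmove => //; rewrite subn_gt0.
apply: trans_if; rewrite hst_M; case: eqP => e1.
  have -> : (i.+1.*2 <= m) = false by move: e1 le; clear; lia.
  rewrite e1; apply: trans_wr => // k; rewrite /hst /gO /=.
  have -> : m./2 = i by move: e1 le; clear; lia.
  case: ifP => // _; rewrite /wbit /=; congr (_, _); apply/funext=> j.
  by case: eqP.
have -> : i.+1.*2 <= m by move: e1 le; clear; lia.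
apply: trans_hmove => //=; move: e1 le; clear; lia.
Qed.

Lemma trans_hbody m l L : m <= L ->
  trans hbody (hst m 0 (lt l)) (hst m./2 0 (lt (rcons l (Some (inl (odd m)))))) (6 * L + 4).
Proof.
move=> mL; apply: (@trans_le _ _ _ _ (1 + ((m * 4 + 1) + (1 + (m./2 * 2 + 1))))).
  by move: mL; clear; lia.
apply: (@trans_seq _ _ _ _ (hst m 0 (wbit l false))).
  by apply: trans_wr => // k; rewrite /hst /gO /=; case: ifP.
apply: trans_seq (trans_hinner m l) _.
apply: (@trans_seq _ _ _ _ (hst 0 m./2 (lt (rcons l (Some (inl (odd m))))))).
  apply: trans_mvf => k; rewrite /hst /gO /=; case: ifP => // _.
    by rewrite /lt size_rcons -nth_rcons_fun.
  by case: (if _ then _ else _).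
set o := lt _; pose F i := hst i (m./2 - i) o.
have -> : hst 0 m./2 o = F 0 by rewrite /F subn0.
have -> : hst m./2 0 o = F m./2 by rewrite /F subnn.
apply: trans_while => [i lti|]; rewrite /F hst_tmp ?subnn // subn_eq0 -ltnNge; split=> //.
by apply: trans_hmove => //=; move: lti; clear; lia.
Qed.

Lemma trans_halve m l L : m <= L ->
  trans halve (hst m 0 (lt l))
    (hst 0 0 (lt (l ++ bits mark (if m is 0 then [::] else binary m)))) (m * (6 * L + 5) + 1).
Proof.
elim/ltn_ind: m l => m IH l mL; case: (posnP m) => [->|m0].
  by rewrite cats0; exists 1 => //; apply: exec_whilef; rewrite hst_M.
have m2 : m./2 < m by move: m0; clear; lia.
have [t2 le2 ex2] := IH m./2 m2 (rcons l (Some (inl (odd m)))) (leq_trans (ltnW m2) mL).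
have [t1 le1 ex1] := trans_hbody l mL.
exists (t1 + t2).+1.
  have : m./2.+1 * (6 * L + 5) <= m * (6 * L + 5) by rewrite leq_mul2r orbC; apply/orP; left; move: m0; clear; lia.
  by rewrite mulSn; move: le1 le2; clear; lia.
apply: exec_whilet ex1 _; first by rewrite hst_M -lt0n.
suff -> : l ++ bits mark (if m is 0 then [::] else binary m) =
    rcons l (Some (inl (odd m))) ++ bits mark (if m./2 is 0 then [::] else binary m./2) by [].
have -> : (if m is 0 then [::] else binary m) = binary m by case: (m) m0.
by rewrite binaryE // divn2 -cats1 -catA.
Qed.

(** The output is read from the head onwards, hence the final return to the origin and the step past
    [mStart]. *)
Definition prog_all : prog K mark :=
  Seq prog_init (Seq prog_graph (Seq halve (Seq (rewind kout gO) (mv gO Right)))).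

Definition renc : seq bool := nseq #|rG| true ++ false :: adjacency rG ++ binary (rm n).

Lemma rm_gt0 : 0 < rm n.
Proof.
have k1 : 1 < rk n.
  rewrite /rk; apply: (@leq_trans ((rA n).+1 * 1)); first by rewrite muln1.
  by rewrite leq_mul2l /rwidth; clear; lia.
have : 2 * 2 <= ra n by apply: leq_mul.
by rewrite /rm /rd'; clear; lia.
Qed.

Lemma size_renc : size renc = #|rG| + 1 + #|rG| * #|rG| + size (binary (rm n)).
Proof.
rewrite size_cat size_nseq /= size_cat size_allpairs -!cardE.
by rewrite addn1 !addSn addnS addnA.
Qed.

Definition tall L N := tinit L + (tgraph L + ((L * (6 * L + 5) + 1) + ((N * 2 + 1) + 1))).

Lemma trans_all : exists s, trans prog_all (start_store mark kin w) s
    (tall rL (size renc).+1) /\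
  forall i, (s kout).2 ((s kout).1 + i) = nth None (bits mark renc) i.
Proof.
pose l1 := mStart :: bits mark (nseq #|rG| true ++ false :: adjacency rG).
pose l2 := mStart :: bits mark renc.
have l2E : l1 ++ bits mark (binary (rm n)) = l2.
  by rewrite /l1 /l2 /renc cat_cons -map_cat -catA.
have o2 : origin (nth None l2).
  by case=> [|i] //=; case: (ltnP i (size renc)) => [lti|ge];
    [rewrite (nth_map false)|rewrite nth_default ?size_map].
pose s1 := hst 0 0 (lt [::]).
exists (putg gO s1 (1, nth None l2)); split; last first.
  by move=> i.
have mL : rm n <= rL by rewrite /rL; clear; lia.
have mid10 o : putg gO (mid 10) o = hst (rm n) 0 o.
  apply/funext=> k; rewrite /putg /gO /hst /=; case: ifP => // _.
  by case: (eqVneq k kM) => [->|_] //; case: (eqVneq k ktmp) => [->|_].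
have hput o : hst 0 0 o = putg gO s1 o.
  by apply/funext=> k; rewrite /putg /gO /s1 /hst /=; case: ifP.
apply: trans_seq trans_init _.
have -> : mid 10 = putg gO (mid 10) (lt [:: mStart]).
  by apply/funext=> k; rewrite /putg /gO /=; case: eqP => // ->.
apply: trans_seq (emits_graph [:: mStart]) _; rewrite -/l1 mid10.
apply: (@trans_seq _ _ _ _ (hst 0 0 (lt l2))).
  have th := trans_halve l1 mL.
  have e : (if rm n is 0 then [::] else binary (rm n)) = binary (rm n) by case: (rm n) rm_gt0.
  rewrite e l2E in th; apply: trans_le th; by rewrite leq_add2r leq_mul2r mL orbT.
rewrite hput; apply: (@trans_seq _ _ _ _ (putg gO s1 (0, nth None l2))).
  have -> : lt l2 = ((size renc).+1, nth None l2) by rewrite /lt /= size_map.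
  by apply: trans_rewind.
apply: trans_mvf => k; rewrite /putg /gO /=; case: ifP => // _.
by case: (s1 k).
Qed.

End Word.

(** * Polynomial bound on the running time of the reduction *)

Definition rLn n := n + rS n + (rA n).+1 + rwidth n + ra n + rb n + rm n + 4.

Lemma card_rU w : #|rU w| = rk (size w) * q.
Proof. by rewrite card_prod card_prod !card_ord. Qed.

Lemma card_rG w : #|rG w| <= 4 * rm (size w).
Proof.
rewrite card_sum; have -> : #|rV w| = rk (size w) * q * (rk (size w) * q) + rk (size w) * q +
    (rd' (size w) + rd' (size w)).
  by rewrite /rV /cliqueT !card_sum card_prod card_rU !card_ord.
by rewrite /rm; clear; lia.
Qed.

Lemma size_binary m : size (binary m) <= m.+1.
Proof.
rewrite size_mkseq ltnS; case: m => [|m]; first by rewrite trunc_log0.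
by apply: leq_trans (ltnW (ltn_expl _ _)) (trunc_logP _ _).
Qed.

Lemma tsize w : (size (renc w)).+1 <= 4 * rm (size w) + 1 +
  4 * rm (size w) * (4 * rm (size w)) + rm (size w) + 2.
Proof.
rewrite size_renc; have := leq_mul (card_rG w) (card_rG w).
have := card_rG w; have := size_binary (rm (size w)); clear; lia.
Qed.

Lemma poly_iter f g m : poly_bounded f -> poly_bounded g ->
  poly_bounded (fun n => iter m (ts (f n)) (g n)).
Proof.
move=> hf hg; elim: m => [|m IH] //=.
apply: poly_boundedD; last exact: poly_bounded_const.
by apply: poly_boundedM => //; apply: poly_boundedD => //; apply: poly_bounded_const.
Qed.

(* The head symbol is matched syntactically: unification would unfold products into sums. *)
Ltac pb := repeat first
  [ assumption | exact: poly_bounded_id | exact: poly_bounded_const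
  | lazymatch goal with
    | |- poly_bounded (fun n => addn _ _) => apply: poly_boundedD
    | |- poly_bounded (fun n => muln _ _) => apply: poly_boundedM
    | |- poly_bounded (fun n => expn _ _) => apply: poly_boundedX
    | _ => apply: poly_iter
    end ].

Lemma poly_rS : poly_bounded rS.
Proof.
apply: (@poly_bounded_le _ (fun n => n + n + 2 + (n ^ c + c))); last by pb.
by move=> n; rewrite /rS /rB addnn.
Qed.

Lemma poly_rA : poly_bounded rA.
Proof.
have hS := poly_rS.
apply: (@poly_bounded_le _ (fun n => rS n ^ c' + c' + rS n + q + 1)); last by pb.
by move=> n; rewrite addn1.
Qed.

Lemma poly_rk : poly_bounded rk.
Proof.
have hS := poly_rS; have hA := poly_rA.
apply: (@poly_bounded_le _ (fun n => (rA n + 1) * (rA n + rS n + rS n + rA n))); last by pb.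
by move=> n; rewrite /rk addn1 leq_mul2l /rwidth /rA /rS; clear; lia.
Qed.

Lemma poly_rm : poly_bounded rm.
Proof.
have hk := poly_rk.
apply: (@poly_bounded_le _ (fun n => rk n * q * (rk n * q) + rk n * q + (rk n * rk n + rk n * q.-1))); last by pb.
by move=> n; rewrite /rm leq_add2l /rd' leq_pred.
Qed.

Lemma poly_rLn : poly_bounded rLn.
Proof.
have hS := poly_rS; have hA := poly_rA; have hk := poly_rk; have hm := poly_rm.
apply: (@poly_bounded_le _ (fun n => n + rS n + (rA n + 1) + (rA n + rS n + rS n + rA n) +
  rk n * rk n + rk n * q.-1 + rm n + 4)); last by pb.
by move=> n; rewrite /rLn addn1 /rwidth /ra /rb /rA /rS; clear; lia.
Qed.

Lemma poly_tall f g : poly_bounded f -> poly_bounded g ->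
  poly_bounded (fun n => tall (f n) (g n)).
Proof.
move=> hf hg.
have hts h : poly_bounded h -> poly_bounded (fun n => ts (f n) (h n)) by move=> hh; rewrite /ts; pb.
have htcl h : poly_bounded h -> poly_bounded (fun n => tcl (f n) (h n)).
  by move=> hh; exact: (hts _ (hts _ hh)).
have htu h : poly_bounded h -> poly_bounded (fun n => tu (f n) (h n)).
  by move=> hh; apply: (htcl (fun n => q * h n + 1)); pb.
have htv h : poly_bounded h -> poly_bounded (fun n => tv (f n) (h n)).
  move=> hh; exact: (poly_boundedD (poly_boundedD (htu _ (htu _ hh)) (htu _ hh))
    (poly_boundedD (hts _ hh) (hts _ hh))).
have htB : poly_bounded (fun n => tB (f n)) by rewrite /tB; pb.
have htS : poly_bounded (fun n => tS (f n)).
  by rewrite /tS; apply: poly_boundedD; [apply: (hts); pb|pb].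
have htT : poly_bounded (fun n => tT (f n)).
  rewrite /tT; apply: poly_boundedD; first by pb.
  apply: poly_boundedD; first by pb.
  by apply: poly_boundedD; [apply: (hts); pb|pb].
have ht1 : poly_bounded (fun n => t1 (f n)) by rewrite /t1; pb.
have hc1 := poly_bounded_const 1; have hc2 := poly_bounded_const (1 + 1).
have hcq := poly_bounded_const (q * 1 + 1); have hcq1 := poly_bounded_const (q.-1 * 1 + 1).
have hts2 := hts _ hc2; have hts1 := hts _ hc1.
have ht4 : poly_bounded (fun n => t4 (f n)) by rewrite /t4; pb.
have hcc := htcl _ (htcl _ hc1); have hcq1' := htcl _ hcq1; have hcq' := htcl _ hcq.
have ht8 : poly_bounded (fun n => t8 (f n)) by rewrite /t8; pb.
have hcq2 : poly_bounded (fun n => tcl (f n) (q * tcl (f n) (q * 1 + 1) + 1)) by apply: (htcl); pb.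
have ht9 : poly_bounded (fun n => t9 (f n)) by rewrite /t9; pb.
have hti : poly_bounded (fun n => tinit (f n)) by rewrite /tinit; pb.
have hme : poly_bounded (fun n => tme (f n)) by rewrite /tme /tev /= /tq; pb.
have hv1 := htv _ hc1; have hvm := htv _ hme; have hvv := htv _ (poly_boundedD hvm hvm).
have htg : poly_bounded (fun n => tgraph (f n)) by rewrite /tgraph; pb.
by rewrite /tall; pb.
Qed.

Theorem renc_polytime : polytime renc.
Proof.
have hm := poly_rm; have hL := poly_rLn.
pose N n := 4 * rm n + 1 + 4 * rm n * (4 * rm n) + rm n + 2.
have hN : poly_bounded N by rewrite /N; pb.
apply: (@exec_polytime K mark kin kout isT prog_all renc (fun n => tall (rLn n) (N n))).
  exact: poly_tall.
move=> w; have [s [[t le ex] out]] := trans_all w; exists s, t; split=> //.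
apply: leq_trans le _; rewrite /tall; have := tsize w; rewrite -/(N (size w)).
by rewrite -[rL w]/(rLn (size w)); clear; lia.
Qed.

Lemma q_gt1 : 1 < q.
Proof.
pose r (o : option (bool + aux M)) : reading M := [ffun=> o].
apply/card_gt1P; exists (start M, r None, r None), (start M, r None, r (Some (inl true))).
split=> //; apply/eqP=> -[/ffunP/(_ ord0)]; by rewrite !ffunE.
Qed.

Lemma rk_gt1 n : 1 < rk n.
Proof.
rewrite /rk; apply: (@leq_trans ((rA n).+1 * 1)); first by rewrite muln1.
by rewrite leq_mul2l /rwidth; clear; lia.
Qed.

Lemma q_le_rk n : q <= rk n.
Proof.
apply: (@leq_trans ((rA n).+1 * 1)); first by rewrite muln1 /rA /rT; clear; lia.
by rewrite leq_mul2l /rwidth; clear; lia.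
Qed.

Lemma rG_hn w : hn (rG w) <= rm (size w) <->
  exists2 S : {set rU w}, #|S| = #|cell w (rA (size w)) (rB (size w)) (rT (size w))| &
    forall p p', p \in S -> p' \in S -> cell_compat p p'.
Proof.
have -> : #|cell w (rA (size w)) (rB (size w)) (rT (size w))| = rk (size w).
  by rewrite card_prod !card_ord.
exact: (@hn_cliqueP (rU w) (@cell_compat M w _ _ _) (rk (size w)) q (card_rU w)
  (rk_gt1 _) q_gt1 (q_le_rk _)).
Qed.

End Reduction.

(** * Hardness of Hunting on bipartite graphs *)

Theorem hunting_NP_hard :
  NP_hard (@restrict Hunting (fun x => bipartite (hunting_graph x))).
Proof.
move=> Lg [V [c [[M [c' MV]] LV]]].
pose inst w : {x : instance Hunting | bipartite (hunting_graph x)} :=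
  exist _ (@HuntingInstance (rG M c c' w) (rm M c c' (size w)) (rm_gt0 M c c' w))
    (dense_bipartite _).
exists inst; split; first exact: (renc_polytime M c c').
move=> w; rewrite LV /=; symmetry.
apply: iff_trans (rG_hn M c c' w) _.
apply: (tableauP (V := V) (c' := c')) => // [m lem|].
  have le1 : m ^ c' <= rS c (size w) ^ c' by case: (c') => // c1; rewrite leq_exp2r.
  by rewrite /rA /rT; move: le1; clear; lia.
by rewrite /rA; clear; lia.
Qed.

Theorem theorem5 :
  NP_hard (@restrict Hunting (fun x => bipartite (hunting_graph x))) /\
  (exists Fam : sgraph -> Prop,
     infinite_family Fam /\
     forall c : nat, exists N : nat, forall G : sgraph,
       Fam G -> N <= #|G| ->
       forall s : seq {set G}, shortest_winning (hn G) s -> #|G| ^ c < size s).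
Proof. by split; [exact: hunting_NP_hard | exact: superpolynomial_hunting]. Qed.
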